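(* Consider the sequence of distributed systems under the RJSQ policy described in the context (origins unknown or known). Assume the systems are initially empty, $\lim_{n\to\infty}\sqrt n(1-\rho_n)=\beta\in\mathbb R$, $\lim_{n\to\infty}\chi_n=0$, $\lim_{n\to\infty}\sqrt n\chi_n=\infty$, and moreover \[ \mathbb E[z(1)^4]+\sum_{k=1}^s\mathbb E[w_k(1)^4]<\infty\quad\text{and}\quad \lim_{n\to\infty}\frac{\sqrt n\chi_n}{\sqrt{\log\log n}}=\infty . \] Then there exist positive numbers $C$ and $C'$ such that, for every $T>0$, with probability 1, \[ \sup_{0\le t\le T}\max_{k,\ell=1,\ldots,s}|\tilde L_{n,k}(t)-\tilde L_{n,\ell}(t)|<\max\Big\{C\chi_n,\;C'\frac{\log\log n+\log(n\chi_n^2)}{\sqrt n\chi_n}\Big\} \] for all $n$ sufficiently large. Furthermore, if the systems are initially empty, $\lim\sqrt n(1-\rho_n)=\beta\in\mathbb R$, $\lim\chi_n=0$, $\lim\sqrt n\chi_n=\infty$, $\mathbb E[z(1)^4]+\sum_k\mathbb E[w_k(1)^4]<\infty$ and $\lim_{n\to\infty}\sqrt n\chi_n/\log\log n=\infty$, then for every $T>0$, with probability 1, \[ \lim_{n\to\infty}\sup_{0\le t\le T}\max_{k,\ell=1,\ldots,s}|\tilde L_{n,k}(t)-\tilde L_{n,\ell}(t)|=0. \]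
   Context: Setting (distributed systems under RJSQ). Fix integers $s\ge 2$, $b\ge 1$, and rates $0<\mu_1\le\cdots\le\mu_s$; put $\mu=\sum_{k=1}^s\mu_k$. For each $n\in\mathbb{N}$ there is a system with $s$ stations; each station has one work-conserving server, unlimited waiting room and FCFS discipline. All systems are driven by the following mutually independent primitives: (1) i.i.d. nonnegative $z(1),z(2),\ldots$ with mean $1$ and coefficient of variation $c_0<\infty$; (2) for each $k$, i.i.d. nonnegative $w_k(1),w_k(2),\ldots$ with mean $1$ and coefficient of variation $c_k<\infty$, where $w_k(i)$ is the service requirement of the $i$th customer served at station $k$, whose service time there is $w_k(i)/\mu_k$; (3) i.i.d. random vectors $\boldsymbol\gamma(j)=(\gamma_1(j),\ldots,\gamma_s(j))$ with $\mathbb{P}[\boldsymbol\gamma(j)=\boldsymbol d_m]=p_m>0$ for $m=1,\ldots,b$, where $\boldsymbol d_m=(d_{m,1},\ldots,d_{m,s})\in\mathbb{R}_+^s$ and $\sum_m p_m=1$ (customer $j$ is ''from origin $m$'' if $\boldsymbol\gamma(j)=\boldsymbol d_m$); (4) i.i.d. uniform$(0,1)$ variables $u(1),u(2),\ldots$. In system $n$, with $\lambda_n>0$ and $\rho_n=\lambda_n/\mu$, customer $j$ appears at time $a_n(j)=\sum_{i\le j}z(i)/\lambda_n$; if sent to station $k$ it arrives there at time $a_n(j)+\sqrt{n}\gamma_k(j)$ and stays until its service completes. $Q_{n,k}(t)$ is the number of customers present at station $k$ at time $t$, $L_{n,k}(t)=Q_{n,k}(t)/\mu_k$, $\tilde Q_{n,k}(t)=Q_{n,k}(nt)/\sqrt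 n$, $\tilde L_{n,k}(t)=\tilde Q_{n,k}(t)/\mu_k$. A routing plan is an array $r_{m,k}\in[0,1]$ with $\sum_k r_{m,k}=1$ for each $m$ and $\mu_k=\mu\sum_m p_m r_{m,k}$ for each $k$. RJSQ policy with balancing fraction $\chi_n>0$: when customer $j$ appears, a permutation $(\zeta_{n,1}(j),\ldots,\zeta_{n,s}(j))$ of $\{1,\ldots,s\}$ is chosen with $L_{n,\zeta_{n,1}(j)}(a_n(j)-)\le\cdots\le L_{n,\zeta_{n,s}(j)}(a_n(j)-)$ (ties broken by an arbitrary rule), and $\pi_{n,k}(j)=\ell$ iff $\zeta_{n,\ell}(j)=k$. Perturbation coefficients $\varepsilon_{n,1},\ldots,\varepsilon_{n,s}$ satisfy $\sum_\ell\varepsilon_{n,\ell}=0$, $\varepsilon_{n,1}=\chi_n$, $\varepsilon_{n,\ell}<0$ for $\ell\ge2$, $0\le\mu_k/\mu+\varepsilon_{n,\ell}\le1$ for all $k,\ell$, and there is $\delta_0>0$ with $\varepsilon_{n,\ell}\le-\delta_0\chi_n$ for all $\ell\ge2$ and $n$. If origins are unknown, customer $j$ is sent to station $k$ iff $\kappa_{n,k-1}(j)\le u(j)<\kappa_{n,k}(j)$, where $\kappa_{n,0}(j)=0$ and $\kappa_{n,k}(j)=\sum_{\ell\le k}(\mu_\ell/\mu+\varepsilon_{n,\pi_{n,\ell}(j)})$ (the routing plan is then $r_{m,k}=\mu_k/\mu$). If origins are known, a routing plan $r$ is fixed and coefficients $\varepsilon^m_{n,\ell}(j)$ ($m\le b$,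 $\ell\le s$, $j\in\mathbb N$), determined by $(\pi_{n,1}(j),\ldots,\pi_{n,s}(j))$, satisfy $\sum_\ell\varepsilon^m_{n,\ell}(j)=0$, $\sum_m p_m\varepsilon^m_{n,\ell}(j)=\varepsilon_{n,\ell}$, $\varepsilon^m_{n,1}(j)\ge0$, $\varepsilon^m_{n,\ell}(j)\le0$ for $\ell\ge2$, and $0\le r_{m,k}+\varepsilon^m_{n,\pi_{n,k}(j)}(j)\le1$; a customer $j$ from origin $m$ is sent to station $k$ iff $\kappa^m_{n,k-1}(j)\le u(j)<\kappa^m_{n,k}(j)$, where $\kappa^m_{n,0}(j)=0$, $\kappa^m_{n,k}(j)=\sum_{\ell\le k}(r_{m,\ell}+\varepsilon^m_{n,\pi_{n,\ell}(j)}(j))$. ''Initially empty'' means no customers are present at time $0$. *)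

(* Defs.v *)
From HB Require Import structures.
From mathcomp Require Import all_boot all_order all_algebra all_fingroup.
From mathcomp Require Import all_classical all_reals all_analysis.

Set Implicit Arguments.
Unset Strict Implicit.
Unset Printing Implicit Defensive.

Import Order.TTheory GRing.Theory Num.Theory.
Local Open Scope classical_set_scope.
Local Open Scope ring_scope.

Definition mutual_indep d (Omega : measurableType d) (R : realType)
  (P : probability Omega R) (I : eqType) (X : I -> Omega -> R) : Prop :=
  forall (F : seq I) (B : I -> set R), uniq F ->
    (forall i, measurable (B i)) ->
    P (\bigcap_(i in [set` F]) (X i @^-1` B i)) =
    \big[*%E/1%E]_(i <- F) P (X i @^-1` B i).

Definition prim_index (s : nat) : eqType := ((nat + ('I_s * nat)) + (nat + nat))%type.

Definition prim_rv d (Omega : measurableType d) (R : realType) (s b : nat)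
  (z : nat -> Omega -> R) (w : 'I_s -> nat -> Omega -> R)
  (org : nat -> Omega -> 'I_b) (u : nat -> Omega -> R)
  (x : prim_index s) : Omega -> R :=
  match x with
  | inl (inl i) => z i
  | inl (inr (k, i)) => w k i
  | inr (inl j) => fun om => (nat_of_ord (org j om))%:R
  | inr (inr j) => u j
  end.

(* Sample-path dynamics of system n (customers and indices are 0-based:      *)
(* customer j here is customer j+1 of the paper, w k i is the requirement of *)
(* the (i+1)-th customer served at station k, rank l : 'I_s is rank l+1).    *)
Section Dynamics.
Variables (R : realType) (s b : nat).
Variable mu : 'I_s -> R.
Variable dvec : 'I_b -> 'I_s -> R.
Variables (n : nat) (lam : R).
Variables (z : nat -> R) (w : 'I_s -> nat -> R) (org : nat -> 'I_b) (u : nat -> R).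
Variable known : bool.
Variable r : 'I_b -> 'I_s -> R.
Variable eps : 'I_s -> R.                (* eps_{n,l}, l = rank *)
Variable epsm : 'I_b -> 'I_s -> {perm 'I_s} -> R.
  (* epsm m l pi = eps^m_{n,l}(j) when (pi_{n,1}(j),...,pi_{n,s}(j)) = pi *)
Variable tb : nat -> ('I_s -> R) -> {perm 'I_s}.
  (* tie-breaking rule: tb j L = zeta_n(j) (zeta l = station of rank l),
     chosen from the load vector L = L_n(a_n(j)-) *)

Definition mutot : R := \sum_(k < s) mu k.

Definition appear (j : nat) : R := (\sum_(i < j.+1) z i) / lam.

Definition arrive (j : nat) (k : 'I_s) : R :=
  appear j + Num.sqrt (n%:R) * dvec (org j) k.

(* sig : the stations to which customers 0, ..., size sig - 1 were sent    *)
Definition custs_at (sig : seq (option 'I_s)) (k : 'I_s) : seq nat :=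
  [seq c <- iota 0 (size sig) | onth sig c == Some (Some k)].

Definition fcfs_le (k : 'I_s) (c c' : nat) : bool :=
  (arrive c k < arrive c' k) || ((arrive c k == arrive c' k) && (c <= c')%N).

Definition queue_order sig k : seq nat := sort (fcfs_le k) (custs_at sig k).

Fixpoint departures (prev : option R) (l : seq (R * R)) : seq R :=
  match l with
  | [::] => [::]
  | (a, sv) :: l' =>
      let dep := (if prev is Some p then Num.max a p else a) + sv in
      dep :: departures (Some dep) l'
  end.

Definition station_data sig k : seq (R * R) :=
  let l := queue_order sig k in
  let As := [seq arrive c k | c <- l] in
  let Ss := [seq w k i / mu k | i <- iota 0 (size l)] in
  zip As (departures None (zip As Ss)).

Definition qlen sig k (t : R) : nat :=
  count (fun ad => (ad.1 <= t) && (t < ad.2)) (station_data sig k).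
Definition qlen_left sig k (t : R) : nat :=
  count (fun ad => (ad.1 < t) && (t <= ad.2)) (station_data sig k).

Definition route_weight (pi : {perm 'I_s}) (m : 'I_b) (l : 'I_s) : R :=
  if known then r m l + epsm m (pi l) pi
  else mu l / mutot + eps (pi l).

Definition route_decision (zeta : {perm 'I_s}) (m : 'I_b) (x : R) : option 'I_s :=
  let pi := (zeta^-1)%g in
  [pick k : 'I_s | (\sum_(l < s | (l < k)%N) route_weight pi m l <= x)
                   && (x < \sum_(l < s | (l <= k)%N) route_weight pi m l)].

Definition loads_before sig (j : nat) : 'I_s -> R :=
  fun k => (qlen_left sig k (appear j))%:R / mu k.

Fixpoint assign (j : nat) : seq (option 'I_s) :=
  if j is j'.+1 then
    let sig := assign j' in
    rcons sig (route_decision (tb j' (loads_before sig j')) (org j') (u j'))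
  else [::].

(* system truncated to its first M customers (initially empty) *)
Definition Q_trunc (M : nat) (k : 'I_s) (t : R) : nat := qlen (assign M) k t.

Definition Qlen (k : 'I_s) (t : R) : nat :=
  xget 0%N [set q | exists N, forall M, (N <= M)%N -> Q_trunc M k t = q].

Definition Ltilde (k : 'I_s) (t : R) : R :=
  (Qlen k (n%:R * t))%:R / Num.sqrt (n%:R) / mu k.

Definition imbalance (T : R) : R :=
  sup [set x | exists t k l, 0 <= t <= T /\ x = `|Ltilde k t - Ltilde l t|].

End Dynamics.

Definition sys_imbalance d (Omega : measurableType d) (R : realType) (s b : nat)
  (mu : 'I_s -> R) (dvec : 'I_b -> 'I_s -> R) (lam : nat -> R)
  (z : nat -> Omega -> R) (w : 'I_s -> nat -> Omega -> R)
  (org : nat -> Omega -> 'I_b) (u : nat -> Omega -> R)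
  (known : bool) (r : 'I_b -> 'I_s -> R) (eps : nat -> 'I_s -> R)
  (epsm : nat -> 'I_b -> 'I_s -> {perm 'I_s} -> R)
  (tb : nat -> nat -> ('I_s -> R) -> {perm 'I_s})
  (om : Omega) (n : nat) (T : R) : R :=
  imbalance mu dvec n (lam n) (fun i => z i om) (fun k i => w k i om)
    (fun j => org j om) (fun j => u j om) known r (eps n) (epsm n) (tb n) T.

(* Main.v *)
(** On every window of [l] steps, each driving random walk (interappearance times, service
    requirements, routing decisions) stays within [c chi_n l + C B_n] of its mean, almost
    surely, for all large [n] and all windows in [0, K n]; here [B_n] is [sqrt n] times the
    bound to be proved and [c] is as small as desired. For the i.i.d. walks this is an
    exponential maximal inequality for truncated variables on blocks of length of order
    [B_n / chi_n], together with the Borel-Cantelli lemma along geometric scales of [n]. The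
    routing thresholds depend on the past, but they differ from those of the routing plan by
    [O(chi_n)], so that the difference has conditional variance [O(chi_n)] and a union bound
    over all windows suffices.

    The rest is a sample-path argument. While the load of a station exceeds the average load
    its server is busy and the station is never ranked first, so that its excess over the
    average decreases at rate [delta0 chi_n] up to noise. Going back to the last time at which
    there was no excess bounds it by a multiple of [B_n]; a bound on all excesses bounds the
    deficits as well. *)
Require Import Defs.
From HB Require Import structures.
From mathcomp Require Import all_boot all_order all_algebra all_fingroup.
From mathcomp Require Import all_classical all_reals all_analysis.
From mathcomp Require Import measurable_realfun ring lra zify.
Set Implicit Arguments.
Unset Strict Implicit.
Unset Printing Implicit Defensive.
Import Order.TTheory GRing.Theory Num.Theory numFieldNormedType.Exports.
Local Open Scope classical_set_scope.
Local Open Scope ring_scope.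

(** * Independence of sigma-algebras generated by disjoint families *)

(** Each term of the bound pays for something specific. The i.i.d. walks are the same for every [n],
    so blocks need only be examined at the scales $16^q$; up to logarithmic factors there are $n
    \chi_n^2$ of them, whence $\log(n\chi_n^2)$, and summability over the scales costs $\log\log n$.
    With four moments the variables can be truncated at order $n^{1/4}$, changing only finitely many
    terms; where $\chi_n$ is too large for exponential moments at that level, a smaller slope of
    order $n^{-1/4}\log n$ is used, and $\sqrt n\chi_n$ dominates there. The routing noise varies
    with [n], so its bad events must be summable over [n] itself: the two terms of $B_n$ have
    product at least $\sqrt n$, hence $B_n^4 \ge n$ and $e^{-B_n}$ outweighs the number of windows.
    Finally, a customer may reach its station a time of order $\sqrt n$ after being routed. The
    order $\sqrt n$ customers on their way carry a total bias of order $\sqrt n\chi_n \le B_n$, so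
    feedback based on old information costs no more than the noise. *)

Definition cyl {T : Type} {R : realType} {I : eqType} (X : I -> T -> R)
    (J : pred I) : set (set T) :=
  [set A | exists (F : seq I) (B : I -> set R),
     [/\ uniq F, all J F, forall i, measurable (B i) &
         A = \bigcap_(i in [set` F]) (X i @^-1` B i)]].

Lemma cyl_setI {T : Type} {R : realType} {I : eqType} (X : I -> T -> R)
    (J : pred I) : setI_closed (cyl X J).
Proof.
move=> _ _ [F1 [B1 [u1 J1 m1 ->]]] [F2 [B2 [u2 J2 m2 ->]]].
exists (undup (F1 ++ F2)).
exists (fun i => (if i \in F1 then B1 i else setT) `&` (if i \in F2 then B2 i else setT)).
split.
- exact: undup_uniq.
- by rewrite (eq_all_r (mem_undup _)) all_cat J1.
- by move=> i; apply: measurableI; case: ifP.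
- apply/seteqP; split => [x [h1 h2] i|x h].
    rewrite /= mem_undup mem_cat => _; split; case: ifP => //= iF; [exact: h1|exact: h2].
  split => i /= iF; have := h i; rewrite /= mem_undup mem_cat iF ?orbT => /(_ isT) [] //.
Qed.

Lemma cyl_coord {T : Type} {R : realType} {I : eqType} (X : I -> T -> R)
    (J : pred I) i (B : set R) : J i -> measurable B -> cyl X J (X i @^-1` B).
Proof.
move=> Ji mB; exists [:: i], (fun=> B); split => //; first by rewrite /= Ji.
by apply/seteqP; split => [x hx j /=|x]; [rewrite inE => /eqP ->|apply; rewrite /= inE].
Qed.

Lemma cyl_sub {T : Type} {R : realType} {I : eqType} (X : I -> T -> R)
    (J J' : pred I) : subpred J J' -> cyl X J `<=` cyl X J'.
Proof.
by move=> JJ' _ [F [B [uF JF mB ->]]]; exists F, B; split => //; apply: sub_all JF.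
Qed.

Section Indep.
Context {d} {Omega : measurableType d} {R : realType} (P : probability Omega R).
Local Open Scope ereal_scope.

(** Pi-lambda argument: the [A] satisfying the product formula with the fixed [B] form a
    lambda-system. The cylinders [cyl] will serve as the pi-system [G], since [mutual_indep] speaks
    of exactly such sets. *)
Lemma indep_generated (G : set (set Omega)) (B : set Omega) :
  setI_closed G -> G `<=` measurable -> measurable B ->
  (forall A, G A -> P (A `&` B) = P A * P B) ->
  forall A, <<s G >> A -> P (A `&` B) = P A * P B.
Proof.
move=> GI Gm mB GB.
pose H := [set A | measurable A /\ P (A `&` B) = P A * P B].
suff: <<s G >> `<=` H by move=> h A /h [].
apply: lambda_system_subset => //; last by move=> A GA; split; [exact: Gm|exact: GB].
split => //.
- by split; rewrite ?setTI ?probability_setT ?mul1e.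
- move=> A C CA [mA PA] [mC PC]; split; first exact: measurableD.
  have -> : (A `\` C) `&` B = (A `&` B) `\` (C `&` B).
    by apply/seteqP; split => x /=; tauto.
  rewrite !measureD //; try exact: measurableI;
    try by rewrite ltey_eq fin_num_measure //; exact: measurableI.
  have -> : (A `&` B) `&` (C `&` B) = C `&` B.
    by apply/seteqP; split => x /= => [[_ []]|[c ?]]; split => //; split => //; exact: CA.
  rewrite (setIidr CA); change (P (A `&` B) - P (C `&` B) = (P A - P C) * P B); rewrite PA PC.
  by rewrite muleBl // ?fin_num_measure // fin_num_adde_defl // ?fin_numN fin_num_measure.
- move=> F ndF HF; split; first by apply: bigcup_measurable => i _; have [] := HF i.
  have mF i : measurable (F i) by have [] := HF i.
  have c1 : P (F n) @[n --> \oo] --> P (\bigcup_n F n).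
    by apply: nondecreasing_cvg_mu => //; apply: bigcup_measurable.
  have c2 : P (F n `&` B) @[n --> \oo] --> P ((\bigcup_n F n) `&` B).
    rewrite setI_bigcupl; apply: (nondecreasing_cvg_mu (F := fun n => F n `&` B)).
    - by move=> i; exact: measurableI.
    - by apply: bigcup_measurable => i _; exact: measurableI.
    - by move=> m n mn; apply/subsetPset; apply: setSI; apply/subsetPset/ndF.
  have c3 : P (F n) * P B @[n --> \oo] --> P (\bigcup_n F n) * P B.
    by apply: cvgeZr => //; rewrite fin_num_measure.
  have e : (fun n => P (F n `&` B)) = (fun n => P (F n) * P B).
    by apply/funext => n; have [] := HF n.
  by rewrite e in c2; exact: (cvg_unique _ c2 c3).
Qed.

Section Family.
Context {I : eqType} (X : I -> Omega -> R).
Hypothesis mX : forall i, measurable_fun setT (X i).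
Hypothesis iX : mutual_indep P X.

Lemma cyl_measurable J : cyl X J `<=` measurable.
Proof.
move=> _ [F [B [uF JF mB ->]]]; apply: fin_bigcap_measurable => //.
by move=> i _; rewrite -[_ @^-1` _]setTI; exact: mX.
Qed.

Lemma sigma_cyl_measurable J : <<s cyl X J >> `<=` measurable.
Proof.
apply: smallest_sub; last exact: cyl_measurable.
exact: sigma_algebra_measurable.
Qed.

Lemma cyl_indep (J1 J2 : pred I) A1 A2 : (forall i, J1 i -> ~~ J2 i) ->
  cyl X J1 A1 -> cyl X J2 A2 -> P (A1 `&` A2) = P A1 * P A2.
Proof.
move=> J12 [F1 [B1 [u1 j1 m1 ->]]] [F2 [B2 [u2 j2 m2 ->]]].
have d12 i : i \in F2 -> i \notin F1.
  move=> /(allP j2) i2; apply/negP => /(allP j1)/J12; by rewrite i2.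
pose B i := if i \in F1 then B1 i else B2 i.
have -> : \bigcap_(i in [set` F1]) (X i @^-1` B1 i) `&` \bigcap_(i in [set` F2]) (X i @^-1` B2 i)
    = \bigcap_(i in [set` F1 ++ F2]) (X i @^-1` B i).
  apply/seteqP; split => [x [h1 h2] i /=|x h].
    rewrite mem_cat /B; case: ifPn => iF /=; [by move=> _; exact: h1|exact: h2].
  split => i /= iF; have := h i; rewrite /= mem_cat iF ?orbT => /(_ isT); rewrite /B.
    by rewrite iF.
  by rewrite (negbTE (d12 _ iF)).
rewrite iX; last 2 first.
- rewrite cat_uniq u1 u2 andbT /=; apply/hasPn => i; exact: d12.
- by move=> i; rewrite /B; case: ifP.
rewrite big_cat /= !iX //; congr (_ * _); apply: eq_big_seq => i iF; rewrite /B.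
  by rewrite iF.
by rewrite (negbTE (d12 _ iF)).
Qed.

(** The pi-lambda step is applied twice, with the roles of the two families exchanged. *)
Lemma sigma_cyl_indep (J1 J2 : pred I) A1 A2 : (forall i, J1 i -> ~~ J2 i) ->
  <<s cyl X J1 >> A1 -> <<s cyl X J2 >> A2 -> P (A1 `&` A2) = P A1 * P A2.
Proof.
move=> J12 s1 s2; have m2 := @sigma_cyl_measurable J2 _ s2.
move: A1 s1; apply: indep_generated => //; [exact: cyl_setI|exact: cyl_measurable|].
move=> A1 c1; rewrite setIC muleC.
move: A2 s2 m2 => A2 s2 _; move: A2 s2; apply: indep_generated => //.
- exact: cyl_setI.
- exact: cyl_measurable.
- exact: cyl_measurable c1.
- by move=> A2 c2; rewrite setIC muleC; exact: cyl_indep c1 c2.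
Qed.

End Family.

(** The joint law agrees with the product of the marginals on rectangles, hence everywhere; Tonelli
    then separates the integral. *)
Lemma expectation_indepM (Y f : Omega -> R) :
  measurable_fun setT Y -> measurable_fun setT f ->
  (forall x, 0 <= Y x)%R -> (forall x, 0 <= f x)%R ->
  (forall A B : set R, measurable A -> measurable B ->
     P (Y @^-1` A `&` f @^-1` B) = P (Y @^-1` A) * P (f @^-1` B)) ->
  \int[P]_x (Y x * f x)%:E = (\int[P]_x (Y x)%:E) * (\int[P]_x (f x)%:E).
Proof.
move=> mY mf Y0 f0 ind.
pose Yf x := (Y x, f x).
have mYf : measurable_fun setT Yf by exact: measurable_fun_pair.
pose Yp : {RV P >-> R} := HB.pack Y (isMeasurableFun.Build _ _ _ _ _ mY).
pose fp : {RV P >-> R} := HB.pack f (isMeasurableFun.Build _ _ _ _ _ mf).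
pose Yfp : {RV P >-> (R * R)%type} := HB.pack Yf (isMeasurableFun.Build _ _ _ _ _ mYf).
(* The absolute values make the integrand nonnegative on the whole plane, as Tonelli requires; on
   the range of [Y] and [f] they change nothing. *)
pose g (z : R * R) : \bar R := (`|z.1| * `|z.2|)%:E.
have mg : measurable_fun [set: R * R] g.
  apply/measurable_EFinP; apply: measurable_funM.
    by apply: measurableT_comp; [exact: normr_measurable|exact: measurable_fst].
  by apply: measurableT_comp; [exact: normr_measurable|exact: measurable_snd].
have g0 z : 0 <= g z by rewrite lee_fin mulr_ge0.
have mn : measurable_fun [set: R] (fun y : R => (`|y|)%:E : \bar R).
  by apply/measurable_EFinP; exact: normr_measurable.
transitivity (\int[distribution P Yfp]_z g z).
  rewrite ge0_integral_distribution //; apply: eq_integral => x _ /=.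
  by rewrite /g /= !ger0_norm.
transitivity (\int[(distribution P Yp \x distribution P fp)]_z g z).
  apply: eq_measure_integral => A mA _; apply/esym.
  apply: (@product_measure_unique _ _ _ _ _ (distribution P Yp) (distribution P fp) (distribution P Yfp)) => //.
rewrite (fubini_tonelli1 _ mg g0) /fubini_F.
have e x : \int[distribution P fp]_y g (x, y) = (`|x|)%:E * \int[distribution P fp]_y (`|y|)%:E.
  by rewrite -(ge0_integralZl _ measurableT mn).
under eq_integral do rewrite e.
have n0 (y : R) : 0 <= (`|y|)%:E by rewrite lee_fin.
rewrite (ge0_integralZr _ measurableT mn) //; last exact: integral_ge0.
rewrite !(ge0_integral_distribution _ mn n0).
by congr (_ * _); apply: eq_integral => x _ /=; rewrite ger0_norm.
Qed.

End Indep.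

(** * Exponential moments and a maximal inequality *)

(** $e^{-v} \ge 1 - v$ gives $e^v \le 1/(1-v)$, which is below the quadratic for $v \le 1/2$,
    however negative. *)
Lemma expR_le_quad (R : realType) (v : R) : v <= 1 / 2 -> expR v <= 1 + v + 2 * v ^+ 2.
Proof.
move=> v2; have h : 0 < 1 - v by lra.
have : expR v <= (1 - v)^-1.
  rewrite -[v in expR v]opprK expRN lef_pV2 ?posrE ?expR_gt0 //.
  exact: expR_ge1Dx.
move=> /le_trans; apply; rewrite -[_^-1]mul1r ler_pdivrMr //.
have h2 : 0 <= v * v * (1 - 2 * v) by apply: mulr_ge0; [rewrite -expr2 sqr_ge0|lra].
by rewrite !expr2; lra.
Qed.

Lemma expR1_le4 (R : realType) : expR 1 <= 4 :> R.
Proof.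
have h : expR (1 / 2) <= 2 :> R by apply: (le_trans (expR_le_quad _)); [|rewrite expr2]; lra.
have -> : expR 1 = expR (1 / 2) * expR (1 / 2) :> R by rewrite -expRD; congr expR; field.
apply: (@le_trans _ _ (2 * 2)); last by lra.
by apply: ler_pM; rewrite ?expR_ge0.
Qed.

Definition cutoff {R : realType} (y x : R) : R := if `|x| <= y then x else 0.

(** The linear term is that of [x] itself, so for a centred variable it integrates to 0 without
    recentring after the cutoff. If [x] is cut off, $|x| > y$ lets the term in $th/y^3$ absorb a
    negative $th\,x$. If $th\,x \le 1/2$, the quadratic bound applies. Otherwise $1 \le 16
    (th\,x)^4$ and $e^{th\,x} \le e^{th\,y}$. *)
Lemma expR_cutoff_le (R : realType) (th y x : R) : 0 < th -> 0 < y ->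
  expR (th * cutoff y x) <=
    1 + th * x + 2 * th ^+ 2 * x ^+ 2 + (16 * th ^+ 4 * expR (th * y) + th / y ^+ 3) * x ^+ 4.
Proof.
move=> th0 y0.
have x4 : 0 <= x ^+ 4 by rewrite exprn_even_ge0.
have x2 : 0 <= 2 * th ^+ 2 * x ^+ 2 by rewrite -mulrA -exprMn mulr_ge0 // sqr_ge0.
have p1 : 0 <= 16 * th ^+ 4 * expR (th * y) by rewrite mulr_ge0 ?expR_ge0 // mulr_ge0 // exprn_even_ge0.
have p2 : 0 <= th / y ^+ 3 by apply: divr_ge0; rewrite ?exprn_ge0 ?ltW.
rewrite /cutoff; case: ifPn => [xy|]; last first.
  rewrite -ltNge mulr0 expR0 => xy.
  have : th * `|x| <= th / y ^+ 3 * x ^+ 4.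
    rewrite -mulrA ler_pM2l // mulrC ler_pdivlMr ?exprn_gt0 //.
    rewrite -(normr_id x) -[x ^+ 4]ger0_norm // normrX normr_id (exprS _ 3).
    by rewrite ler_wpM2l // lerXn2r ?nnegrE // ltW.
  have : - (th * x) <= th * `|x| by rewrite -mulrN ler_pM2l // -normrN ler_norm.
  have : 0 <= 16 * th ^+ 4 * expR (th * y) * x ^+ 4 by rewrite mulr_ge0.
  rewrite mulrDl; lra.
have [v1|v1] := leP (th * x) (1 / 2).
  apply: (le_trans (@expR_le_quad _ _ v1)).
  rewrite exprMn; have : 0 <= (16 * th ^+ 4 * expR (th * y) + th / y ^+ 3) * x ^+ 4 by rewrite mulr_ge0 ?addr_ge0.
  lra.
have : expR (th * x) <= expR (th * y) by rewrite ler_expR ler_pM2l // (le_trans (ler_norm x)).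
move=> /le_trans; apply.
have h : 1 <= 16 * (th * x) ^+ 4.
  rewrite -ler_pdivrMl // mulr1 (_ : 16^-1 = (1/2) ^+ 4); last by field.
  by rewrite lerXn2r ?nnegrE; lra.
have : expR (th * y) <= 16 * th ^+ 4 * expR (th * y) * x ^+ 4.
  rewrite (_ : _ * x ^+ 4 = 16 * (th * x) ^+ 4 * expR (th * y)); last by rewrite exprMn; ring.
  by rewrite ler_peMl ?expR_ge0.
have : 0 <= th / y ^+ 3 * x ^+ 4 by rewrite mulr_ge0.
rewrite mulrDl; lra.
Qed.

Lemma markov_le {d} {Omega : measurableType d} {R : realType} (P : probability Omega R)
    (U : Omega -> R) (M L : R) : measurable_fun setT U ->
  (forall x, 0 <= U x) -> 0 < L -> (\int[P]_x (U x)%:E <= M%:E)%E ->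
  (P [set om | (L <= U om)%R] <= (M / L)%:E)%E.
Proof.
move=> mU U0 L0 hM.
have mA : measurable [set om | L <= U om].
  by rewrite -[X in measurable X]setTI; apply: measurable_fun_ler => //; exact: measurable_cst.
rewrite mulrC EFinM -lee_pdivrMl //; last by rewrite invr_gt0.
rewrite invrK; apply: le_trans hM; rewrite -integral_cst //.
apply: (@le_trans _ _ (\int[P]_(x in [set om | (L <= U om)%R]) (U x)%:E)%E).
  apply: ge0_le_integral => //.
  - by move=> x _; rewrite lee_fin ltW.
  - by apply: (measurable_funS measurableT) => //; exact/measurable_EFinP.
apply: ge0_subset_integral => //; first exact/measurable_EFinP.
by move=> x _; rewrite lee_fin.
Qed.

(** * A maximal inequality for products of independent factors *)

Section StoppedProduct.
Context {d} {Omega : measurableType d} {R : realType} (P : probability Omega R).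
Local Open Scope ereal_scope.
Variable X : nat -> Omega -> R.
Hypothesis mX : forall i, measurable_fun setT (X i).
Hypothesis iX : forall (j : nat) (A : set Omega) (B : set R),
  <<s cyl X (fun i => (i < j)%N) >> A -> measurable B ->
  P (A `&` X j @^-1` B) = P A * P (X j @^-1` B).

(* The product of the [phi (X i)] frozen when it reaches [L], as in the proof of Doob's
   maximal inequality. *)
Fixpoint stopped (phi : R -> R) (a : nat) (L : R) (j : nat) (om : Omega) : R :=
  if j is j'.+1 then
    let U := stopped phi a L j' om in
    (if U < L then U * phi (X (a + j')%N om) else U)%R
  else 1%R.

Variables (phi : R -> R) (a : nat) (L : R).
Hypothesis mphi : measurable_fun setT phi.
Hypothesis phi0 : forall x, (0 <= phi x)%R.

Lemma stopped_ge0 j om : (0 <= stopped phi a L j om)%R.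
Proof. by elim: j => //= j IH; case: ifP => // _; rewrite mulr_ge0. Qed.

(** [Z] is always the identity map, but from two measurable structures: [Omega] itself, and [Omega]
    with the sigma-algebra generated by the past, for independence of the next factor. *)
Lemma measurable_stopped d' (T : measurableType d') (Z : T -> Omega) j :
  (forall i, (i < a + j)%N -> measurable_fun setT (X i \o Z)) ->
  measurable_fun setT (stopped phi a L j \o Z).
Proof.
elim: j => [|j IH] h; first exact: measurable_cst.
have IH' : measurable_fun setT (stopped phi a L j \o Z).
  by apply: IH => i ia; apply: h; rewrite addnS ltnS ltnW.
apply: (@measurable_fun_ifT _ _ _ _ (fun om => (stopped phi a L j (Z om) * phi (X (a + j)%N (Z om)))%R)
   (stopped phi a L j \o Z) (fun om => (stopped phi a L j (Z om) < L)%R)) => //.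
  by apply: measurable_fun_ltr => //; exact: measurable_cst.
apply: measurable_funM => //.
by apply: (measurableT_comp mphi); apply: h; rewrite addnS.
Qed.

Lemma cyl_measurable_coord (J : pred nat) i : J i ->
  measurable_fun setT (X i \o (fun t : g_sigma_algebraType (cyl X J) => t)).
Proof.
move=> Ji _ B mB; rewrite setTI; apply: sub_sigma_algebra.
by apply: cyl_coord.
Qed.

(** The product is split into its value while still below [L] and its frozen value. The first is
    independent of the next factor, whose mean is at most [M]; the second does not change, and $M
    \ge 1$. *)
Lemma stopped_expectation (M : R) : (1 <= M)%R ->
  (forall i, \int[P]_x (phi (X i x))%:E <= M%:E) ->
  forall j, \int[P]_x (stopped phi a L j x)%:E <= (M ^+ j)%:E.
Proof.
move=> M1 hM; have M0 : (0 <= M)%R by apply: le_trans M1.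
have mS j : measurable_fun setT (stopped phi a L j).
  by apply: (@measurable_stopped _ _ (@id Omega)) => i _; exact: mX.
elim=> [|j IH].
  by rewrite expr0 /= integral_cst // mul1e; exact: probability_le1.
pose Y1 om := (if stopped phi a L j om < L then stopped phi a L j om else 0)%R.
pose Y2 om := (if stopped phi a L j om < L then 0 else stopped phi a L j om)%R.
have mY1 : measurable_fun setT Y1.
  by apply: measurable_fun_ifT => //; apply: measurable_fun_ltr.
have mY2 : measurable_fun setT Y2.
  by apply: measurable_fun_ifT => //; apply: measurable_fun_ltr.
have Y10 om : (0 <= Y1 om)%R by rewrite /Y1; case: ifP => // _; exact: stopped_ge0.
have Y20 om : (0 <= Y2 om)%R by rewrite /Y2; case: ifP => // _; exact: stopped_ge0.
have mph : measurable_fun setT (fun om => phi (X (a + j)%N om)) by apply: (measurableT_comp mphi).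
have -> : \int[P]_x (stopped phi a L j.+1 x)%:E =
   \int[P]_x ((Y1 x * phi (X (a + j)%N x))%:E + (Y2 x)%:E).
  by apply: eq_integral => om _; rewrite -EFinD /Y1 /Y2 /=; case: ifP => _; rewrite ?mul0r ?add0r ?addr0.
rewrite ge0_integralD //; last 4 first.
- by move=> om _; rewrite lee_fin mulr_ge0.
- by apply/measurable_EFinP; apply: measurable_funM.
- by move=> om _; rewrite lee_fin.
- exact/measurable_EFinP.
rewrite expectation_indepM //; last first.
  move=> A B mA mB.
  have -> : (fun om => phi (X (a + j)%N om)) @^-1` B = X (a + j)%N @^-1` (phi @^-1` B) by [].
  apply: iX; last by rewrite -[_ @^-1` _]setTI; exact: mphi.
  have : measurable_fun setT (Y1 \o (fun t : g_sigma_algebraType (cyl X (fun i => (i < a + j)%N)) => t)).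
    have mst := @measurable_stopped _ _ (fun t : g_sigma_algebraType (cyl X (fun i => (i < a + j)%N)) => t) j
      (fun i ia => @cyl_measurable_coord (fun i => (i < a + j)%N) i ia).
    by apply: measurable_fun_ifT => //; apply: measurable_fun_ltr.
  by move=> /(_ measurableT A mA); rewrite setTI.
apply: (@le_trans _ _ ((\int[P]_x (Y1 x)%:E) * M%:E + (\int[P]_x (Y2 x)%:E) * M%:E)).
  apply: leeD; first by apply: lee_wpmul2l => //; apply: integral_ge0 => om _; rewrite lee_fin.
  rewrite -[leLHS]mule1; apply: lee_wpmul2l; last by rewrite lee_fin.
  by apply: integral_ge0 => om _; rewrite lee_fin.
rewrite -ge0_muleDl; try by apply: integral_ge0 => om _; rewrite lee_fin.
rewrite -ge0_integralD //; last 4 first.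
- by move=> om _; rewrite lee_fin.
- exact/measurable_EFinP.
- by move=> om _; rewrite lee_fin.
- exact/measurable_EFinP.
rewrite exprSr EFinM; apply: lee_wpmul2r; first by rewrite lee_fin.
apply: le_trans IH; apply: ge0_le_integral => //.
- by move=> om _; rewrite -EFinD lee_fin addr_ge0.
- by apply/measurable_EFinP; apply: measurable_funD.
- exact/measurable_EFinP.
- by move=> om _; rewrite -EFinD lee_fin /Y1 /Y2; case: ifP => _; rewrite ?addr0 ?add0r.
Qed.

(** Below the level, the stopped product equals the plain one; once at [L] or above, it is frozen.
    So a crossing at any [j <= k] is still visible at time [k], which makes a bound at one time a
    maximal inequality. *)
Lemma stopped_prod j k om : (j <= k)%N ->
  (L <= \prod_(i < j) phi (X (a + i)%N om))%R ->
  (L <= stopped phi a L k om)%R.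
Proof.
have st i : (L <= stopped phi a L i om)%R -> (L <= stopped phi a L i.+1 om)%R.
  by move=> h /=; rewrite ltNge h.
have mono i i' : (i <= i')%N -> (L <= stopped phi a L i om)%R -> (L <= stopped phi a L i' om)%R.
  by move=> /subnK <-; elim: (_ - _)%N => // m IH h; rewrite addSn; apply/st/IH.
move=> jk h; apply: (mono _ _ jk).
have [//|sL] := leP L (stopped phi a L j om).
suff e : (stopped phi a L j om = \prod_(i < j) phi (X (a + i)%N om))%R by move: sL; rewrite e ltNge h.
have {h jk} : forall i, (i <= j)%N -> (stopped phi a L i om < L)%R.
  by move=> i ij; rewrite ltNge; apply/negP => /(mono _ _ ij); rewrite leNgt sL.
elim: j {sL} => [|j IH] h; first by rewrite big_ord0.
rewrite big_ord_recr /= -IH; last by move=> i ij; apply: h; rewrite ltnW.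
by rewrite h.
Qed.

Lemma stopped_maximal (M : R) k : (0 < L)%R -> (1 <= M)%R ->
  (forall i, \int[P]_x (phi (X i x))%:E <= M%:E) ->
  P [set om | (L <= stopped phi a L k om)%R] <= (M ^+ k / L)%:E.
Proof.
move=> L0 M1 hM.
have mS : measurable_fun setT (stopped phi a L k).
  by apply: (@measurable_stopped _ _ (@id Omega)) => i _; exact: mX.
exact: markov_le mS (stopped_ge0 k) L0 (stopped_expectation M1 hM k).
Qed.

End StoppedProduct.

(** * Exponential moments of centred variables after truncation *)

Section Moments.
Context {d} {Omega : measurableType d} {R : realType} (P : probability Omega R).
Local Open Scope ereal_scope.

Lemma integral_quartic_le (X : Omega -> R) (V th al ga : R) :
  P.-integrable setT (EFin \o X) -> \int[P]_x (X x)%:E = 0 ->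
  P.-integrable setT (EFin \o (fun x => X x ^+ 2)%R) ->
  P.-integrable setT (EFin \o (fun x => X x ^+ 4)%R) ->
  \int[P]_x (X x ^+ 2)%:E <= V%:E -> \int[P]_x (X x ^+ 4)%:E <= V%:E ->
  (0 <= al)%R -> (0 <= ga)%R ->
  \int[P]_x (1 + th * X x + al * X x ^+ 2 + ga * X x ^+ 4)%:E
    <= (1 + al * V + ga * V)%:E.
Proof.
move=> i1 e1 i2 i4 h2 h4 al0 ga0.
have i0 : P.-integrable setT (fun=> 1%:E) by exact: finite_measure_integrable_cst.
have j1 : P.-integrable setT (fun x => th%:E * (X x)%:E) by exact: integrableZl.
have j2 : P.-integrable setT (fun x => al%:E * (X x ^+ 2)%:E) by exact: (integrableZl _ al i2).
have j4 : P.-integrable setT (fun x => ga%:E * (X x ^+ 4)%:E) by exact: (integrableZl _ ga i4).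
have -> : \int[P]_x (1 + th * X x + al * X x ^+ 2 + ga * X x ^+ 4)%:E =
  \int[P]_x (((1%:E + th%:E * (X x)%:E) + al%:E * (X x ^+ 2)%:E) + ga%:E * (X x ^+ 4)%:E).
  by apply: eq_integral => x _; rewrite !EFinD !EFinM.
have j01 : P.-integrable setT (fun x => 1%:E + th%:E * (X x)%:E) by exact: integrableD.
have j012 : P.-integrable setT (fun x => (1%:E + th%:E * (X x)%:E) + al%:E * (X x ^+ 2)%:E) by exact: (integrableD _ j01 j2).
rewrite (integralD _ j012 j4) // (integralD _ j01 j2) // (integralD _ i0 j1) //.
rewrite (integralZl _ i1) // (integralZl _ i2) // (integralZl _ i4) //.
rewrite integral_cst //= e1 mule0 adde0 !EFinD !EFinM.
apply: leeD; last by apply: lee_wpmul2l; rewrite ?lee_fin.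
apply: leeD; last by apply: lee_wpmul2l; rewrite ?lee_fin.
by rewrite mul1e; exact: probability_le1.
Qed.

(** The last two conditions bound each of the two quartic coefficients of [expR_cutoff_le] by
    $th^2$, so together they cost no more than the variance term $2\,th^2 V$. *)
Lemma mgf_cutoff (X : Omega -> R) (V th y : R) :
  P.-integrable setT (EFin \o X) -> \int[P]_x (X x)%:E = 0 ->
  P.-integrable setT (EFin \o (fun x => X x ^+ 2)%R) ->
  P.-integrable setT (EFin \o (fun x => X x ^+ 4)%R) ->
  \int[P]_x (X x ^+ 2)%:E <= V%:E -> \int[P]_x (X x ^+ 4)%:E <= V%:E ->
  (0 <= V)%R -> (0 < th)%R -> (0 < y)%R ->
  (16 * th ^+ 2 * expR (th * y) <= 1)%R -> (y ^- 3 <= th)%R ->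
  \int[P]_x (expR (th * cutoff y (X x)))%:E <= (expR (4 * th ^+ 2 * V))%:E.
Proof.
move=> i1 e1 i2 i4 h2 h4 V0 th0 y0 c1 c2.
have al0 : (0 <= 2 * th ^+ 2)%R by rewrite mulr_ge0 // sqr_ge0.
have ga0 : (0 <= 16 * th ^+ 4 * expR (th * y) + th / y ^+ 3)%R.
  apply: addr_ge0; first by rewrite mulr_ge0 ?expR_ge0 // mulr_ge0 // exprn_even_ge0.
  by apply: divr_ge0; rewrite ?exprn_ge0 ?ltW.
have mX : measurable_fun setT X by apply/measurable_EFinP; exact: (measurable_int _ i1).
apply: (@le_trans _ _ (\int[P]_x (1 + th * X x + 2 * th ^+ 2 * X x ^+ 2 +
   (16 * th ^+ 4 * expR (th * y) + th / y ^+ 3) * X x ^+ 4)%:E)).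
  apply: ge0_le_integral => //.
  - apply/measurable_EFinP; apply: (measurableT_comp (@measurable_expR R)).
    apply: measurable_funM => //.
    apply: measurable_fun_ifT => //.
    by apply: measurable_fun_ler => //; exact: measurableT_comp.
  - apply/measurable_EFinP; apply: measurable_funD; last by apply: measurable_funM => //; exact: measurable_funX.
    apply: measurable_funD; last by apply: measurable_funM => //; exact: measurable_funX.
    by apply: measurable_funD => //; exact: measurable_funM.
  - by move=> x _; rewrite lee_fin expR_cutoff_le.
apply: (le_trans (integral_quartic_le _ i1 e1 i2 i4 h2 h4 al0 ga0)).
rewrite lee_fin; apply: le_trans (expR_ge1Dx _).
have k1 : (16 * th ^+ 4 * expR (th * y) <= th ^+ 2)%R.
  rewrite (_ : 16 * th ^+ 4 * expR (th * y) = th ^+ 2 * (16 * th ^+ 2 * expR (th * y)))%R; last by ring.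
  by rewrite ler_piMr // sqr_ge0.
have k2 : (th / y ^+ 3 <= th ^+ 2)%R by rewrite expr2 ler_pM2l.
have : ((16 * th ^+ 4 * expR (th * y) + th / y ^+ 3) * V <= (2 * th ^+ 2) * V)%R by apply: ler_wpM2r => //; lra.
lra.
Qed.

End Moments.

(** * Partial sums inside blocks of fixed length *)

Section Blocks.
Context {d} {Omega : measurableType d} {R : realType} (P : probability Omega R).
Local Open Scope ereal_scope.
Variable X : nat -> Omega -> R.
Hypothesis mX : forall i, measurable_fun setT (X i).
Hypothesis iX : forall (j : nat) (A : set Omega) (B : set R),
  <<s cyl X (fun i => (i < j)%N) >> A -> measurable B ->
  P (A `&` X j @^-1` B) = P A * P (X j @^-1` B).

(** The first set contains the event that some partial sum of the truncated variables over block [i]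
    reaches [v], the second that one reaches [-v]. *)
Definition bad_block (th y v : R) (h i : nat) : set Omega :=
  [set om | (expR (th * v) <= stopped X (fun x => expR (th * cutoff y x)) (i * h) (expR (th * v)) h om)%R] `|`
  [set om | (expR (th * v) <= stopped X (fun x => expR (th * cutoff y (- x))) (i * h) (expR (th * v)) h om)%R].

Definition bad_blocks (th y v : R) (h nb : nat) : set Omega :=
  \big[setU/set0]_(i < nb) bad_block th y v h i.

Lemma measurable_cutoff (th y : R) : measurable_fun setT (fun x : R => expR (th * cutoff y x)).
Proof.
apply: (measurableT_comp (@measurable_expR R)); apply: measurable_funM => //.
apply: measurable_fun_ifT => //.
by apply: measurable_fun_ler => //; exact: normr_measurable.
Qed.

Lemma measurable_cutoffN (th y : R) : measurable_fun setT (fun x : R => expR (th * cutoff y (- x))).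
Proof. by apply: (measurableT_comp (measurable_cutoff th y)); exact: oppr_measurable. Qed.

Lemma stopped_set_measurable phi a L h : measurable_fun setT phi ->
  measurable [set om | (L <= stopped X phi a L h om)%R].
Proof.
move=> mphi; rewrite -[X in measurable X]setTI; apply: measurable_fun_ler => //.
by apply: (@measurable_stopped _ _ _ _ _ _ _ mphi _ _ id) => i _; exact: mX.
Qed.

Lemma bad_blocks_measurable th y v h nb : measurable (bad_blocks th y v h nb).
Proof.
apply: bigsetU_measurable => i _; apply: measurableU; apply: stopped_set_measurable.
  exact: measurable_cutoff.
exact: measurable_cutoffN.
Qed.

Lemma bad_blocksP (th y v : R) (h nb : nat) om : (0 < th)%R ->
  ~ bad_blocks th y v h nb om -> forall i j, (i < nb)%N -> (j <= h)%N ->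
  (`| \sum_(l < j) cutoff y (X (i * h + l)%N om) | < v)%R.
Proof.
move=> th0 nbad i j inb jh; rewrite ltNge; apply/negP => vs; apply: nbad.
rewrite /bad_blocks -(bigcup_mkord nb (bad_block th y v h)); exists i => //.
have tN x : (cutoff y (- x) = - cutoff y x)%R by rewrite /cutoff normrN; case: ifP; rewrite ?oppr0.
move: vs; rewrite ler_normr => /orP[vs|vs]; [left|right].
  apply: (stopped_prod jh).
  by rewrite -expR_sum ler_expR -mulr_sumr ler_pM2l.
apply: (stopped_prod jh).
by rewrite -expR_sum ler_expR -mulr_sumr ler_pM2l // (eq_bigr _ (fun l _ => tN _)) sumrN.
Qed.

Lemma bad_blocks_prob (th y v V : R) (h nb : nat) :
  (0 <= V)%R -> (0 < th)%R ->
  (forall i, \int[P]_x (expR (th * cutoff y (X i x)))%:E <= (expR (4 * th ^+ 2 * V))%:E) ->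
  (forall i, \int[P]_x (expR (th * cutoff y (- X i x)))%:E <= (expR (4 * th ^+ 2 * V))%:E) ->
  P (bad_blocks th y v h nb) <= (nb%:R * (2 * expR (4 * th ^+ 2 * V * h%:R - th * v)))%:E.
Proof.
move=> V0 th0 h1 h2; apply: (le_trans (Boole_inequality _ _)).
  move=> i _; apply: measurableU; apply: stopped_set_measurable.
    exact: measurable_cutoff.
  exact: measurable_cutoffN.
have M1 : (1 <= expR (4 * th ^+ 2 * V))%R.
  by rewrite -expR0 ler_expR mulr_ge0 // mulr_ge0 // sqr_ge0.
have e : (expR (4 * th ^+ 2 * V * h%:R - th * v) = expR (4 * th ^+ 2 * V) ^+ h / expR (th * v))%R.
  by rewrite expRD expRN expRM_natr.
apply: (@le_trans _ _ (\sum_(i < nb) (2 * expR (4 * th ^+ 2 * V * h%:R - th * v))%:E)).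
  apply: lee_sum => i _.
  apply: (le_trans (measureU2 _ _ _)).
  - by apply: stopped_set_measurable; exact: measurable_cutoff.
  - by apply: stopped_set_measurable; exact: measurable_cutoffN.
  rewrite mulr2n mulrDl mul1r EFinD; apply: leeD; rewrite e.
    exact: (stopped_maximal mX iX _ (measurable_cutoff th y) (fun x => expR_ge0 _) _ (expR_gt0 _) M1 h1).
  exact: (stopped_maximal mX iX _ (measurable_cutoffN th y) (fun x => expR_ge0 _) _ (expR_gt0 _) M1 h2).
by rewrite sumEFin sumr_const card_ord (mulr_natl _ nb).
Qed.

End Blocks.

(** * The Borel-Cantelli lemma with explicit partial sums *)

Section BorelCantelli.
Context {d} {Omega : measurableType d} {R : realType} (P : probability Omega R).
Local Open Scope ereal_scope.

Lemma ae_eventually_not (F : nat -> set Omega) (C : R) :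
  (forall q, measurable (F q)) ->
  (forall m, \sum_(i < m) P (F i) <= C%:E) ->
  {ae P, forall om, exists N, forall q, (N <= q)%N -> ~ F q om}.
Proof.
move=> mF hC.
have h0 : P (lim_sup_set F) = 0.
  apply: lim_sup_set_cvg0 => //; apply: (@le_lt_trans _ _ C%:E); last exact: ltry.
  apply: lime_le; first exact: is_cvg_nneseries.
  by apply: nearW => m; rewrite big_mkord.
exists (lim_sup_set F); split => //.
  by apply: bigcap_measurable => // k _; exact: bigcup_measurable.
move=> om /= nh n _; apply: contrapT => hn; apply: nh; exists n => q nq Fq.
by apply: hn; exists q.
Qed.

(** The bound is of order $C/q^2$, written so that its partial sums telescope. *)
Lemma ae_eventually_not_telescope (F : nat -> set Omega) (C : R) (q0 : nat) :
  (0 <= C)%R ->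
  (forall q, measurable (F q)) ->
  (forall q, (q0 <= q)%N -> P (F q) <= (C * (q.+1%:R^-1 - q.+2%:R^-1))%:E) ->
  {ae P, forall om, exists N, forall q, (N <= q)%N -> ~ F q om}.
Proof.
move=> C0 mF hC.
have h m : \sum_(i < m) P (F (i + q0)%N) <= (C * (q0.+1%:R^-1 - (m + q0).+1%:R^-1))%:E.
  elim: m => [|m IH]; first by rewrite big_ord0 add0n subrr mulr0.
  rewrite big_ord_recr /=; apply: (le_trans (leeD IH (hC _ (leq_addl _ _)))).
  rewrite -EFinD lee_fin -mulrDr addSn; by rewrite addrA subrK.
have := @ae_eventually_not (fun i => F (i + q0)%N) (C * q0.+1%:R^-1)%R (fun q => mF _).
case=> [m|A [mA PA hA]].
  apply: (le_trans (h m)); rewrite lee_fin; apply: ler_wpM2l => //.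
  by rewrite gerBl invr_ge0.
exists A; split => //; apply: subset_trans hA => om /= + [N hN]; apply.
exists (N + q0)%N => q Nq; have -> : q = (q - q0 + q0)%N by rewrite subnK // (leq_trans (leq_addl _ _) Nq).
by apply: hN; rewrite leq_subRL ?(leq_trans (leq_addl _ _) Nq) // addnC.
Qed.

Lemma ae_and (A B : Omega -> Prop) :
  {ae P, forall om, A om} -> {ae P, forall om, B om} -> {ae P, forall om, A om /\ B om}.
Proof. by move=> hA hB; apply: filterS2 hA hB. Qed.

End BorelCantelli.

(** The window consists of whole blocks and an incomplete one at each end. In the [3], two units are
    for the ends and one for rounding the number of whole blocks. *)
Lemma block_sum_le (R : realType) (x : nat -> R) (v : R) (h nb a b : nat) :
  (0 < h)%N -> 0 <= v ->
  (forall i j, (i < nb)%N -> (j <= h)%N -> `|\sum_(l < j) x (i * h + l)%N| <= v) ->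
  (a <= b)%N -> (b < nb * h)%N ->
  `|\sum_(a <= l < b) x l| <= v * ((b - a)%N%:R / h%:R + 3).
Proof.
move=> h0 v0 hx ab bn.
pose S m := \sum_(0 <= l < m) x l.
have blk i j : (i < nb)%N -> (j <= h)%N -> `|S (i * h + j)%N - S (i * h)%N| <= v.
  move=> inb jh; rewrite /S (big_cat_nat (n := (i * h)%N)) ?leq_addr //= addrAC subrr add0r.
  by rewrite -{1}[(i * h)%N]add0n (addnC _ j) big_addn addnK big_mkord; under eq_bigr do rewrite addnC; exact: hx.
have full i k : (i + k < nb)%N -> `|S ((i + k) * h)%N - S (i * h)%N| <= v * k%:R.
  elim: k => [|k IH] ik; first by rewrite addn0 subrr normr0 mulr0.
  have ik' : (i + k < nb)%N by rewrite addnS in ik; exact: ltnW.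
  have := blk (i + k)%N h ik' (leqnn _); rewrite addnS mulSnr => b1.
  have := ler_normD (S ((i + k) * h + h)%N - S ((i + k) * h)%N) (S ((i + k) * h)%N - S (i * h)%N).
  rewrite addrA subrK => /le_trans; apply.
  rewrite -natr1 mulrDr mulr1 addrC; apply: lerD => //; exact: IH.
have an : (a %/ h < nb)%N by rewrite ltn_divLR // (leq_ltn_trans ab).
have bn' : (b %/ h < nb)%N by rewrite ltn_divLR.
have abh : (a %/ h <= b %/ h)%N by exact: leq_div2r.
have -> : \sum_(a <= l < b) x l = S b - S a.
  by rewrite /S (big_cat_nat (m := 0) (n := a)) //= addrAC subrr add0r.
have b1 := blk _ (b %% h)%N bn' (ltnW (ltn_pmod b h0)).
have b2 := blk _ (a %% h)%N an (ltnW (ltn_pmod a h0)).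
have b3 := full (a %/ h)%N (b %/ h - a %/ h)%N.
rewrite -divn_eq in b1; rewrite -divn_eq in b2; rewrite subnKC // in b3.
have {}b3 := b3 bn'.
have k1 : (b %/ h - a %/ h)%N%:R <= (b - a)%N%:R / h%:R + 1 :> R.
  rewrite -lerBlDr ler_pdivlMr ?ltr0n // mulrBl mul1r lerBlDr -natrM -natrD ler_nat.
  have := divn_eq b h; have := divn_eq a h; have := ltn_pmod a h0; have := ltn_pmod b h0.
  rewrite mulnBl; lia.
have k2 : v * (b %/ h - a %/ h)%N%:R <= v * ((b - a)%N%:R / h%:R + 1) by apply: ler_wpM2l.
rewrite (_ : S b - S a = (S b - S (b %/ h * h)%N) + (S (b %/ h * h)%N - S (a %/ h * h)%N) - (S a - S (a %/ h * h)%N)); last by ring.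
apply: (le_trans (ler_normB _ _)); have := ler_normD (S b - S (b %/ h * h)%N) (S (b %/ h * h)%N - S (a %/ h * h)%N).
rewrite mulrDr in k2 *; lra.
Qed.

(** * Increments of centred random walks *)

(* [Num.sqrt n] times the sum of the two quantities in the bound of the theorem. *)
Definition noise_scale {R : realType} (n : nat) (x : R) : R :=
  Num.sqrt n%:R * x + (ln (ln n%:R) + ln (n%:R * x ^+ 2)) / x.

(** Only terms of index below [i0] can be affected by the cutoff, so the error has a bound that is
    the same for all windows. *)
Lemma cutoff_sum_error (R : realType) (x : nat -> R) (y : R) (a b i0 : nat) :
  (forall l, (i0 <= l)%N -> (l < b)%N -> `|x l| <= y) -> (a <= b)%N ->
  `|\sum_(a <= l < b) x l - \sum_(a <= l < b) cutoff y (x l)| <= \sum_(l < i0) `|x l|.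
Proof.
move=> hy ab.
have {hy} : forall l, (a <= l < b)%N -> (i0 <= l)%N -> x l - cutoff y (x l) = 0.
  by move=> l /andP[_ lb] il; rewrite /cutoff hy // subrr.
have hc l : `|x l - cutoff y (x l)| <= `|x l|.
  by rewrite /cutoff; case: ifP; rewrite ?subrr ?normr0 ?subr0.
rewrite -sumrB => h.
apply: (@le_trans _ _ (\sum_(l < minn b i0) `|x l|)); last first.
  rewrite -!(big_mkord xpredT (fun l => `|x l|)) (big_cat_nat (n := minn b i0) (p := i0)) ?geq_minr //=.
  by rewrite lerDl sumr_ge0.
elim: b ab h => [|b IH] ab h.
  by move: ab; rewrite leqn0 => /eqP ->; rewrite big_geq // normr0 sumr_ge0.
move: ab; rewrite leq_eqVlt => /orP[/eqP ->|]; first by rewrite big_geq // normr0 sumr_ge0.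
rewrite ltnS => ab; rewrite big_nat_recr //=.
have {}IH : `|\sum_(a <= l < b) (x l - cutoff y (x l))| <= \sum_(l < minn b i0) `|x l|.
  by apply: IH => // l /andP[al lb]; apply: h; rewrite al ltnW.
have [bi|ib] := ltnP b i0.
  rewrite (minn_idPl bi); rewrite (minn_idPl (ltnW bi)) in IH.
  by rewrite big_ord_recr /=; apply: (le_trans (ler_normD _ _)); exact: lerD.
by rewrite (minn_idPr (leqW ib)) h // ?ab ?leqnn // addr0; rewrite (minn_idPr ib) in IH.
Qed.

Section Increments.
Context {d} {Omega : measurableType d} {R : realType} (P : probability Omega R).
Variable X : nat -> Omega -> R.
Hypothesis mX : forall i, measurable_fun setT (X i).
Hypothesis iX : forall (j : nat) (A : set Omega) (B : set R),
  <<s cyl X (fun i => (i < j)%N) >> A -> measurable B ->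
  (P (A `&` X j @^-1` B) = P A * P (X j @^-1` B))%E.
Variable V : R.
Hypothesis V1 : 1 <= V.
Hypothesis X1 : forall i, P.-integrable setT (EFin \o X i).
Hypothesis EX : forall i, (\int[P]_x (X i x)%:E = 0)%E.
Hypothesis X2 : forall i, P.-integrable setT (EFin \o (fun x => X i x ^+ 2)).
Hypothesis X4 : forall i, P.-integrable setT (EFin \o (fun x => X i x ^+ 4)).
Hypothesis EX2 : forall i, (\int[P]_x (X i x ^+ 2)%:E <= V%:E)%E.
Hypothesis EX4 : forall i, (\int[P]_x (X i x ^+ 4)%:E <= V%:E)%E.
Hypothesis tailX : forall e : R, 0 < e ->
  {ae P, forall om, exists N, forall i, (N <= i)%N -> X i om ^+ 4 <= e * i%:R}.

(* The bad events are defined for [n] in [16 ^ q, 16 ^ q.+1) and [chi n] rounded down to a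
   dyadic value, so that only O(q) of them occur at each scale [q ~ log n]: this is why the
   Borel-Cantelli lemma costs no more than [ln (ln n)]. *)
Let mesh (p : nat) : R := 2 ^- p.
(* [expR (lev q p)] is n chi^2 log n up to constants when n ~ 16^q and chi ~ 2^-p. *)
Let lev (q p : nat) : R := ln (16 ^+ q * mesh p ^+ 2 * q%:R).
(** The block length. With deviation $c \cdot mesh \cdot len$ and exponential parameter $ka \cdot
    mesh$, the exponent is of order $mesh^2 \cdot len$, hence a multiple of [lev]. *)
Let len (A : R) (q p : nat) : nat := (Num.truncn (A * lev q p / mesh p ^+ 2)).+1.
(** The first condition says $mesh \ge 4^{-q}$, that is, of order $n^{-1/2}$ or more. The second
    keeps $mesh \cdot 2^q \le q$, so that exponential moments of variables cut off at $2^q$ stay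
    under control. *)
Let adm (q p : nat) : bool := (p <= 2 * q)%N && (mesh p <= q%:R / 2 ^+ q).

Let mesh_gt0 p : 0 < mesh p. Proof. by rewrite invr_gt0 exprn_gt0. Qed.

Let mesh_ge q p : (p <= 2 * q)%N -> 1 <= 16 ^+ q * mesh p ^+ 2.
Proof.
move=> pq; rewrite /mesh exprVn ler_pdivlMr ?exprn_gt0 ?exprn_gt0 // mul1r -exprM.
rewrite (_ : 16 = 2 ^+ 4); last by ring.
by rewrite -exprM; apply: ler_weXn2l; [lra|lia].
Qed.

Let lev_exp q p : (0 < q)%N -> (p <= 2 * q)%N ->
  expR (lev q p) = 16 ^+ q * mesh p ^+ 2 * q%:R.
Proof.
move=> q0 pq; rewrite lnK // posrE mulr_gt0 ?ltr0n //.
exact: lt_le_trans ltr01 (mesh_ge pq).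
Qed.

Let lev_ge1 q p : (4 <= q)%N -> (p <= 2 * q)%N -> 1 <= lev q p.
Proof.
move=> q4 pq; rewrite -ler_expR lev_exp ?(leq_trans _ q4) //.
apply: (le_trans (expR1_le4 R)); rewrite -[4]mul1r; apply: ler_pM => //; first exact: mesh_ge.
by rewrite ler_nat.
Qed.

Let len_ge A q p : 0 <= A * lev q p / mesh p ^+ 2 ->
  A * lev q p <= mesh p ^+ 2 * (len A q p)%:R.
Proof.
move=> h; rewrite -ler_pdivrMl ?exprn_gt0 // mulrC; apply: ltW; exact: truncnS_gt.
Qed.

Let len_le A q p : 0 <= A * lev q p / mesh p ^+ 2 ->
  mesh p * (len A q p)%:R <= A * lev q p / mesh p + mesh p.
Proof.
move=> h; rewrite /len -natr1 mulrDr mulr1 lerD2r.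
have := truncn_itv h => /andP[+ _].
rewrite -(ler_pM2l (mesh_gt0 p)) => /le_trans; apply.
by rewrite le_eqVlt; apply/orP; left; apply/eqP; field; rewrite gt_eqF.
Qed.

Let sq_le_exp2 q : (q * q <= 2 * 2 ^ q)%N.
Proof.
case: q => [|[|[|q]]] //; elim: q => [|q IH] //.
by rewrite expnS; lia.
Qed.

(** $e^{ka \cdot mesh \cdot 2^q} \le 2^q$ and $mesh^2\, 2^q \le q^2/2^q \le 2$, so the first claim
    reduces to $32\,ka^2 \le 1$; this is what the bound $1/6$ is for. The second combines $mesh \ge
    4^{-q}$ with $ka \ge 1/q \ge 2^{-q}$. *)
Let cutoff_cond (ka : R) q p : 0 < ka -> ka <= 6^-1 -> ka^-1 <= q%:R -> adm q p ->
  16 * (ka * mesh p) ^+ 2 * expR (ka * mesh p * 2 ^+ q) <= 1 /\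
  (2 ^+ q) ^- 3 <= ka * mesh p.
Proof.
move=> ka0 ka6 kaq /andP[pq xq].
have m0 := mesh_gt0 p.
have p2 : 0 < 2 ^+ q :> R by rewrite exprn_gt0.
have xq' : mesh p * 2 ^+ q <= q%:R by rewrite -ler_pdivlMr.
split.
  have h : expR (1 / 2) <= 2 :> R.
    by apply: (le_trans (expR_le_quad _)); [|rewrite expr2]; lra.
  have e1 : expR (ka * mesh p * 2 ^+ q) <= 2 ^+ q.
    apply: (@le_trans _ _ (expR (1 / 2) ^+ q)); last by apply: lerXn2r; rewrite ?nnegrE ?expR_ge0.
    rewrite -expRM_natr ler_expR -mulrA; apply: ler_pM => //; [exact: ltW|by rewrite ltW // mulr_gt0|lra].
  have e2 : (mesh p) ^+ 2 * 2 ^+ q <= 2.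
    rewrite -(ler_pM2r p2) -mulrA -[_ * 2 ^+ q]expr2 -exprMn.
    apply: (@le_trans _ _ (q%:R ^+ 2)); first by apply: lerXn2r; rewrite ?nnegrE // ltW // mulr_gt0.
    by rewrite expr2 -natrX -!natrM ler_nat.
  apply: (@le_trans _ _ (16 * ka ^+ 2 * (mesh p ^+ 2 * 2 ^+ q))).
    have -> : 16 * (ka * mesh p) ^+ 2 * expR (ka * mesh p * 2 ^+ q) =
        16 * ka ^+ 2 * (mesh p ^+ 2 * expR (ka * mesh p * 2 ^+ q)) by ring.
    apply: ler_wpM2l; first by rewrite mulr_ge0 // sqr_ge0.
    by apply: ler_wpM2l => //; rewrite sqr_ge0.
  have k2 : ka ^+ 2 <= 6^-1 ^+ 2 by apply: lerXn2r; rewrite ?nnegrE // ltW.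
  have : ka ^+ 2 * (mesh p ^+ 2 * 2 ^+ q) <= 6^-1 ^+ 2 * 2.
    by apply: ler_pM => //; rewrite ?sqr_ge0 // mulr_ge0 ?sqr_ge0 // ltW.
  by rewrite !expr2; lra.
have mp : (2 ^+ q) ^- 2 <= mesh p.
  rewrite /mesh lef_pV2 ?posrE ?exprn_gt0 // -exprM mulnC; apply: ler_weXn2l => //; lra.
have kq : (2 ^+ q)^-1 <= ka.
  rewrite -[ka]invrK lef_pV2 ?posrE ?invr_gt0 //; apply: (le_trans kaq).
  by rewrite -natrX ler_nat ltnW // ltn_expl.
rewrite exprSr invfM mulrC; apply: ler_pM => //; rewrite invr_ge0 ?exprn_ge0 // ltW //.
Qed.

Let bad (c ka A : R) (K q : nat) : set Omega :=
  \big[setU/set0]_(p < (2 * q).+1)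
    (if adm q p then bad_blocks X (ka * mesh p) (2 ^+ q) (c * mesh p * (len A q p)%:R)
       (len A q p) ((K * 16 ^ q.+1) %/ len A q p).+1 else set0).

Let bad_measurable c ka A K q : measurable (bad c ka A K q).
Proof.
apply: bigsetU_measurable => p _; case: ifP => // _.
exact: bad_blocks_measurable.
Qed.

(** With $E = e^{lev}$, each block is bad with probability at most $2E^{-4}$. Blocks have length at
    least $mesh^{-2}$, so their number is at most a multiple of $E$. What remains is $E^{-3} \le
    q^{-3}$. *)
Let bad_prob1 (c ka A : R) (K q p : nat) : 0 < c -> 0 < ka -> ka <= 6^-1 ->
  ka <= c / (8 * V) -> 8 / (ka * c) + 1 <= A -> (4 <= q)%N -> ka^-1 <= q%:R -> adm q p ->
  (P (bad_blocks X (ka * mesh p) (2 ^+ q) (c * mesh p * (len A q p)%:R)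
       (len A q p) ((K * 16 ^ q.+1) %/ len A q p).+1)
   <= (2 * (16 * K%:R + 1) * q%:R ^- 3)%:E)%E.
Proof.
move=> c0 ka0 ka6 kac hA q4 kaq ad.
have [c1 c2] := cutoff_cond ka0 ka6 kaq ad.
have /andP[pq xq] := ad.
have m0 := mesh_gt0 p.
have th0 : 0 < ka * mesh p by rewrite mulr_gt0.
have y0 : 0 < 2 ^+ q :> R by rewrite exprn_gt0.
have V0 : 0 <= V by apply: le_trans V1.
have A0 : 0 <= 8 / (ka * c) by rewrite divr_ge0 // mulr_ge0 // ltW.
have l1 := lev_ge1 q4 pq.
have A1 : 1 <= A * lev q p.
  by rewrite -[1]mulr1; apply: ler_pM => //; lra.
have hl0 : 0 <= A * lev q p / mesh p ^+ 2.
  by rewrite divr_ge0 ?sqr_ge0 //; lra.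
have hl := len_ge hl0.
have h1 i := mgf_cutoff (X1 i) (EX i) (X2 i) (X4 i) (EX2 i) (EX4 i) V0 th0 y0 c1 c2.
have h2 i : (\int[P]_x (expR (ka * mesh p * cutoff (2 ^+ q) (- X i x)))%:E <= (expR (4 * (ka * mesh p) ^+ 2 * V))%:E)%E.
  apply: (@mgf_cutoff _ _ _ P (fun x => - X i x)) => //.
  - by have := integrableN (X1 i).
  - under eq_integral do rewrite EFinN.
    rewrite integralN ?EX ?oppe0 //; have := integrable_add_def measurableT (X1 i); exact.
  - by under eq_fun do rewrite sqrrN; exact: X2.
  - by under eq_fun do rewrite exprNn -signr_odd mul1r; exact: X4.
  - by under eq_integral do rewrite sqrrN; exact: EX2.
  - by under eq_integral do rewrite exprNn -signr_odd mul1r; exact: EX4.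
apply: (le_trans (bad_blocks_prob mX iX _ _ _ V0 th0 h1 h2)).
rewrite lee_fin.
set h := len A q p in hl *; set E := 16 ^+ q * mesh p ^+ 2 * q%:R.
have eE : expR (lev q p) = E by rewrite lev_exp // (leq_trans _ q4).
have q0 : 0 < q%:R :> R by rewrite ltr0n (leq_trans _ q4).
have Eq : q%:R <= E by rewrite -[leLHS]mul1r ler_pM2r // mesh_ge.
have E0 : 0 < E by apply: lt_le_trans Eq.
have h0 : 0 < h%:R :> R by rewrite ltr0n.
have q1 : 1 <= q%:R :> R by rewrite ler1n (leq_trans _ q4).
have nb : ((K * 16 ^ q.+1) %/ h).+1%:R <= (16 * K%:R + 1) * E.
  rewrite -natr1 mulrDl mul1r; apply: lerD; last by apply: le_trans Eq.
  have -> : 16 * K%:R * E = (K * 16 ^ q.+1)%N%:R * (mesh p ^+ 2 * q%:R) :> R.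
    by rewrite natrM natrX exprS /E; ring.
  apply: (@le_trans _ _ ((K * 16 ^ q.+1)%N%:R / h%:R)).
    by rewrite ler_pdivlMr // -natrM ler_nat leq_trunc_div.
  apply: ler_wpM2l => //; rewrite -[h%:R^-1]mul1r ler_pdivrMr //.
  rewrite mulrAC; apply: (@le_trans _ _ (1 * 1)); first by rewrite mulr1.
  by apply: ler_pM => //; lra.
(* [ka <= c / (8 * V)] makes the variance term at most half of the linear one; [A >= 8 / (ka * c)]
   turns the other half into at least $4\,lev$. *)
have ex : 4 * (ka * mesh p) ^+ 2 * V * h%:R - ka * mesh p * (c * mesh p * h%:R) <= - (4 * lev q p).
  have -> : 4 * (ka * mesh p) ^+ 2 * V * h%:R - ka * mesh p * (c * mesh p * h%:R) =
     - (ka * (c - 4 * ka * V) * (mesh p ^+ 2 * h%:R)) by ring.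
  rewrite lerN2.
  have kv : c / 2 <= c - 4 * ka * V.
    have V0' : 0 < 8 * V by have V1' := V1; lra.
    by move: kac; rewrite ler_pdivlMr //; lra.
  apply: (@le_trans _ _ (ka * (c / 2) * (A * lev q p))).
    have -> : 4 * lev q p = ka * (c / 2) * (8 / (ka * c) * lev q p) by field; rewrite !gt_eqF.
    apply: ler_wpM2l; first by rewrite mulr_ge0 ?divr_ge0 // ltW.
    by apply: ler_wpM2r; lra.
  apply: ler_pM => //; try (rewrite mulr_ge0 // ?divr_ge0 //; lra); try lra.
  by rewrite ler_pM2l.
have ex2 : expR (4 * (ka * mesh p) ^+ 2 * V * h%:R - ka * mesh p * (c * mesh p * h%:R)) <= E ^- 4.
  apply: (@le_trans _ _ (expR (- (4 * lev q p)))); first by rewrite ler_expR.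
  by rewrite expRN mulrC expRM_natr eE.
apply: (@le_trans _ _ ((16 * K%:R + 1) * E * (2 * E ^- 4))).
  apply: ler_pM => //; try by rewrite mulr_ge0 ?expR_ge0.
  by apply: ler_wpM2l.
have -> : (16 * K%:R + 1) * E * (2 * E ^- 4) = 2 * (16 * K%:R + 1) * E ^- 3 by field; rewrite gt_eqF.
apply: ler_wpM2l; first by rewrite mulr_ge0 // addr_ge0 // mulr_ge0.
rewrite lef_pV2 ?posrE ?exprn_gt0 //; apply: lerXn2r => //; rewrite nnegrE ltW //.
Qed.

(** The $2q+1$ meshes turn $q^{-3}$ into order $q^{-2}$. The factor 36 is the value of
    $2(2q+1)(q+1)(q+2)/q^3$ at $q = 1$, which dominates the later ones. *)
Let bad_prob (c ka A : R) (K q : nat) : 0 < c -> 0 < ka -> ka <= 6^-1 ->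
  ka <= c / (8 * V) -> 8 / (ka * c) + 1 <= A -> (4 <= q)%N -> ka^-1 <= q%:R ->
  (P (bad c ka A K q) <= (36 * (16 * K%:R + 1) * (q.+1%:R^-1 - q.+2%:R^-1))%:E)%E.
Proof.
move=> c0 ka0 ka6 kac hA q4 kaq.
have q0 : 0 < q%:R :> R by rewrite ltr0n (leq_trans _ q4).
have q1 : 1 <= q%:R :> R by rewrite ler1n (leq_trans _ q4).
have h : (P (bad c ka A K q) <= \sum_(p < (2 * q).+1) (2 * (16 * K%:R + 1) * q%:R ^- 3)%:E)%E.
  pose F (p : nat) := if adm q p then bad_blocks X (ka * mesh p) (2 ^+ q) (c * mesh p * (len A q p)%:R)
       (len A q p) ((K * 16 ^ q.+1) %/ len A q p).+1 else set0.
  apply: (le_trans (@Boole_inequality _ _ _ P F _ _)).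
    by move=> p _; rewrite /F; case: ifP => // _; exact: bad_blocks_measurable.
  apply: lee_sum => p _; rewrite /F; case: ifPn => [ad|_]; first exact: bad_prob1.
  by rewrite measure0 lee_fin mulr_ge0.
apply: (le_trans h); rewrite sumEFin sumr_const card_ord lee_fin -[X in X <= _]mulr_natr.
set k : R := 16 * K%:R + 1.
have k0 : 0 <= k by rewrite addr_ge0 // mulr_ge0.
have -> : (2 * q).+1%:R = 2 * q%:R + 1 :> R by rewrite -natr1 natrM.
have -> : q.+1%:R^-1 - q.+2%:R^-1 = ((q%:R + 1) * (q%:R + 2))^-1 :> R.
  by rewrite -[q.+2%:R]natr1 -[q.+1%:R]natr1; field; rewrite !gt_eqF //; lra.
have -> : 2 * k * q%:R ^- 3 * (2 * q%:R + 1) = k * (2 * (2 * q%:R + 1) / q%:R ^+ 3) by ring.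
set w := (_ * _)^-1; have -> : 36 * k * w = k * (36 * w) by ring.
apply: ler_wpM2l => //.
rewrite ler_pdivrMr ?exprn_gt0 // /w mulrAC ler_pdivlMr; last by apply: mulr_gt0; lra.
have q2 : 1 <= q%:R ^+ 2 :> R by rewrite exprn_ege1.
have q3 : q%:R <= q%:R ^+ 2 :> R by rewrite expr2 ler_peMl.
have q5 : q%:R ^+ 2 <= q%:R ^+ 3 :> R by rewrite exprS ler_peMl ?sqr_ge0.
move: q2 q3 q5; rewrite !exprS expr0 !mulr1 => *; lra.
Qed.

(** The noise level $lev/mesh$ of the blocks must fit the target bound. If $x \le q/2^q$, the mesh
    is within a factor 2 of [x], and $q \le \ln n$ bounds [lev] by the logarithms in [noise_scale].
    Otherwise the mesh is comparable to $q/2^q$ and $lev \le 5q$, so the ratio is at most $10 \cdot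
    2^q$, while $\sqrt n\,x \ge 4^q \cdot q/2^q \ge 2^q$. *)
Let lev_scale (n q p : nat) (x : R) : (4 <= q)%N -> (16 ^ q <= n)%N -> 0 < x -> x <= 1 ->
  4 <= Num.sqrt n%:R * x -> adm q p -> mesh p <= Num.min x (q%:R / 2 ^+ q) ->
  Num.min x (q%:R / 2 ^+ q) < 2 * mesh p ->
  lev q p / mesh p <= 10 * noise_scale n x /\ 1 <= noise_scale n x.
Proof.
move=> q4 qn x0 x1 x4 /andP[pq _] hm1 hm2.
have m0 := mesh_gt0 p.
have n0 : 0 < n%:R :> R by rewrite ltr0n (leq_trans _ qn) // expn_gt0.
have q0 : 0 < q%:R :> R by rewrite ltr0n (leq_trans _ q4).
have l1 := lev_ge1 q4 pq.
have qln : q%:R <= ln n%:R :> R.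
  rewrite -ler_expR lnK ?posrE //; apply: (@le_trans _ _ (16 ^+ q)); last by rewrite -natrX ler_nat.
  rewrite -[q%:R]mul1r expRM_natr; apply: lerXn2r; rewrite ?nnegrE ?expR_ge0 //.
  by apply: (le_trans (expR1_le4 R)); lra.
have ln0 : 0 < ln n%:R :> R by apply: lt_le_trans qln.
have nx : 16 <= n%:R * x ^+ 2.
  have -> : n%:R * x ^+ 2 = (Num.sqrt n%:R * x) ^+ 2 by rewrite exprMn sqr_sqrtr // ltW.
  rewrite (_ : 16 = 4 ^+ 2); last by rewrite expr2; lra.
  by apply: lerXn2r; rewrite ?nnegrE //; lra.
have l0 : 0 <= ln (ln n%:R) :> R.
  by rewrite ln_ge0 // (le_trans _ qln) // ler1n (leq_trans _ q4).
have l0' : 0 <= ln (n%:R * x ^+ 2) by rewrite ln_ge0 //; lra.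
have B0 : 0 <= (ln (ln n%:R) + ln (n%:R * x ^+ 2)) / x by rewrite divr_ge0 ?addr_ge0 // ltW.
rewrite /noise_scale; split; last by lra.
have [xc|xc] := leP x (q%:R / 2 ^+ q).
  rewrite (min_idPl xc) in hm1 hm2.
  have ll : lev q p <= ln (ln n%:R) + ln (n%:R * x ^+ 2).
    rewrite -lnM ?posrE //; last by lra.
    rewrite ler_ln ?posrE; last 2 first.
    - by rewrite mulr_gt0 //; apply: lt_le_trans ltr01 (mesh_ge pq).
    - by rewrite mulr_gt0 //; lra.
    rewrite mulrC; apply: ler_pM => //.
      by rewrite mulr_ge0 ?exprn_ge0 // ltW.
    apply: ler_pM; rewrite ?exprn_ge0 //; first by rewrite ltW.
      by rewrite -natrX ler_nat.
    by apply: lerXn2r; rewrite ?nnegrE // ltW.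
  have : lev q p / mesh p <= 2 * ((ln (ln n%:R) + ln (n%:R * x ^+ 2)) / x).
    set LL := ln (ln n%:R) + _ in ll *.
    rewrite ler_pdivrMr // (_ : 2 * (LL / x) * mesh p = LL * (2 * mesh p / x)); last by ring.
    apply: (le_trans ll); rewrite -[leLHS]mulr1; apply: ler_wpM2l; first by lra.
    by rewrite ler_pdivlMr // mul1r ltW.
  by lra.
rewrite (min_idPr (ltW xc)) in hm1 hm2.
have p2 : 0 < 2 ^+ q :> R by rewrite exprn_gt0.
have h1 : lev q p <= 5 * q%:R.
  have m1 : mesh p <= 1 by rewrite /mesh invf_le1 ?exprn_gt0 ?exprn_ege1 ?ler1n.
  have : lev q p <= ln (32 ^+ q).
    rewrite ler_ln ?posrE ?exprn_gt0 //; last first.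
      by rewrite mulr_gt0 //; apply: lt_le_trans ltr01 (mesh_ge pq).
    rewrite (_ : 32 = 16 * 2); last by lra.
    rewrite exprMn; apply: ler_pM => //; first by rewrite mulr_ge0 ?exprn_ge0 // ltW.
      rewrite -[leRHS]mulr1; apply: ler_wpM2l; first by rewrite exprn_ge0.
      by rewrite expr2; apply: mulr_ile1 => //; exact: ltW.
    by rewrite -natrX ler_nat ltnW // ltn_expl.
  move=> /le_trans; apply; rewrite (_ : 32 = 2 ^+ 5); last by ring.
  rewrite -exprM.
  have -> : ln (2 ^+ (5 * q)) = 5 * q%:R * ln 2 :> R by rewrite lnXn // -natrM mulr_natl.
  have h : ln 2 <= 1 :> R.
    by have := @le_ln1Dx R 1; rewrite (_ : 1 + 1 = 2) //; apply; lra.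
  by rewrite -[leRHS]mulr1; apply: ler_wpM2l => //; rewrite mulr_ge0.
have h2 : 2 ^+ q <= Num.sqrt n%:R * x.
  apply: (@le_trans _ _ (4 ^+ q * (q%:R / 2 ^+ q))).
    rewrite (_ : 4 = 2 * 2); last by ring.
    rewrite exprMn (_ : 2 ^+ q * 2 ^+ q * (q%:R / 2 ^+ q) = q%:R * 2 ^+ q); last by field; rewrite gt_eqF.
    by rewrite ler_peMl ?exprn_ge0 // ler1n (leq_trans _ q4).
  apply: ler_pM; [by rewrite exprn_ge0|by rewrite divr_ge0 ?exprn_ge0| |exact: ltW].
  rewrite -(@ler_pXn2r _ 2) ?nnegrE ?exprn_ge0 ?sqrtr_ge0 // sqr_sqrtr ?(ltW n0) //.
  rewrite -exprM mulnC exprM (_ : 4 ^+ 2 = 16); last by ring.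
  by rewrite -natrX ler_nat.
have h3 : lev q p / mesh p <= 10 * 2 ^+ q.
  rewrite ler_pdivrMr //; apply: (le_trans h1).
  move: hm2; rewrite ltr_pdivrMr // => hm2; lra.
by lra.
Qed.

(** The smallest [p] with mesh below the minimum is taken, and minimality gives the factor 2. That
    [p <= 2 * q] suffices is the reason for the constant 4: $\sqrt n \le 4 \cdot 4^q$ and $\sqrt
    n\,x \ge 4$ force $x \ge 4^{-q}$. *)
Let choose_mesh (n q : nat) (x : R) : (4 <= q)%N -> (n < 16 ^ q.+1)%N -> 0 < x -> x <= 1 ->
  4 <= Num.sqrt n%:R * x ->
  exists p, [/\ adm q p, mesh p <= Num.min x (q%:R / 2 ^+ q) &
    Num.min x (q%:R / 2 ^+ q) < 2 * mesh p].
Proof.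
move=> q4 nq x0 x1 x4; set m := Num.min _ _.
have p2 : 0 < 2 ^+ q :> R by rewrite exprn_gt0.
have hq : mesh (2 * q) <= m.
  rewrite le_min; apply/andP; split.
    have sn : Num.sqrt n%:R <= 4 * 2 ^+ (2 * q) :> R.
      rewrite -(@ler_pXn2r _ 2) ?nnegrE ?mulr_ge0 ?exprn_ge0 ?sqrtr_ge0 // sqr_sqrtr ?ler0n //.
      rewrite exprMn -exprM (_ : (2 * q * 2 = 4 * q)%N); last by lia.
      rewrite exprM (_ : 2 ^+ 4 = 16); last by ring.
      rewrite (_ : 4 ^+ 2 = 16); last by ring.
      by rewrite -exprS -natrX ler_nat ltnW.
    have : 4 <= 4 * 2 ^+ (2 * q) * x by apply: (le_trans x4); apply: ler_wpM2r => //; exact: ltW.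
    rewrite /mesh -[_^-1]mul1r ler_pdivrMr ?exprn_gt0 // mulrC; lra.
  rewrite /mesh mulnC exprM expr2 invfM; apply: ler_wpM2r; first by rewrite invr_ge0 ltW.
  apply: (@le_trans _ _ 1); first by rewrite invf_le1 // exprn_ege1 //; lra.
  by rewrite ler1n (leq_trans _ q4).
have ex : exists p, mesh p <= m by exists (2 * q)%N.
case: (ex_minnP ex) => p hp pmin; exists p; split => //.
  rewrite /adm pmin //=; apply: (le_trans hp); by rewrite ge_min lexx orbT.
case: p hp pmin => [|p] hp pmin.
  rewrite /mesh expr0 invr1; apply: (@le_lt_trans _ _ 1); last by lra.
  by rewrite ge_min x1.
rewrite /mesh exprS invfM mulrA mulfV // mul1r ltNge; apply/negP => /pmin.
by rewrite ltnn.
Qed.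

Lemma increments_noise (chi : nat -> R) (c : R) : 0 < c ->
  (exists N, forall n, (N <= n)%N -> [/\ 0 < chi n, chi n <= 1 & 4 <= Num.sqrt n%:R * chi n]) ->
  (forall Z, exists N, forall n, (N <= n)%N -> Z <= noise_scale n (chi n)) ->
  exists C, 0 < C /\ forall K : nat,
    {ae P, forall om, exists N, forall n, (N <= n)%N -> forall a b, (a <= b)%N -> (b <= K * n)%N ->
      `|\sum_(a <= l < b) X l om| <= c * chi n * (b - a)%N%:R + C * noise_scale n (chi n)}.
Proof.
move=> c0 [N1 hN1] hN2.
have V0 : 0 < V by apply: lt_le_trans V1.
pose ka := Num.min 6^-1 (c / (8 * V)).
have ka0 : 0 < ka by rewrite lt_min invr_gt0 divr_gt0 ?mulr_gt0 ?ltr0n.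
pose A := 8 / (ka * c) + 1.
have A0 : 0 <= A by rewrite addr_ge0 // divr_ge0 // mulr_ge0 // ltW.
(* [3] comes from [block_sum_le], [10] from [lev_scale], the inner [1] from rounding the block
   length, and the last [1] absorbs the truncation error. The constant must not depend on [K], which
   will grow with the time horizon. *)
exists (3 * c * (10 * A + 1) + 1); split.
  by apply: addr_gt0 => //; rewrite mulr_gt0 ?mulr_gt0 // addr_gt0 // mulr_gt0 // addr_gt0 // divr_gt0 // mulr_gt0.
move=> K.
have ae1 : {ae P, forall om, exists N, forall q, (N <= q)%N -> ~ bad c ka A K q om}.
  apply: (@ae_eventually_not_telescope _ _ _ P _ (36 * (16 * K%:R + 1)) (maxn 4 (Num.truncn ka^-1).+1)).
  - by rewrite mulr_ge0 // addr_ge0 // mulr_ge0.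
  - by move=> q; exact: bad_measurable.
  - move=> q; rewrite geq_max => /andP[q4 qk]; apply: bad_prob => //.
    + by rewrite ge_min lexx.
    + by rewrite ge_min lexx orbT.
    + by apply: (le_trans (ltW (truncnS_gt _))); rewrite ler_nat.
(* With this choice, $X_l^4 \le 16^q$ for all large $l < K\,16^{q+1}$, so the cutoff at $2^q$ is
   inactive there. *)
have ae2 := @tailX (16 * K.+1%:R)^-1 _.
have {}ae2 := ae2 (ltac:(by rewrite invr_gt0 mulr_gt0 // ltr0n)).
apply: filterS2 ae1 ae2 => om [Nq hq] [i0 hi0].
have [N3 hN3] := hN2 (\sum_(l < i0) `|X l om|).
exists (maxn (maxn N1 N3) (16 ^ maxn 4 Nq)) => n; rewrite !geq_max => /andP[/andP[nN1 nN3] nq] a b ab bK.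
have [x0 x1 x4] := hN1 _ nN1.
pose q := trunc_log 16 n.
have n0 : (0 < n)%N by apply: leq_trans nq; rewrite expn_gt0.
have /andP[qn nq1] := @trunc_log_bounds 16 n isT n0.
have qq : (maxn 4 Nq <= q)%N.
  by rewrite -ltnS -(@ltn_exp2l 16) //; apply: leq_ltn_trans nq1.
move: qq; rewrite geq_max => /andP[q4 qNq].
have [p [ad hm1 hm2]] := choose_mesh q4 nq1 x0 x1 x4.
have [s1 s2] := lev_scale q4 qn x0 x1 x4 ad hm1 hm2.
have /andP[pq _] := ad.
have m0 := mesh_gt0 p.
have nbad : ~ bad_blocks X (ka * mesh p) (2 ^+ q) (c * mesh p * (len A q p)%:R)
       (len A q p) ((K * 16 ^ q.+1) %/ len A q p).+1 om.
  move=> hb; apply: (hq q qNq).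
  pose F (p : nat) := if adm q p then bad_blocks X (ka * mesh p) (2 ^+ q) (c * mesh p * (len A q p)%:R)
       (len A q p) ((K * 16 ^ q.+1) %/ len A q p).+1 else set0.
  rewrite /bad -(bigcup_mkord _ F); exists p; first by rewrite /= ltnS.
  by rewrite /F ad.
have v0 : 0 <= c * mesh p * (len A q p)%:R by rewrite mulr_ge0 // mulr_ge0 // ltW.
have hb : (b < ((K * 16 ^ q.+1) %/ len A q p).+1 * len A q p)%N.
  apply: leq_ltn_trans (ltn_ceil _ _) => //.
  by apply: (leq_trans bK); rewrite leq_mul2l ltnW ?orbT.
have e1 := @block_sum_le _ (fun l => cutoff (2 ^+ q) (X l om)) _ _ _ a b (ltn0Sn _) v0
  (fun i j ib jh => ltW (bad_blocksP (mulr_gt0 ka0 m0) nbad ib jh)) ab hb.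
have e2 : `|\sum_(a <= l < b) X l om - \sum_(a <= l < b) cutoff (2 ^+ q) (X l om)| <= \sum_(l < i0) `|X l om|.
  apply: cutoff_sum_error => // l il lb.
  rewrite -(@ler_pXn2r _ 4) ?nnegrE ?exprn_ge0 // -normrX ger0_norm ?exprn_even_ge0 //.
  apply: (le_trans (hi0 _ il)).
  rewrite ler_pdivrMl ?mulr_gt0 ?ltr0n // -exprM mulnC exprM (_ : 2 ^+ 4 = 16); last by ring.
  rewrite mulrAC -exprS -natrX -natrM ler_nat.
  apply: (leq_trans (ltnW lb)); apply: (leq_trans bK); rewrite mulnC.
  by apply: leq_mul; [exact: ltnW|].
have e3 := hN3 _ nN3.
have l1 := lev_ge1 q4 pq.
have hl0 : 0 <= A * lev q p / mesh p ^+ 2.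
  by rewrite divr_ge0 ?sqr_ge0 // mulr_ge0 //; lra.
have e4 := len_le hl0.
have m1 : mesh p <= 1 by rewrite /mesh invf_le1 ?exprn_gt0 ?exprn_ege1 ?ler1n.
have mx : mesh p <= chi n by apply: (le_trans hm1); rewrite ge_min lexx.
have e5 : mesh p * (len A q p)%:R <= (10 * A + 1) * noise_scale n (chi n).
  have -> : (10 * A + 1) * noise_scale n (chi n) = A * (10 * noise_scale n (chi n)) + noise_scale n (chi n) by ring.
  apply: (le_trans e4); apply: lerD; last by apply: le_trans s2.
  by rewrite -mulrA; apply: ler_wpM2l.
have e6 : c * mesh p * (len A q p)%:R * ((b - a)%N%:R / (len A q p)%:R + 3) <=
   c * chi n * (b - a)%N%:R + 3 * c * ((10 * A + 1) * noise_scale n (chi n)).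
  have -> : c * mesh p * (len A q p)%:R * ((b - a)%N%:R / (len A q p)%:R + 3) =
     c * mesh p * (b - a)%N%:R + 3 * c * (mesh p * (len A q p)%:R).
    by field; rewrite gt_eqF // ltr0n.
  apply: lerD; last by apply: ler_wpM2l => //; rewrite mulr_ge0 // ltW.
  by apply: ler_wpM2r => //; apply: ler_wpM2l => //; exact: ltW.
have := ler_normD (\sum_(a <= l < b) X l om - \sum_(a <= l < b) cutoff (2 ^+ q) (X l om)) (\sum_(a <= l < b) cutoff (2 ^+ q) (X l om)).
rewrite subrK => /le_trans; apply.
apply: (le_trans (lerD e2 (le_trans e1 e6))).
have -> : (3 * c * (10 * A + 1) + 1) * noise_scale n (chi n) =
  3 * c * ((10 * A + 1) * noise_scale n (chi n)) + noise_scale n (chi n) by ring.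
lra.
Qed.

End Increments.

(** * Noise with adaptively chosen coefficients *)

Section Discrete.
Context {d} {T : measurableType d}.

(** For values such as permutations, sequences and options, which carry no sigma-algebra here; on a
    countable codomain, measurable level sets are all that is used. *)
Definition mdisc {A : Type} (f : T -> A) : Prop := forall a, measurable (f @^-1` [set a]).

Lemma mdisc_cst {A : Type} (a : A) : mdisc (fun=> a).
Proof.
move=> b; have [e|ne] := pselect (a = b).
  by rewrite (_ : _ @^-1` _ = setT) //; apply/seteqP; split.
by rewrite (_ : _ @^-1` _ = set0) //; apply/seteqP; split.
Qed.

(** Splitting along the countably many values of [f] freezes the first argument of [g]. The
    measurability of the recursive dynamics rests on this. *)
Lemma measurable_bind_set {A : countType} (f : T -> A) (g : A -> set T) :
  mdisc f -> (forall a, measurable (g a)) -> measurable [set t | g (f t) t].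
Proof.
move=> mf mg.
rewrite (_ : [set t | g (f t) t] =
    \bigcup_n (if unpickle n is Some a then f @^-1` [set a] `&` g a else set0)).
  apply: bigcup_measurable => n _; case: unpickle => [a|] //.
  exact: measurableI.
apply/seteqP; split => [t gt|t [n _]] /=.
  by exists (pickle (f t)) => //; rewrite pickleK.
by case: unpickle => // a [<-].
Qed.

Lemma mdisc_bind {A : countType} {B : Type} (f : T -> A) (g : A -> T -> B) :
  mdisc f -> (forall a, mdisc (g a)) -> mdisc (fun t => g (f t) t).
Proof.
move=> mf mg b.
exact: (measurable_bind_set (g := fun a => g a @^-1` [set b]) mf (fun a => mg a b)).
Qed.

Lemma mdisc_comp {A : countType} {B : Type} (f : T -> A) (g : A -> B) :
  mdisc f -> mdisc (fun t => g (f t)).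
Proof. by move=> mf; apply: (mdisc_bind (g := fun a _ => g a)) => // a; exact: mdisc_cst. Qed.

Lemma measurable_fun_bind d' (S : measurableType d') {A : countType} (f : T -> A) (g : A -> T -> S) :
  mdisc f -> (forall a, measurable_fun setT (g a)) -> measurable_fun setT (fun t => g (f t) t).
Proof.
move=> mf mg _ B mB; rewrite setTI.
apply: (measurable_bind_set (g := fun a => g a @^-1` B) mf) => a.
by rewrite -[_ @^-1` _]setTI; exact: mg.
Qed.

Lemma mdisc_fun_bool (f : T -> bool) : measurable_fun setT f -> mdisc f.
Proof. by move=> mf b; rewrite -[_ @^-1` _]setTI; exact: mf. Qed.

Lemma mdisc_ffun {I : finType} {A : countType} (h : I -> T -> A) :
  (forall i, mdisc (h i)) -> mdisc (fun t => [ffun i => h i t]).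
Proof.
move=> mh f.
rewrite (_ : _ @^-1` _ = \bigcap_(i in [set: I]) (h i @^-1` [set f i])).
  by apply: fin_bigcap_measurable => [|i _]; [exact: finite_finset|exact: mh].
apply/seteqP; split => [t <- i _ /=|t ht /=]; first by rewrite ffunE.
by apply/ffunP => i; rewrite ffunE; exact: ht.
Qed.

End Discrete.

Section Adaptive.
Context {d} {Omega : measurableType d} {R : realType} (P : probability Omega R).

(* [f a j] is the noise of customer [j] when the discrete state is [a]; the state
   [st j] is determined by the past [C j], of which each [f a j] is independent. *)
Variables (A : finType) (C : nat -> set (set Omega)).
Variables (f : A -> nat -> Omega -> R) (st : nat -> Omega -> A).
Hypothesis Cm : forall j, C j `<=` measurable.
Hypothesis Cmono : forall i j, (i <= j)%N -> C i `<=` C j.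
Hypothesis stC : forall j, mdisc (st j : g_sigma_algebraType (C j) -> A).
Hypothesis fC : forall a j, measurable_fun setT (f a j : g_sigma_algebraType (C j.+1) -> R).
Hypothesis f_indep : forall a j B D, <<s C j >> B -> measurable D ->
  (P (B `&` f a j @^-1` D) = P B * P (f a j @^-1` D))%E.

Let sC j : <<s C j >> `<=` measurable.
Proof. by apply: smallest_sub; [exact: sigma_algebra_measurable|exact: Cm]. Qed.

Let from_past d' (S : measurableType d') j (g : Omega -> S) :
  measurable_fun setT (g : g_sigma_algebraType (C j) -> S) -> measurable_fun setT g.
Proof.
move=> mg _ B mB; have := mg measurableT B mB; rewrite !setTI; exact: sC.
Qed.

Let past_mono d' (S : measurableType d') i j (g : Omega -> S) : (i <= j)%N ->
  measurable_fun setT (g : g_sigma_algebraType (C i) -> S) ->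
  measurable_fun setT (g : g_sigma_algebraType (C j) -> S).
Proof.
move=> ij mg _ B mB; have := mg measurableT B mB; rewrite !setTI.
by apply: sub_sigma_algebra2; exact: Cmono.
Qed.

Let step l om := f (st l om) l om.

Let measurable_step j l : (l < j)%N ->
  measurable_fun setT (step l : g_sigma_algebraType (C j) -> R).
Proof.
move=> lj; apply: (@measurable_fun_bind _ (g_sigma_algebraType (C j)) _ _ _ (st l) (fun a => f a l)).
  move=> a; have := @stC l a; rewrite /measurable /=.
  by apply: sub_sigma_algebra2; apply: Cmono; exact: ltnW.
by move=> a; apply: (past_mono (i := l.+1)) => //; exact: fC.
Qed.

Let measurable_sum a b j : (b <= j)%N ->
  measurable_fun setT ((fun om => \sum_(a <= l < b) step l om) : g_sigma_algebraType (C j) -> R).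
Proof.
move=> bj.
(* The guard [l < j] always holds in the window; it lets the induction run over an arbitrary list of
   indices. *)
have -> : (fun om => \sum_(a <= l < b) step l om) =
   (fun om => \sum_(l <- iota a (b - a)) (if (l < j)%N then step l om else 0)).
  apply/funext => om; apply: eq_big_seq => l; rewrite mem_index_iota => /andP[_ lb].
  by rewrite (leq_trans lb bj).
elim: (iota a (b - a)) => [|l s IH].
  have -> : (fun om => \sum_(l <- [::]) (if (l < j)%N then step l om else 0)) = cst 0.
    by apply/funext => om; rewrite big_nil.
  exact: measurable_cst.
have -> : (fun om => \sum_(l0 <- l :: s) (if (l0 < j)%N then step l0 om else 0)) =
   (fun om => (if (l < j)%N then step l om else 0) +
   \sum_(l <- s) (if (l < j)%N then step l om else 0)).
  by apply/funext => om; rewrite big_cons.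
apply: (@measurable_funD _ (g_sigma_algebraType (C j)) R setT) => //.
by have [lj|_] := boolP (l < j)%N; [exact: measurable_step|exact: measurable_cst].
Qed.

Lemma measurable_adaptive_sum a b : measurable_fun setT (fun om => \sum_(a <= l < b) f (st l om) l om).
Proof. exact: (from_past (measurable_sum a (leqnn b))). Qed.

(** Conditionally on the past the state is fixed, so each step contributes a factor at most
    $e^{psi}$. The conditioning is done by hand: the expectation is summed over the finitely many
    states [s], and where [st b] equals [s] the next term is [f s b], independent of the past. *)
Lemma adaptive_mgf (th psi : R) (a b : nat) : 0 <= psi ->
  (forall s j, (\int[P]_x (expR (th * f s j x))%:E <= (expR psi)%:E)%E) ->
  (a <= b)%N ->
  (\int[P]_om (expR (th * \sum_(a <= l < b) f (st l om) l om))%:E <= (expR (psi * (b - a)%N%:R))%:E)%E.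
Proof.
move=> psi0 hpsi.
have mexp d' (T : measurableType d') (g : T -> R) : measurable_fun setT g ->
    measurable_fun setT (fun x => expR (th * g x)).
  by move=> mg; apply: (measurableT_comp (@measurable_expR R)); apply: measurable_funM.
elim: b => [|b IH].
  rewrite leqn0 => /eqP ->; rewrite subn0 mulr0 expR0.
  under eq_integral do rewrite big_geq // mulr0 expR0.
  by rewrite integral_cst //= mul1e; exact: probability_le1.
rewrite leq_eqVlt => /orP[/eqP ->|].
  rewrite subnn mulr0 expR0.
  under eq_integral do rewrite big_geq // mulr0 expR0.
  by rewrite integral_cst //= mul1e; exact: probability_le1.
rewrite ltnS => ab.
pose Y om := expR (th * \sum_(a <= l < b) f (st l om) l om).
pose Ys s om := Y om * (st b om == s)%:R.
have mYs s : measurable_fun setT (Ys s : g_sigma_algebraType (C b) -> R).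
  apply: measurable_funM; first by apply: mexp; exact: measurable_sum.
  apply: (@measurable_fun_bind _ (g_sigma_algebraType (C b)) _ R A (st b) (fun a _ => (a == s)%:R)); [exact: (@stC b)|by move=> a0; exact: measurable_cst].
have Y0 om : 0 <= Y om by rewrite expR_ge0.
have Ys0 s om : 0 <= Ys s om by rewrite mulr_ge0.
have mE s : measurable_fun setT (fun om => expR (th * f s b om)).
  by apply: mexp; apply: from_past; exact: fC.
have e1 : (\int[P]_om (expR (th * \sum_(a <= l < b.+1) f (st l om) l om))%:E =
    \int[P]_om \sum_(s : A) (Ys s om * expR (th * f s b om))%:E)%E.
  apply: eq_integral => om _; rewrite sumEFin; congr EFin.
  have z s : s != st b om -> Ys s om * expR (th * f s b om) = 0.
    by rewrite /Ys eq_sym => /negbTE ->; rewrite mulr0 mul0r.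
  rewrite (bigD1 (st b om)) //= (big1 _ _ _ z) addr0.
  by rewrite big_nat_recr //= mulrDr expRD /Ys eqxx mulr1.
have e2 : (\int[P]_om (Y om)%:E = \sum_(s : A) \int[P]_om (Ys s om)%:E)%E.
  rewrite -ge0_integral_sum //; last 2 first.
  - by move=> s; apply/measurable_EFinP; exact: from_past (mYs s).
  - by move=> s om _; rewrite lee_fin.
  apply: eq_integral => om _; rewrite sumEFin; congr EFin.
  have z s : s != st b om -> Ys s om = 0.
    by rewrite /Ys eq_sym => /negbTE ->; rewrite mulr0.
  rewrite (bigD1 (st b om)) //= (big1 _ _ _ z) addr0.
  by rewrite /Ys eqxx mulr1.
rewrite e1 ge0_integral_sum //; last 2 first.
- move=> s; apply/measurable_EFinP; apply: measurable_funM => //.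
  exact: from_past (mYs s).
- by move=> s om _; rewrite lee_fin mulr_ge0 // expR_ge0.
apply: (@le_trans _ _ (\sum_(s : A) (\int[P]_om (Ys s om)%:E) * (expR psi)%:E)%E).
  apply: lee_sum => s _; rewrite expectation_indepM //.
  - by apply: lee_wpmul2l => //; apply: integral_ge0 => om _; rewrite lee_fin.
  - exact: from_past (mYs s).
  - move=> D1 D2 mD1 mD2.
    have -> : (fun om => expR (th * f s b om)) @^-1` D2 =
       f s b @^-1` ((fun x => expR (th * x)) @^-1` D2) by [].
    apply: f_indep; first by have := mYs s measurableT D1 mD1; rewrite setTI.
    by rewrite -[_ @^-1` _]setTI; apply: mexp.
rewrite -ge0_sume_distrl; last by move=> s _; apply: integral_ge0 => om _; rewrite lee_fin.
rewrite -e2 subSn // -natr1 mulrDr mulr1 expRD EFinM.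
by apply: lee_wpmul2r; [rewrite lee_fin expR_ge0|exact: IH].
Qed.

End Adaptive.

(** * Union bound over all windows when the conditional variance is of order [chi n] *)

Section AdaptiveNoise.
Context {d} {Omega : measurableType d} {R : realType} (P : probability Omega R).
Variables (A : finType) (C : nat -> set (set Omega)).
Variables (f : nat -> A -> nat -> Omega -> R) (st : nat -> nat -> Omega -> A).
Hypothesis Cm : forall j, C j `<=` measurable.
Hypothesis Cmono : forall i j, (i <= j)%N -> C i `<=` C j.
Hypothesis stC : forall n j, mdisc (st n j : g_sigma_algebraType (C j) -> A).
Hypothesis fC : forall n a j, measurable_fun setT (f n a j : g_sigma_algebraType (C j.+1) -> R).
Hypothesis f_indep : forall n a j B D, <<s C j >> B -> measurable D ->
  (P (B `&` f n a j @^-1` D) = P B * P (f n a j @^-1` D))%E.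
Variables (chi : nat -> R) (W : R).
Hypothesis W0 : 0 < W.
Hypothesis chi0 : forall n, 0 < chi n.
Hypothesis f_mgf : forall n s j (th : R), `|th| <= 1 / 2 ->
  (\int[P]_x (expR (th * f n s j x))%:E <= (expR (2 * th ^+ 2 * (W * chi n)))%:E)%E.

Let S n a b om := \sum_(a <= l < b) f n (st n l om) l om.

Let mS n a b : measurable_fun setT (S n a b).
Proof.
by apply: (measurable_adaptive_sum Cm Cmono (fun j => @stC n j) (fun a j => @fC n a j)).
Qed.

Let tail (n a b : nat) (th x : R) : 0 < th -> th <= 1 / 2 -> (a <= b)%N ->
  (P [set om | (x <= `|S n a b om|)%R] <=
   (2 * expR (2 * th ^+ 2 * (W * chi n) * (b - a)%N%:R - th * x))%:E)%E.
Proof.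
move=> th0 th2 ab.
have psi0 : 0 <= 2 * th ^+ 2 * (W * chi n).
  by rewrite mulr_ge0 ?mulr_ge0 ?sqr_ge0 // ltW.
have one (t : R) : `|t| = th -> (P [set om | (expR (th * x) <= expR (t * S n a b om))%R] <=
   (expR (2 * th ^+ 2 * (W * chi n) * (b - a)%N%:R - th * x))%:E)%E.
  move=> tth; rewrite expRD expRN; apply: markov_le; rewrite ?expR_gt0 //.
    by apply: (measurableT_comp (@measurable_expR R)); apply: measurable_funM.
  apply: (adaptive_mgf Cm Cmono (fun j => @stC n j) (fun a j => @fC n a j) (fun a j => @f_indep n a j)) => // s j.
  have -> : th ^+ 2 = t ^+ 2 by rewrite -tth -normrX ger0_norm ?sqr_ge0.
  by apply: f_mgf; rewrite tth.
have mset (t : R) : measurable [set om | (expR (th * x) <= expR (t * S n a b om))%R].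
  rewrite -[X in measurable X]setTI; apply: measurable_fun_ler => //.
  by apply: (measurableT_comp (@measurable_expR R)); apply: measurable_funM.
apply: (@le_trans _ _ (P ([set om | (expR (th * x) <= expR (th * S n a b om))%R] `|`
   [set om | (expR (th * x) <= expR (- th * S n a b om))%R]))).
  apply: le_measure; rewrite ?inE //.
  - rewrite -[X in measurable X]setTI; apply: measurable_fun_ler => //.
    exact: measurableT_comp.
  - exact: measurableU.
  - move=> om /=; rewrite ler_normr => /orP[h|h]; [left|right]; rewrite /= ler_expR.
      by rewrite ler_pM2l.
    by rewrite mulNr -mulrN ler_pM2l.
apply: (le_trans (measureU2 _ _ _)) => //.
rewrite mulr2n mulrDl mul1r EFinD; apply: leeD; apply: one; rewrite ?normrN gtr0_norm //.
Qed.

(** The power 16 suits $B^4 \ge n$: it yields $n^{-4}$, of which two powers pay for the choice of a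
    window and two make the sum over [n] converge. *)
Lemma expRN_le_pow (B : R) : 0 < B -> expR (- B) <= 16 ^+ 16 / B ^+ 16.
Proof.
move=> B0; rewrite expRN -[leRHS]invrK lef_pV2 ?posrE ?expR_gt0 ?invr_gt0 ?divr_gt0 ?exprn_gt0 //.
rewrite invf_div -expr_div_n.
have -> : expR B = expR (B / 16) ^+ 16 by rewrite -expRM_natr; congr expR; field.
apply: lerXn2r; rewrite ?nnegrE ?expR_ge0 //; first by rewrite divr_ge0 // ltW.
by apply: le_trans (expR_ge1Dx _); lra.
Qed.

Lemma adaptive_noise (c : R) : 0 < c ->
  (exists N, forall n, (N <= n)%N -> n%:R <= noise_scale n (chi n) ^+ 4) ->
  (exists N, forall n, (N <= n)%N -> 0 < noise_scale n (chi n)) ->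
  exists C0, 0 < C0 /\ forall K : nat,
    {ae P, forall om, exists N, forall n, (N <= n)%N -> forall a b, (a <= b)%N -> (b <= K * n)%N ->
      `|\sum_(a <= l < b) f n (st n l om) l om| <= c * chi n * (b - a)%N%:R + C0 * noise_scale n (chi n)}.
Proof.
move=> c0 [N1 hN1] [N2 hN2].
(* As the variance proxy is proportional to [chi n], a parameter independent of [n] suffices: for
   $th \le c/(2W)$ the quadratic term of the exponent is absorbed by $c\,\chi_n(b-a)$, and $C_0 =
   1/th$ leaves $e^{-B_n}$. *)
pose th := Num.min (1 / 2) (c / (2 * W)).
have th0 : 0 < th by rewrite lt_min !divr_gt0 ?mulr_gt0.
have th2 : th <= 1 / 2 by rewrite ge_min lexx.
have thW : 2 * th * W <= c.
  have : th <= c / (2 * W) by rewrite ge_min lexx orbT.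
  by rewrite ler_pdivlMr ?mulr_gt0 //; lra.
exists th^-1; split; first by rewrite invr_gt0.
move=> K.
pose x n a b := c * chi n * (b - a)%N%:R + th^-1 * noise_scale n (chi n).
pose E n a b := if (a <= b)%N then [set om | (x n a b <= `|S n a b om|)%R] else set0.
pose bad n := \big[setU/set0]_(a < (K * n).+1) \big[setU/set0]_(b < (K * n).+1) E n a b.
have mE n a b : measurable (E n a b).
  rewrite /E; case: ifP => // _; rewrite -[X in measurable X]setTI; apply: measurable_fun_ler => //.
  exact: measurableT_comp.
have PE n a b : (N1 <= n)%N -> (N2 <= n)%N -> (0 < n)%N -> (P (E n a b) <= (2 * 16 ^+ 16 / n%:R ^+ 4)%:E)%E.
  move=> n1 n2 n0; have n0' : 0 < n%:R :> R by rewrite ltr0n.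
  rewrite /E; case: ifPn => [ab|_]; last first.
    by rewrite measure0 lee_fin mulr_ge0 // mulr_ge0 // exprn_ge0.
  apply: (le_trans (tail _ _ th0 th2 ab)); rewrite lee_fin -[leRHS]mulrA; apply: ler_wpM2l => //.
  have B0 := hN2 _ n2.
  apply: (@le_trans _ _ (expR (- noise_scale n (chi n)))).
    rewrite ler_expR /x mulrDr mulVKf ?gt_eqF //.
    have : 0 <= (c - 2 * th * W) * (th * chi n * (b - a)%N%:R).
      by apply: mulr_ge0; [lra|rewrite mulr_ge0 // mulr_ge0 // ltW].
    by lra.
  apply: (le_trans (expRN_le_pow B0)); apply: ler_wpM2l; first by rewrite exprn_ge0.
  rewrite lef_pV2 ?posrE ?exprn_gt0 // (_ : 16 = 4 * 4)%N // exprM.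
  by apply: lerXn2r; rewrite ?nnegrE ?exprn_ge0 ?hN1 // ltW.
(* $(K+1)^2n^2$ bounds the number of pairs [a], [b]; [6] bounds $(n+1)(n+2)/n^2$ for $n \ge 1$, to
   reach the telescoping form. *)
pose M : R := 6 * (K%:R + 1) ^+ 2 * (2 * 16 ^+ 16).
have M0 : 0 <= M by rewrite mulr_ge0 // ?mulr_ge0 ?sqr_ge0 ?exprn_ge0.
have := @ae_eventually_not_telescope _ _ _ P bad M (maxn 1 (maxn N1 N2)) M0.
case=> [q|n|].
- by apply: bigsetU_measurable => a _; apply: bigsetU_measurable => b _.
- rewrite !geq_max => /andP[n0 /andP[n1 n2]].
  have n0' : 1 <= n%:R :> R by rewrite ler1n.
  pose k : R := 2 * 16 ^+ 16 / n%:R ^+ 4.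
  have k0 : 0 <= k by rewrite mulr_ge0 // mulr_ge0 // exprn_ge0.
  have h : (P (bad n) <= ((K * n).+1%:R * ((K * n).+1%:R * k))%:E)%E.
    apply: (le_trans (@Boole_inequality _ _ _ P (fun a => \big[setU/set0]_(b < (K * n).+1) E n a b) _ _)).
      by move=> a _; apply: bigsetU_measurable => b _.
    apply: (@le_trans _ _ (\sum_(a < (K * n).+1) ((K * n).+1%:R * k)%:E)%E).
      apply: lee_sum => a _.
      apply: (le_trans (@Boole_inequality _ _ _ P (fun b => E n a b) _ _)) => //.
      apply: (@le_trans _ _ (\sum_(b < (K * n).+1) k%:E)%E).
        by apply: lee_sum => b _; exact: PE.
      by rewrite sumEFin sumr_const card_ord (mulr_natl k).
    by rewrite sumEFin sumr_const card_ord (mulr_natl (_ * k)).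
  apply: (le_trans h); rewrite lee_fin.
  have kn : (K * n).+1%:R <= (K%:R + 1) * n%:R :> R.
    by rewrite -natr1 natrM mulrDl mul1r lerD2l.
  apply: (@le_trans _ _ (((K%:R + 1) * n%:R) * (((K%:R + 1) * n%:R) * k))).
    apply: ler_pM => //; first by rewrite mulr_ge0.
    by apply: ler_wpM2r.
  have -> : n.+1%:R^-1 - n.+2%:R^-1 = ((n%:R + 1) * (n%:R + 2))^-1 :> R.
    by rewrite -[n.+2%:R]natr1 -[n.+1%:R]natr1; field; rewrite !gt_eqF //; lra.
  have -> : (K%:R + 1) * n%:R * ((K%:R + 1) * n%:R * k) = (K%:R + 1) ^+ 2 * (2 * 16 ^+ 16) * (n%:R ^+ 2)^-1.
    by rewrite /k; field; rewrite gt_eqF //; lra.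
  rewrite /M -[6 * _ * _]mulrA [6 * _]mulrC -[leRHS]mulrA; apply: ler_wpM2l.
    by rewrite mulr_ge0 ?sqr_ge0 // mulr_ge0 // exprn_ge0.
  rewrite -[_^-1]mul1r ler_pdivrMr ?exprn_gt0 //; last by lra.
  rewrite mulrAC ler_pdivlMr; last by apply: mulr_gt0; lra.
  rewrite !expr2; nra.
move=> B [mB PB hB]; exists B; split => //; apply: subset_trans hB => om /= + [N hN]; apply.
exists N => n Nn a b ab bK.
have := hN n Nn; apply: contra_notP => /negP; rewrite -ltNge => hx.
rewrite /bad -(bigcup_mkord _ (fun a => \big[setU/set0]_(b < (K * n).+1) E n a b)).
exists a; first by rewrite /= ltnS (leq_trans ab).
rewrite -(bigcup_mkord _ (fun b => E n a b)); exists b; first by rewrite /= ltnS.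
by rewrite /E ab /=; exact: ltW.
Qed.

End AdaptiveNoise.

(** * Measurability of the dynamics *)

Section FcfsOrder.
Context {R : realType} {s b : nat}.
Variables (dvec : 'I_b -> 'I_s -> R) (n : nat) (lam : R) (z : nat -> R) (org : nat -> 'I_b).
Variable k : 'I_s.

Lemma fcfs_le_total : total (fcfs_le dvec n lam z org k).
Proof.
move=> c c'; rewrite /fcfs_le eq_sym; case: ltgtP => //= _; exact: leq_total.
Qed.

Lemma fcfs_le_trans : transitive (fcfs_le dvec n lam z org k).
Proof.
move=> y x x'; rewrite /fcfs_le => /orP[h1|/andP[/eqP h1 l1]] /orP[h2|/andP[/eqP h2 l2]].
- by rewrite (lt_trans h1 h2).
- by rewrite -h2 h1.
- by rewrite h1 h2.
- by rewrite h1 h2 eqxx (leq_trans l1 l2) orbT.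
Qed.

Lemma fcfs_le_anti : antisymmetric (fcfs_le dvec n lam z org k).
Proof.
move=> x y; rewrite /fcfs_le; case: ltgtP => //= _ /andP[h1 h2].
by apply/eqP; rewrite eqn_leq h1.
Qed.

(** Breaking ties by index makes the relation a total order, so the sorted list is unique. The event
    that the queue order is [l'] thus becomes a finite conjunction of comparisons. *)
Lemma sort_fcfsP (l l' : seq nat) :
  (sort (fcfs_le dvec n lam z org k) l = l') <->
  (perm_eq l l' && sorted (fcfs_le dvec n lam z org k) l').
Proof.
split=> [<-|/andP[pl sl]].
  by rewrite perm_sym perm_sort perm_refl sort_sorted //; exact: fcfs_le_total.
apply: (sorted_eq fcfs_le_trans fcfs_le_anti _ sl); last by rewrite perm_sort.
by apply: sort_sorted; exact: fcfs_le_total.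
Qed.

End FcfsOrder.

Lemma custs_at_lt (s : nat) (sig : seq (option 'I_s)) (k : 'I_s) :
  all (fun c => c < size sig)%N (custs_at sig k).
Proof. by apply/allP => c; rewrite mem_filter mem_iota add0n => /andP[_]. Qed.

Section DynamicsMeasurable.
Context {d} {T : measurableType d} {R : realType} {s b : nat}.
Variables (mu : 'I_s -> R) (dvec : 'I_b -> 'I_s -> R) (n : nat) (lam : R).
Variables (z : nat -> T -> R) (w : 'I_s -> nat -> T -> R) (org : nat -> T -> 'I_b)
  (u : nat -> T -> R).
Variables (known : bool) (r : 'I_b -> 'I_s -> R) (eps : 'I_s -> R).
Variables (epsm : 'I_b -> 'I_s -> {perm 'I_s} -> R) (tb : nat -> ('I_s -> R) -> {perm 'I_s}).
Variable j : nat.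
Hypothesis mz : forall i, measurable_fun setT (z i).
Hypothesis mw : forall k i, measurable_fun setT (w k i).
Hypothesis morg : forall i, (i < j)%N -> mdisc (org i).
Hypothesis mun : forall i, (i < j)%N -> measurable_fun setT (u i).

Let zz t := fun i => z i t.
Let ww t := fun k i => w k i t.
Let oo t := fun i => org i t.
Let uu t := fun i => u i t.

Lemma measurable_appear c : measurable_fun setT (fun t => appear lam (zz t) c).
Proof.
apply: measurable_funM => //.
by apply: (@measurable_sum _ _ _ _ _ _ (fun i : 'I_c.+1 => z i)) => i; exact: mz.
Qed.

Lemma measurable_arrive c k : (c < j)%N ->
  measurable_fun setT (fun t => arrive dvec n lam (zz t) (oo t) c k).
Proof.
move=> cj; apply: measurable_funD; first exact: measurable_appear.
apply: measurable_funM => //.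
by apply: (measurable_fun_bind (g := fun m _ => dvec m k)) => //; exact: morg.
Qed.

Lemma mdisc_fcfs_le k c c' : (c < j)%N -> (c' < j)%N ->
  mdisc (fun t => fcfs_le dvec n lam (zz t) (oo t) k c c').
Proof.
move=> cj cj'; apply: mdisc_fun_bool; apply: measurable_or.
  by apply: measurable_fun_ltr; exact: measurable_arrive.
apply: measurable_and; last exact: measurable_cst.
by apply: measurable_fun_eqr; exact: measurable_arrive.
Qed.

Lemma mdisc_andb (f g : T -> bool) : mdisc f -> mdisc g -> mdisc (fun t => f t && g t).
Proof.
move=> mf mg; apply: (mdisc_bind (g := fun a t => a && g t)) => // -[] //=.
exact: mdisc_cst.
Qed.

Lemma mdisc_queue_order sig k : (size sig <= j)%N ->
  mdisc (fun t => queue_order dvec n lam (zz t) (oo t) sig k).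
Proof.
move=> sj l'; have hl := custs_at_lt sig k.
have [pl|npl] := boolP (perm_eq (custs_at sig k) l'); last first.
  rewrite (_ : _ @^-1` _ = set0) //; apply/seteqP; split => // t /= /sort_fcfsP.
  by rewrite (negbTE npl).
have {hl} : all (fun c => c < j)%N l'.
  apply/allP => c cl'; move/allP: hl => /(_ c); rewrite (perm_mem pl) => /(_ cl') h.
  exact: leq_trans h sj.
move=> hl.
have -> : (fun t => queue_order dvec n lam (zz t) (oo t) sig k) @^-1` [set l'] =
    (fun t => sorted (fcfs_le dvec n lam (zz t) (oo t) k) l') @^-1` [set true].
  by apply/seteqP; split => t /=; [move=> /sort_fcfsP; rewrite pl|move=> h; apply/sort_fcfsP; rewrite pl].
suff : mdisc (fun t => sorted (fcfs_le dvec n lam (zz t) (oo t) k) l') by apply.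
case: l' {pl} hl => [|c l] /=; first by move=> _; exact: mdisc_cst.
elim: l c => [|c' l IH] c /=; first by move=> _; exact: mdisc_cst.
move=> /and3P[cj cj' hl]; apply: mdisc_andb; first exact: mdisc_fcfs_le.
by apply: IH; rewrite cj' hl.
Qed.

(** The induction carries the previous departure time as a random variable. Departure times are
    real-valued; only the resulting count is discrete. *)
Lemma mdisc_count_departures (L : seq ((T -> R) * (T -> R))) (prev : option (T -> R)) (x : T -> R) :
  measurable_fun setT x ->
  (forall g, prev = Some g -> measurable_fun setT g) ->
  (forall p, List.In p L -> measurable_fun setT p.1 /\ measurable_fun setT p.2) ->
  mdisc (fun t => count (fun ad => (ad.1 < x t) && (x t <= ad.2))
     (zip [seq p.1 t | p <- L]
        (departures (omap (fun g => g t) prev) [seq (p.1 t, p.2 t) | p <- L]))).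
Proof.
move=> mx; elim: L prev => [|[a sv] L IH] prev mp mL /=; first exact: mdisc_cst.
have [ma msv] := mL _ (or_introl erefl); rewrite /= in ma msv.
pose dep : T -> R := (if prev is Some g then (fun t => Num.max (a t) (g t) + sv t)
   else (fun t => a t + sv t)).
have mdep : measurable_fun setT dep.
  rewrite /dep; case: prev mp {dep} => [g|] mp; apply: measurable_funD => //.
  by apply: measurable_maxr => //; exact: mp.
have {}IH := IH (Some dep) _ (fun p pL => mL p (or_intror pL)).
have {}IH := IH (fun g => fun e => ltac:(by case: e => <-)).
have edep t : (if omap (fun g => g t) prev is Some p then Num.max (a t) p else a t) + sv t = dep t.
  by rewrite /dep; case: prev {mp mdep dep IH}.
pose rest t := count (fun ad : R * R => (ad.1 < x t) && (x t <= ad.2))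
     (zip [seq p.1 t | p <- L] (departures (Some (dep t)) [seq (p.1 t, p.2 t) | p <- L])).
apply: (@eq_ind _ (fun t => addn ((a t < x t) && (x t <= dep t)) (rest t)) mdisc); last first.
  by apply/funext => t; rewrite /rest -edep.
apply: (mdisc_bind (f := fun t => (a t < x t) && (x t <= dep t)) (g := fun (bb : bool) t => addn bb (rest t))).
  by apply: mdisc_andb; apply: mdisc_fun_bool; [exact: measurable_fun_ltr|exact: measurable_fun_ler].
by move=> bb; apply: (mdisc_comp (fun m => (bb + m)%N) IH).
Qed.

Lemma mdisc_qlen_left sig k c : (size sig <= j)%N ->
  mdisc (fun t => qlen_left mu dvec n lam (zz t) (ww t) (oo t) sig k (appear lam (zz t) c)).
Proof.
move=> sj; rewrite /qlen_left /station_data.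
pose G (l : seq nat) t := count (fun ad => (ad.1 < appear lam (zz t) c) && (appear lam (zz t) c <= ad.2))
  (zip [seq arrive dvec n lam (zz t) (oo t) c k | c <- l]
   (departures None (zip [seq arrive dvec n lam (zz t) (oo t) c k | c <- l]
       [seq ww t k i / mu k | i <- iota 0 (size l)]))).
have mG (l : seq nat) : all (fun c => c < j)%N l -> mdisc (G l).
  move=> hl; pose L := zip [seq (fun t => arrive dvec n lam (zz t) (oo t) c k) | c <- l]
     [seq (fun t => ww t k i / mu k) | i <- iota 0 (size l)].
  have sL : size [seq (fun t => arrive dvec n lam (zz t) (oo t) c k) | c <- l] =
            size [seq (fun t => ww t k i / mu k) | i <- iota 0 (size l)].
    by rewrite !size_map size_iota.
  have hL p : List.In p L -> measurable_fun setT p.1 /\ measurable_fun setT p.2.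
    move=> pL.
    have {pL} : exists c i, c \in l /\ p = ((fun t => arrive dvec n lam (zz t) (oo t) c k), (fun t => ww t k i / mu k)).
      move: pL; rewrite /L; elim: l (iota 0 _) {hl L sL} => [|c0 l IH] [|i il] //= [<-|/IH [c1 [i1 [h ->]]]].
        by exists c0, i; rewrite inE eqxx.
      by exists c1, i1; rewrite inE h orbT.
    case=> c1 [i [cl ->]] /=; split; first by apply: measurable_arrive; exact: (allP hl).
    by apply: measurable_funM => //; exact: mw.
  have h := @mdisc_count_departures L None (fun t => appear lam (zz t) c) (measurable_appear c)
    (fun g e => ltac:(by [])) hL.
  move: h; rewrite (_ : (fun t => _) = G l) //.
  apply/funext => t; rewrite /G.
  have e1 : [seq p.1 t | p <- L] = [seq arrive dvec n lam (zz t) (oo t) c k | c <- l].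
    have -> : [seq p.1 t | p <- L] = [seq f t | f <- unzip1 L] by rewrite -map_comp.
    by rewrite unzip1_zip ?sL // -map_comp.
  have e2 : [seq p.2 t | p <- L] = [seq ww t k i / mu k | i <- iota 0 (size l)].
    have -> : [seq p.2 t | p <- L] = [seq f t | f <- unzip2 L] by rewrite -map_comp.
    by rewrite unzip2_zip ?sL // -map_comp.
  have e3 (L0 : seq ((T -> R) * (T -> R))) :
      [seq (p.1 t, p.2 t) | p <- L0] = zip [seq p.1 t | p <- L0] [seq p.2 t | p <- L0].
    by elim: L0 => //= p L0 ->.
  by rewrite e3 e1 e2.
(* Lists with an index at or beyond [j] never occur as queue orders; the default 0 makes the map
   measurable for every [l], as [mdisc_bind] asks. *)
pose G' (l : seq nat) t := if all (fun c => c < j)%N l then G l t else 0%N.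
have -> : (fun t => count (fun ad : R * R => (ad.1 < appear lam (zz t) c) && (appear lam (zz t) c <= ad.2))
   (zip [seq arrive dvec n lam (zz t) (oo t) c0 k | c0 <- queue_order dvec n lam (zz t) (oo t) sig k]
   (departures None (zip [seq arrive dvec n lam (zz t) (oo t) c0 k | c0 <- queue_order dvec n lam (zz t) (oo t) sig k]
       [seq ww t k i / mu k | i <- iota 0 (size (queue_order dvec n lam (zz t) (oo t) sig k))])))) =
   (fun t => G' (queue_order dvec n lam (zz t) (oo t) sig k) t).
  apply/funext => t.
  have hq : all (fun c => (c < j)%N) (queue_order dvec n lam (zz t) (oo t) sig k).
    by rewrite all_sort; apply: sub_all (custs_at_lt sig k) => c0 h; exact: leq_trans h sj.
  by rewrite /G' hq.
apply: mdisc_bind; first exact: mdisc_queue_order.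
move=> l; rewrite /G'; have [/mG //|_] := boolP (all (fun c => (c < j)%N) l); exact: mdisc_cst.
Qed.

Lemma mdisc_zeta sig c : (size sig <= j)%N ->
  mdisc (fun t => tb c (loads_before mu dvec n lam (zz t) (ww t) (oo t) sig c)).
Proof.
move=> sj.
have -> : (fun t => tb c (loads_before mu dvec n lam (zz t) (ww t) (oo t) sig c)) =
  (fun t => (fun ff : {ffun 'I_s -> nat} => tb c (fun k => (ff k)%:R / mu k))
     [ffun k => qlen_left mu dvec n lam (zz t) (ww t) (oo t) sig k (appear lam (zz t) c)]).
  by apply/funext => t; congr (tb c _); apply/funext => k; rewrite ffunE.
apply: (mdisc_comp (fun ff : {ffun 'I_s -> nat} => tb c (fun k => (ff k)%:R / mu k))).
apply: (mdisc_ffun (h := fun k t => qlen_left mu dvec n lam (zz t) (ww t) (oo t) sig k (appear lam (zz t) c))) => k.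
exact: mdisc_qlen_left.
Qed.

Lemma mdisc_route_decision zeta i : (i < j)%N ->
  mdisc (fun t => route_decision mu known r eps epsm zeta (org i t) (u i t)).
Proof.
move=> ij; apply: (mdisc_bind (g := fun m t => route_decision mu known r eps epsm zeta m (u i t))).
  exact: morg.
move=> m; rewrite /route_decision.
pose Q (k : 'I_s) t := (\sum_(l < s | (l < k)%N) route_weight mu known r eps epsm zeta^-1%g m l <= u i t) &&
   (u i t < \sum_(l < s | (l <= k)%N) route_weight mu known r eps epsm zeta^-1%g m l).
have -> : (fun t => [pick k : 'I_s | (\sum_(l < s | (l < k)%N) route_weight mu known r eps epsm zeta^-1%g m l <= u i t) &&
   (u i t < \sum_(l < s | (l <= k)%N) route_weight mu known r eps epsm zeta^-1%g m l)]) =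
  (fun t => (fun ff : {ffun 'I_s -> bool} => [pick k : 'I_s | ff k]) [ffun k => Q k t]).
  by apply/funext => t; apply: eq_pick => k; rewrite ffunE.
apply: (mdisc_comp (fun ff : {ffun 'I_s -> bool} => [pick k : 'I_s | ff k])).
apply: (mdisc_ffun (h := Q)) => k; apply: mdisc_andb; apply: mdisc_fun_bool.
  by apply: measurable_fun_ler => //; exact: mun.
by apply: measurable_fun_ltr => //; exact: mun.
Qed.

Lemma size_assign (z0 : nat -> R) w0 org0 u0 i :
  size (assign mu dvec n lam z0 w0 org0 u0 known r eps epsm tb i) = i.
Proof. by elim: i => //= i IH; rewrite size_rcons IH. Qed.

Lemma mdisc_assign i : (i <= j)%N ->
  mdisc (fun t => assign mu dvec n lam (zz t) (ww t) (oo t) (uu t) known r eps epsm tb i).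
Proof.
elim: i => [|i IH] ij /=; first exact: mdisc_cst.
pose G (sig : seq (option 'I_s)) t := if (size sig <= j)%N then rcons sig (route_decision mu known r eps epsm
   (tb i (loads_before mu dvec n lam (zz t) (ww t) (oo t) sig i)) (org i t) (u i t)) else [::].
have -> : (fun t => rcons (assign mu dvec n lam (zz t) (ww t) (oo t) (uu t) known r eps epsm tb i)
   (route_decision mu known r eps epsm (tb i (loads_before mu dvec n lam (zz t) (ww t) (oo t)
     (assign mu dvec n lam (zz t) (ww t) (oo t) (uu t) known r eps epsm tb i) i)) (oo t i) (uu t i))) =
  (fun t => G (assign mu dvec n lam (zz t) (ww t) (oo t) (uu t) known r eps epsm tb i) t).
  by apply/funext => t; rewrite /G size_assign ltnW.
apply: mdisc_bind; first by apply: IH; exact: ltnW.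
move=> sig; rewrite /G; have [sj|_] := boolP (size sig <= j)%N; last exact: mdisc_cst.
apply: (mdisc_comp (fun o => rcons sig o)).
apply: (mdisc_bind (f := fun t => tb i (loads_before mu dvec n lam (zz t) (ww t) (oo t) sig i))
   (g := fun zeta t => route_decision mu known r eps epsm zeta (org i t) (u i t))).
  exact: mdisc_zeta.
by move=> zeta; exact: mdisc_route_decision.
Qed.

(** Origins and uniform variables are assumed measurable only for indices below [j]: the ranking
    used by customer [j] is therefore independent of that customer's own origin and uniform
    variable. *)
Lemma mdisc_ranking :
  mdisc (fun t => tb j (loads_before mu dvec n lam (zz t) (ww t) (oo t)
    (assign mu dvec n lam (zz t) (ww t) (oo t) (uu t) known r eps epsm tb j) j)).
Proof.
pose G (sig : seq (option 'I_s)) t := if (size sig <= j)%N then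
   tb j (loads_before mu dvec n lam (zz t) (ww t) (oo t) sig j) else 1%g.
have -> : (fun t => tb j (loads_before mu dvec n lam (zz t) (ww t) (oo t)
    (assign mu dvec n lam (zz t) (ww t) (oo t) (uu t) known r eps epsm tb j) j)) =
  (fun t => G (assign mu dvec n lam (zz t) (ww t) (oo t) (uu t) known r eps epsm tb j) t).
  by apply/funext => t; rewrite /G size_assign leqnn.
apply: mdisc_bind; first exact: mdisc_assign.
move=> sig; rewrite /G; have [sj|_] := boolP (size sig <= j)%N; [exact: mdisc_zeta|exact: mdisc_cst].
Qed.

End DynamicsMeasurable.

(** * The single-server station *)

Lemma count_lt_iota (R : realType) (f : nat -> R) (M : nat) (t : R) (i : nat) :
  (forall i j, (i <= j)%N -> (j < M)%N -> f i <= f j) -> (i < M)%N ->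
  (i < count (fun c => (f c < t)%R) (iota 0 M))%N = (f i < t).
Proof.
elim: M => // M IH hf; rewrite ltnS => iM.
rewrite -[M.+1]addn1 iotaD count_cat /= add0n addn0.
have hf' : forall i j, (i <= j)%N -> (j < M)%N -> f i <= f j.
  by move=> i0 j0 ij jM; apply: hf => //; exact: ltnW.
have [fM|Mf] := ltP (f M) t.
  have all_lt : count (fun c => (f c < t)%R) (iota 0 M) = M.
    rewrite (eq_in_count (a2 := predT)) ?count_predT ?size_iota // => c.
    by rewrite mem_iota add0n => /= cM; rewrite (le_lt_trans _ fM) //; apply: hf => //; exact: ltnW.
  by rewrite all_lt addn1 ltnS iM (le_lt_trans (hf _ _ iM (ltnSn _)) fM).
rewrite addn0; move: iM; rewrite leq_eqVlt => /orP[/eqP ->|iM]; last exact: IH.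
rewrite [RHS]ltNge Mf /= ltnNge; apply/negbTE; rewrite negbK.
by rewrite (leq_trans (count_size _ _)) // size_iota.
Qed.

Lemma count_lt_sorted (R : realType) (s : seq R) (t : R) (i : nat) :
  sorted <=%R s -> (i < size s)%N -> (i < count (fun x => (x < t)%R) s)%N = (nth 0 s i < t).
Proof.
move=> ss is'.
rewrite -[in LHS](mkseq_nth 0 s) /mkseq count_map.
apply: (@count_lt_iota _ (fun i => nth 0 s i)) => // i0 j ij js.
by apply: (sorted_leq_nth le_trans le_refl) => //; rewrite inE (leq_ltn_trans ij).
Qed.

Section SortedFilter.
Variables (T : eqType) (e : rel T) (p : pred T).
Hypothesis e_tr : transitive e.
Hypothesis p_down : forall x y, e x y -> p y -> p x.

Lemma sorted_filter_cat (l : seq T) : sorted e l -> l = [seq x <- l | p x] ++ [seq x <- l | predC p x].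
Proof.
elim: l => //= x l IH xl; have {}IH := IH (path_sorted xl).
case: (boolP (p x)) => px /=; first by rewrite -IH.
have np : all (predC p) l.
  apply/allP => y yl /=; apply: contraNN px; apply: p_down.
  by move: xl; rewrite (path_sortedE e_tr) => /andP[/allP h _]; exact: h.
have -> : [seq x <- l | p x] = [::].
  by apply/eqP; rewrite -(negbK (_ == _)) -has_filter; apply/hasPn => y /(allP np).
by rewrite /= (all_filterP np).
Qed.
End SortedFilter.

Section Departures.
Context {R : realType}.

Lemma size_departures (prev : option R) L : size (departures prev L) = size L.
Proof. by elim: L prev => [|[a sv] L IH] prev //=; rewrite IH. Qed.

Lemma take_departures (prev : option R) L m :
  take m (departures prev L) = departures prev (take m L).
Proof. by elim: L prev m => [|[a sv] L IH] prev [|m] //=; rewrite IH. Qed.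

Lemma nth_departures0 (L : seq (R * R)) : (0 < size L)%N ->
  nth 0 (departures None L) 0 = (nth 0 L 0).1 + (nth 0 L 0).2.
Proof. by case: L => // -[a sv]. Qed.

Lemma nth_departuresS (prev : option R) (L : seq (R * R)) i : (i.+1 < size L)%N ->
  nth 0 (departures prev L) i.+1 =
    Num.max (nth 0 L i.+1).1 (nth 0 (departures prev L) i) + (nth 0 L i.+1).2.
Proof.
elim: L prev i => [|[a sv] L IH] prev i //=; rewrite ltnS.
case: i => [|i] iL; last by rewrite IH.
by case: L IH iL => // -[a' sv'].
Qed.

End Departures.

Section Station.
Context {R : realType}.
Variables (As : seq R) (S : nat -> R).
Hypothesis S0 : forall i, 0 <= S i.
Hypothesis sAs : sorted <=%R As.

Let m := size As.
Let L := zip As [seq S i | i <- iota 0 m].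
Definition deps := departures None (zip As [seq S i | i <- iota 0 (size As)]).
(** This count and the two below are left limits at [t], like [qlen_left], because the policy ranks
    the stations just before an appearance. *)
Definition arr_count (t : R) : nat := count (fun x => x < t) As.
Definition dep_count (t : R) : nat := count (fun x => x < t) deps.
Definition present (t : R) : nat := count (fun ad => (ad.1 < t) && (t <= ad.2)) (zip As deps).

Let sizeL : size L = m.
Proof. by rewrite size_zip size_map size_iota minnn. Qed.

Let size_deps : size deps = m.
Proof. by rewrite size_departures sizeL. Qed.

Let nthL i : (i < m)%N -> nth 0 L i = (nth 0 As i, S i).
Proof.
move=> im; rewrite /L nth_zip ?size_map ?size_iota //; congr (_, _).
by rewrite (nth_map 0%N) ?size_iota // nth_iota.
Qed.

Lemma dep0 : (0 < m)%N -> nth 0 deps 0 = nth 0 As 0 + S 0%N.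
Proof. by move=> m0; rewrite /deps nth_departures0 ?sizeL // nthL. Qed.

Lemma depS i : (i.+1 < m)%N -> nth 0 deps i.+1 = Num.max (nth 0 As i.+1) (nth 0 deps i) + S i.+1.
Proof. by move=> im; rewrite /deps nth_departuresS ?sizeL // nthL. Qed.

Lemma arr_le_dep i : (i < m)%N -> nth 0 As i <= nth 0 deps i.
Proof.
case: i => [|i] im; first by rewrite dep0 // lerDl.
by rewrite depS // (le_trans (_ : _ <= Num.max (nth 0 As i.+1) (nth 0 deps i))) ?le_max ?lexx ?lerDl.
Qed.

Lemma dep_step i : (i.+1 < m)%N -> nth 0 deps i + S i.+1 <= nth 0 deps i.+1.
Proof. by move=> im; rewrite depS // lerD2r le_max lexx orbT. Qed.

Lemma deps_sorted : sorted <=%R deps.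
Proof.
apply/(sortedP 0) => i; rewrite size_deps => im.
by apply: le_trans (dep_step im); rewrite lerDl.
Qed.

Lemma deps_mono i j : (i <= j)%N -> (j < m)%N -> nth 0 deps i <= nth 0 deps j.
Proof.
move=> ij jm; apply: (sorted_leq_nth le_trans le_refl 0 deps_sorted) => //; rewrite inE size_deps //.
exact: leq_ltn_trans jm.
Qed.

Lemma lt_dep_count t i : (i < m)%N -> (i < dep_count t)%N = (nth 0 deps i < t).
Proof. by move=> im; apply: count_lt_sorted; rewrite ?size_deps //; exact: deps_sorted. Qed.

Lemma lt_arr_count t i : (i < m)%N -> (i < arr_count t)%N = (nth 0 As i < t).
Proof. exact: count_lt_sorted. Qed.

Lemma dep_count_le t : (dep_count t <= m)%N.
Proof. by rewrite -size_deps count_size. Qed.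

Lemma arr_count_le t : (arr_count t <= m)%N.
Proof. exact: count_size. Qed.

Lemma present_balance t : (present t + dep_count t = arr_count t)%N.
Proof.
rewrite /present /dep_count /arr_count.
have : forall i, (i < size As)%N -> nth 0 As i <= nth 0 deps i by exact: arr_le_dep.
have : size deps = size As by [].
elim: (As) (deps) => [|a l IH] [|x l'] //= [sl] h.
have h0 := h 0%N isT; rewrite /= in h0.
have -> : (a < t) = addn ((a < t) && (t <= x))%R (x < t)%R :> nat.
  have [tx|xt] := leP t x; first by rewrite andbT addn0.
  by rewrite andbF (le_lt_trans h0 xt).
rewrite addnACA; congr addn; apply: IH; first by case: sl.
by move=> i; exact: (h i.+1).
Qed.

(** The server handles one customer at a time, so these services fit one after another into the
    window. Customer [dep_count t1] may have begun service before [t1] and is left out. *)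
Lemma departures_le (t1 t2 : R) : t1 <= t2 ->
  \sum_((dep_count t1).+1 <= i < dep_count t2) S i <= t2 - t1.
Proof.
move=> t12; set D1 := dep_count t1; set D2 := dep_count t2.
have [D21|D12] := leqP D2 D1.
  by rewrite big_geq ?subr_ge0 // (leq_trans D21).
have D2m : (D2 <= m)%N by exact: dep_count_le.
have h k : (D1 + k < D2)%N -> nth 0 deps D1 + \sum_(D1.+1 <= i < (D1 + k).+1) S i <= nth 0 deps (D1 + k)%N.
  elim: k => [|k IH]; first by rewrite addn0 big_geq // addr0.
  rewrite addnS => kD; rewrite big_nat_recr /= ?ltnS ?leq_addr // addrA.
  apply: le_trans (dep_step (leq_trans kD D2m)); rewrite lerD2r.
  by apply: IH; exact: ltnW.
have D2e : D2 = (D1 + (D2 - D1.+1)).+1 by lia.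
have := h (D2 - D1.+1)%N; rewrite -D2e => /(_ _) h1.
have d1 : t1 <= nth 0 deps D1.
  by rewrite leNgt -lt_dep_count ?ltnn // (leq_trans D12).
have d2 : nth 0 deps (D1 + (D2 - D1.+1))%N < t2.
  by rewrite -lt_dep_count -/D2; lia.
have {}h1 := h1 (ltac:(lia)).
lra.
Qed.

(** Without idling, service passes from each customer to the next with no gap. Customer
    [dep_count t2] has arrived and not departed before [t2], so the services up to and including
    that one cover the window. *)
Lemma departures_ge (t1 t2 : R) : t1 < t2 ->
  (forall x, t1 < x -> x <= t2 -> (0 < present x)%N) ->
  (dep_count t2 < m)%N /\
  t2 - t1 <= \sum_(dep_count t1 <= i < (dep_count t2).+1) S i.
Proof.
move=> t12 busy; set D1 := dep_count t1; set D2 := dep_count t2.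
have first_in x : t1 < x -> x <= t2 -> (dep_count x < m)%N /\ nth 0 As (dep_count x) < x.
  move=> tx xt; have := busy x tx xt; have := present_balance x; have := arr_count_le x => h1 h2 h3.
  have h : (dep_count x < arr_count x)%N by lia.
  have hm : (dep_count x < m)%N by apply: leq_trans h h1.
  by split => //; rewrite -lt_arr_count.
have [D2m _] := first_in t2 t12 (lexx _).
split => //.
have D12 : (D1 <= D2)%N.
  rewrite leqNgt; apply/negP => h.
  have : (D2 < dep_count t2)%N by rewrite lt_dep_count // (lt_trans _ t12) // -lt_dep_count.
  by rewrite ltnn.
(* While the server stays busy, the customer [i] next in line has already arrived when
   the server becomes free, at time [e]. *)
have arrived i e : (D1 <= i)%N -> (i <= D2)%N -> t1 <= e -> e < t2 ->
   (forall i', (i' < i)%N -> nth 0 deps i' <= e) -> nth 0 As i <= e.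
  move=> Di iD te et he; rewrite leNgt; apply/negP => ea.
  (* If [i] arrived after [e], all earlier customers would have left before [x] while [i] had not
     arrived before [x]: the station would be empty at [x], against [busy]. *)
  pose x := Num.min (nth 0 As i) t2.
  have ex : e < x by rewrite lt_min ea.
  have xt : x <= t2 by rewrite ge_min lexx orbT.
  have [h1 h2] := first_in x (le_lt_trans te ex) xt.
  have ii : (i <= dep_count x)%N.
    rewrite leqNgt; apply/negP => h; have := he _ h.
    have : ~~ (nth 0 deps (dep_count x) < x) by rewrite -lt_dep_count // ltnn.
    by rewrite -leNgt => a1 a2; move: (le_lt_trans (le_trans a1 a2) ex); rewrite ltxx.
  have : nth 0 As i <= nth 0 As (dep_count x).
    apply: (sorted_leq_nth le_trans le_refl 0 sAs) => //; rewrite inE //.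
    exact: leq_ltn_trans h1.
  move=> /le_lt_trans => /(_ _ h2); rewrite /x lt_min ltxx //.
have h k : (D1 + k <= D2)%N -> nth 0 deps (D1 + k)%N <= t1 + \sum_(D1 <= i < (D1 + k).+1) S i.
  elim: k => [|k IH] kD.
    rewrite addn0 big_nat1.
    have pre i' : (i' < D1)%N -> nth 0 deps i' <= t1.
      by move=> h; apply: ltW; rewrite -lt_dep_count //; apply: leq_trans h _; exact: dep_count_le.
    have hA := arrived D1 t1 (leqnn _) D12 (lexx _) t12 pre.
    move: (leq_ltn_trans D12 D2m) hA pre; case: (D1) => [|D] Dm hA pre.
      by rewrite dep0 // lerD2r.
    by rewrite depS // lerD2r ge_max hA pre.
  have kD' : (D1 + k < D2)%N by rewrite -addnS.
  have {}IH := IH (ltnW kD').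
  rewrite addnS in kD *.
  have dk : nth 0 deps (D1 + k)%N < t2 by rewrite -lt_dep_count // (ltn_trans kD').
  have sum0 : 0 <= \sum_(D1 <= i < (D1 + k).+1) S i by rewrite sumr_ge0.
  pose e := Num.max t1 (nth 0 deps (D1 + k)%N).
  have hA : nth 0 As (D1 + k).+1 <= e.
    apply: arrived => //.
    - by rewrite leqW // leq_addr.
    - by rewrite le_max lexx.
    - by rewrite gt_max t12.
    - by move=> i' ik; rewrite le_max deps_mono ?orbT // (ltn_trans kD').
  rewrite big_nat_recr /= ?addrA; last by rewrite leqW // leq_addr.
  rewrite depS; last exact: leq_ltn_trans D2m.
  rewrite lerD2r.
  have he : e <= t1 + \sum_(D1 <= i < (D1 + k).+1) S i by rewrite ge_max IH lerDl sum0.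
  by rewrite ge_max IH (le_trans hA he).
have := h (D2 - D1)%N; rewrite subnKC // => /(_ (leqnn _)).
have : t2 <= nth 0 deps D2 by rewrite leNgt -lt_dep_count // ltnn.
lra.
Qed.

End Station.

Lemma take_zip (S T : Type) (s : seq S) (t : seq T) m : take m (zip s t) = zip (take m s) (take m t).
Proof. by elim: s t m => [|x s IH] [|y t] [|m] //=; rewrite ?IH // ; case: (take _ _). Qed.

(** Causality of the discipline: a departure time depends only on the customers ahead. As [p] is
    closed downwards it selects a prefix of the queue, and the customers behind it fail [f]. *)
Lemma count_zip_prefix (R : realType) (T : eqType) (e : rel T) (p : pred T) (l : seq T) (ar : T -> R)
    (S : nat -> R) (f : pred (R * R)) (g : pred R) :
  transitive e -> (forall x y, e x y -> p y -> p x) -> sorted e l ->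
  (forall ad, f ad -> g ad.1) -> (forall c, g (ar c) = p c) ->
  count f (zip [seq ar c | c <- l] (departures None (zip [seq ar c | c <- l] [seq S i | i <- iota 0 (size l)])))
  = count f (zip [seq ar c | c <- l & p c] (departures None (zip [seq ar c | c <- l & p c]
       [seq S i | i <- iota 0 (size [seq c <- l | p c])]))).
Proof.
move=> etr pd sl fg gp; have el := sorted_filter_cat etr pd sl.
set l1 := [seq c <- l | p c] in el *; set l2 := [seq c <- l | predC p c] in el.
set X := zip _ _; set n1 := size l1.
rewrite -(cat_take_drop n1 X) count_cat.
have sX : size [seq ar c | c <- l] = size (departures None (zip [seq ar c | c <- l] [seq S i | i <- iota 0 (size l)])).
  by rewrite size_departures size_zip !size_map size_iota minnn.
have t1 : take n1 [seq ar c | c <- l] = [seq ar c | c <- l1].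
  by rewrite el map_cat take_size_cat // size_map.
have sl' : size l = (n1 + size l2)%N by rewrite {1}el size_cat.
have -> : take n1 X = zip [seq ar c | c <- l1] (departures None (zip [seq ar c | c <- l1] [seq S i | i <- iota 0 n1])).
  rewrite /X take_zip take_departures take_zip t1; do 3 congr (_ _ _).
  by rewrite sl' iotaD map_cat take_size_cat // size_map size_iota.
rewrite [X in (_ + X)%N](_ : _ = 0%N) ?addn0 //.
apply/eqP; rewrite -leqn0.
apply: (@leq_trans (count (fun ad => g ad.1) (drop n1 X))); first exact: sub_count.
have -> : count (fun ad => g ad.1) (drop n1 X) = count g (drop n1 (unzip1 X)).
  by rewrite /unzip1 -map_drop count_map.
rewrite unzip1_zip ?sX // el map_cat drop_size_cat ?size_map // count_map.
rewrite (eq_in_count (a2 := pred0)) ?count_pred0 // => c; rewrite mem_filter /= gp => /andP[/negbTE -> _] //.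
Qed.

(** A time just after [t] and not beyond the next of finitely many event times: it turns the queue
    lengths [qlen] at [t] into left limits [qlen_left] at [t']. The bound [t + 1] keeps [t'] within
    the horizon. *)
Lemma separating_time (R : realType) (t : R) (X : seq R) :
  exists2 t', t < t' <= t + 1 & all (fun x => (x <= t) == (x < t')) X.
Proof.
elim: X => [|x X [t' /andP[tt t1] h]]; first by exists (t + 1); rewrite ?lexx ?andbT ?ltrDl.
exists (if x <= t then t' else Num.min t' x).
  case: ifPn => [_|]; first by rewrite tt.
  by rewrite -ltNge => tx; rewrite lt_min tt tx ge_min t1.
have [xt|tx] := leP x t; first by rewrite /= h xt (le_lt_trans xt tt).
rewrite /= leNgt tx lt_min ltxx andbF /=.
apply/allP => y yX; have /eqP := allP h _ yX.
have [yt|ty] := leP y t; rewrite lt_min => <- //.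
by rewrite (le_lt_trans yt tx).
Qed.

(** * Later customers do not change the past of the truncated systems *)

Section Path.
Context {R : realType} {s b : nat}.
Variables (mu : 'I_s -> R) (dvec : 'I_b -> 'I_s -> R) (n : nat) (lam : R).
Variables (z : nat -> R) (w : 'I_s -> nat -> R) (org : nat -> 'I_b) (u : nat -> R).
Variables (known : bool) (r : 'I_b -> 'I_s -> R) (eps : 'I_s -> R).
Variables (epsm : 'I_b -> 'I_s -> {perm 'I_s} -> R) (tb : nat -> ('I_s -> R) -> {perm 'I_s}).
Hypothesis mu0 : forall k, 0 < mu k.
Hypothesis d0 : forall m k, 0 <= dvec m k.
Hypothesis lam0 : 0 < lam.
Hypothesis z0 : forall i, 0 <= z i.
Hypothesis w0 : forall k i, 0 <= w k i.

Let asg := assign mu dvec n lam z w org u known r eps epsm tb.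
Let ap := appear lam z.
Let arv := arrive dvec n lam z org.

Definition ranking (j : nat) : {perm 'I_s} :=
  tb j (loads_before mu dvec n lam z w org (asg j) j).
Definition decision (j : nat) : option 'I_s :=
  route_decision mu known r eps epsm (ranking j) (org j) (u j).

Lemma onth_assign M c : (c < M)%N -> onth (asg M) c = Some (decision c).
Proof.
elim: M => // M IH; rewrite ltnS leq_eqVlt => /orP[/eqP ->|cM] /=.
  by rewrite -cats1 onth_cat size_assign ltnn subnn.
by rewrite -cats1 onth_cat size_assign cM IH.
Qed.

Lemma custs_at_assign M k : custs_at (asg M) k = [seq c <- iota 0 M | decision c == Some k].
Proof.
rewrite /custs_at size_assign; apply: eq_in_filter => c.
by rewrite mem_iota add0n => /= cM; rewrite onth_assign.
Qed.

Lemma appear_mono i j : (i <= j)%N -> ap i <= ap j.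
Proof.
move=> ij; rewrite /ap /appear ler_pM2r ?invr_gt0 // -!(big_mkord xpredT z).
by rewrite (big_cat_nat (n := i.+1) (p := j.+1)) //= lerDl sumr_ge0.
Qed.

Lemma appear_le_arrive c k : ap c <= arv c k.
Proof. by rewrite /arv /arrive lerDl mulr_ge0 ?sqrtr_ge0. Qed.

Let e k := fcfs_le dvec n lam z org k.

Lemma fcfs_arrive k c c' : e k c c' -> arv c k <= arv c' k.
Proof. by rewrite /e /fcfs_le -/arv => /orP[/ltW //|/andP[/eqP -> _]]. Qed.

Lemma queue_order_sorted sig k : sorted (e k) (queue_order dvec n lam z org sig k).
Proof. by apply: sort_sorted; exact: fcfs_le_total. Qed.

Lemma arrivals_sorted sig k : sorted <=%R [seq arv c k | c <- queue_order dvec n lam z org sig k].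
Proof.
rewrite sorted_map; apply: sub_sorted (queue_order_sorted sig k) => c c'; exact: fcfs_arrive.
Qed.

(** The predicate [g] abstracts [x < t] and [x <= t], so that left limits and current values are
    treated at once. The customers from [i] on fail [g], and by causality they do not influence
    those who satisfy it. *)
Lemma count_station_assign (f : pred (R * R)) (g : pred R) (k : 'I_s) (i j : nat) :
  (forall ad, f ad -> g ad.1) -> (forall x y, x <= y -> g y -> g x) ->
  (i <= j)%N -> (forall c, (i <= c)%N -> (c < j)%N -> ~~ g (arv c k)) ->
  count f (station_data mu dvec n lam z w org (asg j) k) =
  count f (station_data mu dvec n lam z w org (asg i) k).
Proof.
move=> fg gd ij hg.
have pd x y : e k x y -> g (arv y k) -> g (arv x k) by move=> /fcfs_arrive; exact: gd.
have key M := @count_zip_prefix _ _ (e k) (fun c => g (arv c k)) _ (arv^~ k) (fun i => w k i / mu k) f g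
  (@fcfs_le_trans _ _ _ _ _ _ _ _ _) pd (queue_order_sorted (asg M) k) fg (fun=> erefl).
rewrite /station_data -/arv; rewrite !key.
have fE M : [seq c <- queue_order dvec n lam z org (asg M) k | g (arv c k)] =
    sort (e k) [seq c <- custs_at (asg M) k | g (arv c k)].
  rewrite /queue_order filter_sort //; [exact: fcfs_le_total|exact: fcfs_le_trans].
rewrite !fE; suff -> : [seq c <- custs_at (asg j) k | g (arv c k)] = [seq c <- custs_at (asg i) k | g (arv c k)] by [].
rewrite !custs_at_assign -!filter_predI -(subnKC ij) iotaD add0n filter_cat.
rewrite [X in _ ++ X](_ : _ = [::]) ?cats0 //.
rewrite -(filter_pred0 (iota i (j - i))); apply: eq_in_filter => c.
by rewrite mem_iota subnKC // => /andP[ic cj] /=; rewrite (negbTE (hg _ ic cj)).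
Qed.

Lemma qlen_left_assign (k : 'I_s) (j M : nat) (t : R) : (j <= M)%N -> t <= ap j ->
  qlen_left mu dvec n lam z w org (asg M) k t = qlen_left mu dvec n lam z w org (asg j) k t.
Proof.
move=> jM tj; apply: (count_station_assign (g := fun x => x < t)) => //.
- by move=> ad /andP[].
- by move=> x y xy /(le_lt_trans xy).
- move=> c jc _; rewrite -leNgt (le_trans tj) // (le_trans (appear_mono jc)) //.
  exact: appear_le_arrive.
Qed.

Lemma Q_trunc_stable (k : 'I_s) (j M : nat) (t : R) : (j <= M)%N -> t < ap j ->
  Q_trunc mu dvec n lam z w org u known r eps epsm tb M k t =
  Q_trunc mu dvec n lam z w org u known r eps epsm tb j k t.
Proof.
move=> jM tj; apply: (count_station_assign (g := fun x => x <= t)) => //.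
- by move=> ad /andP[].
- by move=> x y; exact: le_trans.
- move=> c jc _; rewrite -ltNge (lt_le_trans tj) // (le_trans (appear_mono jc)) //.
  exact: appear_le_arrive.
Qed.

Lemma Qlen_trunc (k : 'I_s) (M : nat) (t : R) : t < ap M ->
  Qlen mu dvec n lam z w org u known r eps epsm tb k t =
  Q_trunc mu dvec n lam z w org u known r eps epsm tb M k t.
Proof.
move=> tM; rewrite /Qlen; set A := [set q | _].
have : A (xget 0%N A).
  by apply: (@xgetPex _ 0%N A); exists (Q_trunc mu dvec n lam z w org u known r eps epsm tb M k t), M => M' MM;
    exact: Q_trunc_stable.
by move=> [N hN]; rewrite -(hN _ (leq_maxl N M)); apply: Q_trunc_stable; rewrite ?leq_maxr.
Qed.

End Path.

(** * The drift of the loads *)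

(** The supremum of the times satisfying [P] need not be attained, as queue lengths jump. A time
    within 1 of it is enough: the gap of one unit is absorbed by the noise terms. *)
Lemma last_time (R : realType) (P : R -> Prop) (a t : R) : P a -> a <= t ->
  exists t1, [/\ a <= t1, t1 <= t, P t1 & forall x, t1 + 1 <= x -> x <= t -> ~ P x].
Proof.
move=> Pa at_; pose E := [set x | [/\ a <= x, x <= t & P x]].
have hE : has_sup E by split; [exists a; split|exists t => x [_ + _]].
have [t1 [a1 tt1 P1] h1] := sup_adherent (ltr01 : 0 < 1) hE.
exists t1; split => // x tx xt Px.
have : x <= sup E by apply: (ub_le_sup hE.2); split => //; apply: (le_trans a1); lra.
lra.
Qed.

(** The deviation of a walk is bounded relative to its number of steps [y], which is the unknown.
    This and the next lemma trade it for a bound relative to the known length [V]. *)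
Lemma solve_le (R : realType) (y V e c : R) : 0 <= y -> 0 <= V -> 0 <= c -> 0 <= e -> e <= 1 / 2 ->
  y - (e * y + c) <= V -> y <= V + 2 * (e * V) + 2 * c.
Proof.
move=> y0 V0 c0 e0 e2 h.
have y2 : y <= 2 * V + 2 * c.
  have : e * y <= 1 / 2 * y by apply: ler_wpM2r.
  lra.
have : e * y <= e * (2 * V + 2 * c) by apply: ler_wpM2l.
have : e * c <= 1 / 2 * c by apply: ler_wpM2r.
lra.
Qed.

Lemma solve_ge (R : realType) (y V e c : R) : 0 <= V -> 0 <= c -> 0 <= e ->
  V <= y + (e * y + c) -> V - e * V - c <= y.
Proof.
move=> V0 c0 e0 h; have [Vy|yV] := leP V y.
  have : 0 <= e * V := mulr_ge0 e0 V0; lra.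
have : e * y <= e * V := ler_wpM2l e0 (ltW yV); lra.
Qed.

Section Drift.
Context {R : realType} {s b : nat}.
Variables (mu : 'I_s -> R) (dvec : 'I_b -> 'I_s -> R) (n : nat) (lam : R).
Variables (z : nat -> R) (w : 'I_s -> nat -> R) (org : nat -> 'I_b) (u : nat -> R).
Variables (known : bool) (r : 'I_b -> 'I_s -> R) (eps : 'I_s -> R).
Variables (epsm : 'I_b -> 'I_s -> {perm 'I_s} -> R) (tb : nat -> ('I_s -> R) -> {perm 'I_s}).
Hypothesis mu0 : forall k, 0 < mu k.
Hypothesis d0 : forall m k, 0 <= dvec m k.
Hypothesis lam0 : 0 < lam.
Hypothesis z0 : forall i, 0 <= z i.
Hypothesis w0 : forall k i, 0 <= w k i.
Variables (M : nat) (H : R).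
Hypothesis M0 : (0 < M)%N.

Let asg := assign mu dvec n lam z w org u known r eps epsm tb.
Let ap := appear lam z.
Let arv := arrive dvec n lam z org.
Let rk j := ranking mu dvec n lam z w org u known r eps epsm tb j.
Let dec j := decision mu dvec n lam z w org u known r eps epsm tb j.
Hypothesis HM : H <= ap M.-1.

(* [x] is the balancing fraction [chi n], and [CB] is a constant multiple of
   [noise_scale n (chi n)]. *)
Variables (x c0 CB : R).
Hypothesis x0 : 0 < x.
Hypothesis c00 : 0 <= c0.
Hypothesis cx : c0 * x <= 1 / 2.
Hypothesis CB1 : 1 <= CB.
Let err (a c : nat) : R := c0 * x * (c - a)%N%:R + CB.
Hypothesis hz : forall a c, (a <= c)%N -> (c <= M)%N ->
  `|\sum_(a <= i < c) (z i - 1)| <= err a c.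
Hypothesis hw : forall k a c, (a <= c)%N -> (c <= M)%N ->
  `|\sum_(a <= i < c) (w k i - 1)| <= err a c.

Definition entered (t : R) : nat := count (fun c => ap c < t) (iota 0 M).
Definition queue (k : 'I_s) (t : R) : nat := qlen_left mu dvec n lam z w org (asg M) k t.
Let As k := [seq arv c k | c <- queue_order dvec n lam z org (asg M) k].
Definition arrived (k : 'I_s) (t : R) : nat := arr_count (As k) t.
Definition departed (k : 'I_s) (t : R) : nat := dep_count (As k) (fun i => w k i / mu k) t.
Definition slack (tau : R) : R := c0 * x * tau + CB.

Let mu_tot := mutot mu.

Let S0 k : forall i, 0 <= w k i / mu k.
Proof. by move=> i; rewrite divr_ge0 // ltW. Qed.

Let sAs k : sorted <=%R (As k).
Proof. exact: arrivals_sorted. Qed.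

Let size_As k : (size (As k) <= M)%N.
Proof.
rewrite size_map size_sort custs_at_assign.
by apply: (leq_trans (size_subseq (filter_subseq _ _))); rewrite size_iota.
Qed.

Lemma queue_balance k t : (queue k t + departed k t)%N = arrived k t.
Proof.
have := present_balance (As k) (S0 k) t; rewrite /queue /departed /arrived => <-.
by rewrite /qlen_left /station_data /present /deps /As !size_map.
Qed.

Lemma entered_mono t1 t2 : t1 <= t2 -> (entered t1 <= entered t2)%N.
Proof. by move=> t12; apply: sub_count => c /= h; exact: lt_le_trans t12. Qed.

Lemma lt_entered t c : (c < M)%N -> (c < entered t)%N = (ap c < t).
Proof.
by move=> cM; apply: (@count_lt_iota R ap M t c) => // i j ij _; exact: appear_mono.
Qed.

Lemma entered_lt t : t <= H -> (entered t < M)%N.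
Proof.
move=> tH; rewrite ltnNge; apply/negP => h.
have hM : (M.-1 < M)%N by rewrite ltn_predL.
have : (M.-1 < entered t)%N by apply: leq_trans h.
by rewrite lt_entered // ltNge (le_trans tH HM).
Qed.

Let sum_unit (f : nat -> R) a c : (a <= c)%N ->
  \sum_(a <= i < c) (f i - 1) = \sum_(a <= i < c) f i - (c - a)%N%:R.
Proof. by move=> ac; rewrite sumrB sumr_const_nat. Qed.

Let cx0 : 0 <= c0 * x. Proof. by rewrite mulr_ge0 // ltW. Qed.
Let CB0 : 0 <= CB. Proof. exact: le_trans ler01 CB1. Qed.

Lemma sum_lower (f : nat -> R) a c V : (forall a c, (a <= c)%N -> (c <= M)%N ->
  `|\sum_(a <= i < c) (f i - 1)| <= err a c) -> (a <= c)%N -> (c <= M)%N ->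
  0 <= V -> \sum_(a <= i < c) f i <= V -> (c - a)%N%:R <= V + 2 * (c0 * x * V) + 2 * CB.
Proof.
move=> hf ac cM V0 hV; apply: solve_le => //.
have := hf a c ac cM; rewrite sum_unit // ler_norml /err => /andP[h1 _]; lra.
Qed.

Lemma sum_upper (f : nat -> R) a c V : (forall a c, (a <= c)%N -> (c <= M)%N ->
  `|\sum_(a <= i < c) (f i - 1)| <= err a c) -> (a <= c)%N -> (c <= M)%N ->
  0 <= V -> V <= \sum_(a <= i < c) f i -> V - c0 * x * V - CB <= (c - a)%N%:R.
Proof.
move=> hf ac cM V0 hV; apply: solve_ge => //.
have := hf a c ac cM; rewrite sum_unit // ler_norml /err => /andP[_ h1]; lra.
Qed.

Lemma lam_appear j : lam * ap j = \sum_(0 <= i < j.+1) z i.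
Proof. by rewrite /ap /appear big_mkord mulrCA mulfV ?mulr1 // gt_eqF. Qed.

Lemma entered_upper t1 t2 : t1 <= t2 -> t2 <= H ->
  (entered t2 - entered t1)%N%:R <= lam * (t2 - t1) + (2 * lam + 3) * slack (t2 - t1).
Proof.
move=> t12 tH; set N1 := entered t1; set N2 := entered t2.
have CB1' := CB1; have tau0 : 0 <= t2 - t1 by rewrite subr_ge0.
have V0 : 0 <= lam * (t2 - t1) by rewrite mulr_ge0 // ltW.
have s0 : 0 <= c0 * x * (t2 - t1) by rewrite mulr_ge0.
have l0 : 0 <= lam * (c0 * x * (t2 - t1)) by rewrite mulr_ge0 // ltW.
have l1 : 0 <= lam * CB by rewrite mulr_ge0 // ltW.
rewrite /slack; have [N21|N12] := leqP N2 N1.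
  by move: (N21); rewrite -subn_eq0 => /eqP ->; rewrite !mulrDl !mulrDr; lra.
have N2M : (N2 < M)%N by exact: entered_lt.
have a1 : t1 <= ap N1.
  by rewrite leNgt -lt_entered ?ltnn // (ltn_trans N12).
have N20 : (0 < N2)%N by apply: leq_ltn_trans N12.
have N2e : N2.-1.+1 = N2 by rewrite prednK.
have a2 : ap N2.-1 < t2.
  by rewrite -lt_entered ?(leq_ltn_trans (leq_pred _) N2M) // -/N2 ltn_predL.
(* The gap ending at the appearance of customer [N1] may begin before [t1] and is left out; it costs
   one unit in the count. *)
have h : \sum_(N1.+1 <= i < N2) z i <= lam * (t2 - t1).
  have := lam_appear N2.-1; rewrite N2e (big_cat_nat (n := N1.+1)) //= -lam_appear => e.
  have e1 : lam * ap N2.-1 <= lam * t2 by rewrite ler_pM2l // ltW.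
  have e2 : lam * t1 <= lam * ap N1 by rewrite ler_pM2l.
  rewrite mulrBr; lra.
have := sum_lower hz N12 (ltnW N2M) V0 h.
have -> : (N2 - N1.+1)%N%:R = (N2 - N1)%N%:R - 1 :> R.
  by rewrite subnS -subn1 natrB // subn_gt0.
rewrite !mulrDl !mulrDr; lra.
Qed.

Lemma entered_lower t1 t2 : 0 <= t1 -> t1 <= t2 -> t2 <= H ->
  lam * (t2 - t1) - (lam + 3) * slack (t2 - t1) <= (entered t2 - entered t1)%N%:R.
Proof.
move=> t10 t12 tH; set N1 := entered t1; set N2 := entered t2.
have CB1' := CB1; have tau0 : 0 <= t2 - t1 by rewrite subr_ge0.
have V0 : 0 <= lam * (t2 - t1) by rewrite mulr_ge0 // ltW.
have s0 : 0 <= c0 * x * (t2 - t1) by rewrite mulr_ge0.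
have l0 : 0 <= lam * (c0 * x * (t2 - t1)) by rewrite mulr_ge0 // ltW.
have l1 : 0 <= lam * CB by rewrite mulr_ge0 // ltW.
have N12 : (N1 <= N2)%N by exact: entered_mono.
have N2M : (N2 < M)%N by exact: entered_lt.
have a2 : t2 <= ap N2 by rewrite leNgt -lt_entered ?ltnn.
have a1 : \sum_(0 <= i < N1) z i <= lam * t1.
  case E : N1 => [|N]; first by rewrite big_geq // mulr_ge0 // ltW.
  rewrite -lam_appear ler_pM2l // ltW // -lt_entered -/N1; first by rewrite E.
  by apply: leq_ltn_trans N2M; apply: leq_trans N12; rewrite E.
have h : lam * (t2 - t1) <= \sum_(N1 <= i < N2.+1) z i.
  have := lam_appear N2; rewrite (big_cat_nat (n := N1)) ?leqW //= => e.
  have e1 : lam * t2 <= lam * ap N2 by rewrite ler_pM2l.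
  rewrite mulrBr; lra.
have := sum_upper hz (leqW N12) N2M V0 h.
rewrite subSn // -natr1 /slack !mulrDl !mulrDr; lra.
Qed.

Lemma departed_le k t : (departed k t <= M)%N.
Proof. exact: leq_trans (dep_count_le _ _ t) (size_As k). Qed.

Lemma departed_mono k t1 t2 : t1 <= t2 -> (departed k t1 <= departed k t2)%N.
Proof. by move=> t12; apply: sub_count => c /= h; exact: lt_le_trans t12. Qed.

Lemma departed_upper k t1 t2 : t1 <= t2 ->
  (departed k t2 - departed k t1)%N%:R <= mu k * (t2 - t1) + (2 * mu k + 3) * slack (t2 - t1).
Proof.
move=> t12; set N1 := departed k t1; set N2 := departed k t2.
have CB1' := CB1; have tau0 : 0 <= t2 - t1 by rewrite subr_ge0.
have V0 : 0 <= mu k * (t2 - t1) by rewrite mulr_ge0 // ltW.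
have s0 : 0 <= c0 * x * (t2 - t1) by rewrite mulr_ge0.
have l0 : 0 <= mu k * (c0 * x * (t2 - t1)) by rewrite mulr_ge0 // ltW.
have l1 : 0 <= mu k * CB by rewrite mulr_ge0 // ltW.
rewrite /slack; have [N21|N12] := leqP N2 N1.
  by move: (N21); rewrite -subn_eq0 => /eqP ->; rewrite !mulrDl !mulrDr; lra.
have h : \sum_(N1.+1 <= i < N2) w k i <= mu k * (t2 - t1).
  have := departures_le (S0 k) (sAs k) t12; rewrite -/N1 -/N2 -mulr_suml ler_pdivrMr //.
  by rewrite mulrC.
have := sum_lower (hw k) N12 (departed_le k t2) V0 h.
have -> : (N2 - N1.+1)%N%:R = (N2 - N1)%N%:R - 1 :> R.
  by rewrite subnS -subn1 natrB // subn_gt0.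
rewrite !mulrDl !mulrDr; lra.
Qed.

Lemma departed_lower k t1 t2 : t1 <= t2 ->
  (forall y, t1 + 1 <= y -> y <= t2 -> (0 < queue k y)%N) ->
  mu k * (t2 - t1) - (2 * mu k + 3) * slack (t2 - t1) <= (departed k t2 - departed k t1)%N%:R.
Proof.
move=> t12 busy.
have CB1' := CB1; have tau0 : 0 <= t2 - t1 by rewrite subr_ge0.
have s0 : 0 <= c0 * x * (t2 - t1) by rewrite mulr_ge0.
have l0 : 0 <= mu k * (c0 * x * (t2 - t1)) by rewrite mulr_ge0 // ltW.
have m0 := mu0 k; have l1 : mu k <= mu k * CB by rewrite ler_peMr // ltW.
rewrite /slack; have [short|long] := leP t2 (t1 + 1).
  have : mu k * (t2 - t1) <= mu k * 1 by rewrite ler_pM2l //; lra.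
  have : 0 <= (departed k t2 - departed k t1)%N%:R :> R by [].
  by rewrite !mulrDl !mulrDr; lra.
have t01 : t1 <= t1 + 1 by lra.
have := departures_ge (S0 k) (sAs k) long _; rewrite -/(departed k t2) -/(departed k (t1 + 1)).
set N1 := departed k (t1 + 1); set N2 := departed k t2 => dge.
have [y y1 y2|N2s h0] := dge.
  have := busy y (ltW y1) y2; rewrite /queue /qlen_left /station_data /present /deps /As !size_map //.
have N12 : (N1 <= N2)%N by apply: departed_mono; exact: ltW.
have V0 : 0 <= mu k * (t2 - (t1 + 1)) by rewrite mulr_ge0 // ?ltW // subr_gt0.
have h : mu k * (t2 - (t1 + 1)) <= \sum_(N1 <= i < N2.+1) w k i.
  by move: h0; rewrite -mulr_suml ler_pdivlMr // mulrC.
have := sum_upper (hw k) (leqW N12) (leq_trans N2s (size_As k)) V0 h.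
have : (N2.+1 - N1)%N%:R <= (N2 - departed k t1)%N%:R + 1 :> R.
  by rewrite natr1 ler_nat subSn // ltnS leq_sub2l // departed_mono.
have : 0 <= c0 * x * mu k by rewrite mulr_ge0 // ltW.
rewrite !mulrDl !mulrDr; lra.
Qed.

Hypothesis tb_sort : forall j (L : 'I_s -> R) (l1 l2 : 'I_s), (l1 <= l2)%N ->
  L (tb j L l1) <= L (tb j L l2).
(** [wt] stands for the routing probabilities of the plan and [pert c] for the perturbation applied
    to customer [c]; this interface covers known and unknown origins alike. *)
Variables (p : 'I_b -> R) (wt : 'I_b -> 'I_s -> R) (pert : nat -> 'I_b -> 'I_s -> R).
Variables (delta dm : R).
Hypothesis p0 : forall m, 0 < p m.
Hypothesis p1 : \sum_(m < b) p m = 1.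
Hypothesis wt0 : forall m k, 0 <= wt m k.
Hypothesis wt1 : forall m, \sum_(k < s) wt m k = 1.
Hypothesis wt_mu : forall k, \sum_(m < b) p m * wt m k = mu k / mu_tot.
Hypothesis pert_le : forall c m k, `|p m * pert c m k| <= x.
Hypothesis pert_sum : forall c m, \sum_(k < s) pert c m k = 0.
Hypothesis pert_neg : forall c m k, (0 < ((rk c)^-1)%g k)%N -> pert c m k <= 0.
Hypothesis pert_drift : forall c k, (0 < ((rk c)^-1)%g k)%N ->
  \sum_(m < b) p m * pert c m k <= - (delta * x).
Hypothesis delta0 : 0 <= delta.
Hypothesis dm0 : 0 <= dm.
Hypothesis d_le : forall m k, dvec m k <= dm.
Hypothesis x1 : x <= 1.
Hypothesis nx : Num.sqrt n%:R * x <= CB.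
Hypothesis lam2 : lam <= 2 * mu_tot.
Hypothesis mut0 : 0 < mu_tot.

Definition hit (m : 'I_b) (k : 'I_s) (c : nat) : R := ((org c == m) && (dec c == Some k))%:R.
Hypothesis hm : forall m k a c, (a <= c)%N -> (c <= M)%N ->
  `|\sum_(a <= i < c) (hit m k i - p m * (wt m k + pert i m k))| <= err a c.

(** Customers from [c] on have not arrived before [ap c], so the queues of the full truncated system
    are those on which customer [c] was ranked. Rank 0 would contradict the sorting. *)
Lemma not_shortest c k l : (c < M)%N ->
  (queue l (ap c))%:R / mu l < (queue k (ap c))%:R / mu k -> (0 < ((rk c)^-1)%g k)%N.
Proof.
move=> cM; rewrite lt0n; apply: contraTneq => e; rewrite -leNgt.
have qE k' : (queue k' (ap c))%:R / mu k' = loads_before mu dvec n lam z w org (asg c) c k'.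
  by rewrite /loads_before /queue (@qlen_left_assign _ _ _ _ _ _ _ _ _ _ _ _ _ _ _ _ d0 lam0 z0 _ c) // ltnW.
rewrite !qE.
have := @tb_sort c (loads_before mu dvec n lam z w org (asg c) c) (((rk c)^-1)%g k) (((rk c)^-1)%g l).
by rewrite e leq0n => /(_ isT); rewrite /rk /ranking -/asg !permKV.
Qed.

Let delay m k := Num.sqrt n%:R * dvec m k.
Let delay0 m k : 0 <= delay m k. Proof. by rewrite mulr_ge0 ?sqrtr_ge0. Qed.
Let delay_le m k : delay m k <= Num.sqrt n%:R * dm.
Proof. by rewrite ler_wpM2l ?sqrtr_ge0. Qed.

(** The delay is a function of origin and station. For a given origin, those who have reached the
    station therefore form an initial segment of the customers, and the window bounds apply. *)
Lemma arrived_sum k t : (arrived k t)%:R = \sum_(m < b) \sum_(0 <= c < entered (t - delay m k)) hit m k c.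
Proof.
have e1 : arrived k t = count (fun c => (dec c == Some k) && (arv c k < t)) (iota 0 M).
  rewrite /arrived /arr_count count_map /queue_order.
  rewrite count_sort custs_at_assign count_filter /=; apply: eq_count => c /=; exact: andbC.
rewrite e1 -sum1_count natr_sum big_mkcond /=.
have -> : iota 0 M = index_iota 0 M by rewrite /index_iota subn0.
transitivity (\sum_(0 <= c < M) \sum_(m < b) (if (c < entered (t - delay m k))%N then hit m k c else 0)).
  apply: eq_big_nat => c /andP[_ cM].
  rewrite (bigD1 (org c)) //= big1 ?addr0 /hit => [|m /negbTE nm]; last first.
    by rewrite eq_sym nm; case: ifP.
  rewrite eqxx lt_entered // ltrBrDr -/(arv c k); by case: eqP => _ /=; case: ifP.
rewrite exchange_big /=; apply: eq_bigr => m _.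
rewrite [RHS](big_nat_widen _ _ M); last by apply: (leq_trans (count_size _ _)); rewrite size_iota.
by rewrite [RHS]big_mkcond.
Qed.

Let J m k t1 t2 : nat := (entered (t2 - delay m k) - entered (t1 - delay m k))%N.

Lemma arrived_diff k t1 t2 : t1 <= t2 -> (arrived k t2)%:R - (arrived k t1)%:R =
  \sum_(m < b) \sum_(entered (t1 - delay m k) <= c < entered (t2 - delay m k)) hit m k c.
Proof.
move=> t12; rewrite !arrived_sum -sumrB; apply: eq_bigr => m _.
rewrite (big_cat_nat (m := 0) (n := entered (t1 - delay m k)) (p := entered (t2 - delay m k))) //=.
  by rewrite addrAC subrr add0r.
by apply: entered_mono; lra.
Qed.

(** [K1] dominates the constants of [entered_upper] and [entered_lower]; [taud] is a bound on the
    travel times plus the unit lost in [last_time]; [K2 * CB] bounds the bias gathered in a window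
    of length [taud]. *)
Let K1 : R := 4 * mu_tot + 3.
Let taud : R := Num.sqrt n%:R * dm + 1.
Let K2 : R := 2 * mu_tot * (dm + 1) + K1 * (dm + 2).

Let K10 : 0 <= K1. Proof. by rewrite /K1 addr_ge0 // mulr_ge0 // ltW. Qed.
Let dmn : 0 <= Num.sqrt n%:R * dm. Proof. by rewrite mulr_ge0 ?sqrtr_ge0. Qed.

Let slack0 tau : 0 <= tau -> 0 <= slack tau /\ CB <= slack tau /\ c0 * x * tau <= slack tau.
Proof.
move=> t0; have h : 0 <= c0 * x * tau by rewrite mulr_ge0.
by have h2 := CB0; rewrite /slack; split; [|split]; lra.
Qed.

Let slack_mono t1 t2 : t1 <= t2 -> slack t1 <= slack t2.
Proof. by move=> t12; rewrite /slack lerD2r ler_wpM2l. Qed.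

Let J_upper t1 t2 : t1 <= t2 -> t2 <= H ->
  (entered t2 - entered t1)%N%:R <= lam * (t2 - t1) + K1 * slack (t2 - t1).
Proof.
move=> t12 tH; apply: (le_trans (entered_upper t12 tH)); rewrite lerD2l.
have t0 : 0 <= t2 - t1 by rewrite subr_ge0.
have [h _] := slack0 t0.
by apply: ler_wpM2r => //; rewrite /K1; have := lam2; lra.
Qed.

Let J_lower t1 t2 : 0 <= t1 -> t1 <= t2 -> t2 <= H ->
  lam * (t2 - t1) - K1 * slack (t2 - t1) <= (entered t2 - entered t1)%N%:R.
Proof.
move=> t10 t12 tH; apply: le_trans (entered_lower t10 t12 tH); rewrite lerD2l lerN2.
have t0 : 0 <= t2 - t1 by rewrite subr_ge0.
have [h _] := slack0 t0.
by apply: ler_wpM2r => //; rewrite /K1; have := lam2; have := mut0; lra.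
Qed.

Let xtaud : x * taud <= (dm + 1) * CB.
Proof.
have h1 : Num.sqrt n%:R * x * dm <= CB * dm by apply: ler_wpM2r.
have h2 : x <= CB := le_trans x1 CB1.
rewrite /taud; lra.
Qed.

Let lxt tau : 0 <= tau -> tau <= taud -> x * (lam * tau) <= 2 * mu_tot * (dm + 1) * CB.
Proof.
move=> t0 tt; have h : x * tau <= (dm + 1) * CB.
  by apply: le_trans xtaud; rewrite ler_pM2l.
rewrite mulrCA -mulrA; apply: ler_pM => //; first exact: ltW.
by rewrite mulr_ge0 // ltW.
Qed.

Let slack_taud tau : 0 <= tau -> tau <= taud -> x * slack tau <= (dm + 2) * CB.
Proof.
move=> t0 tt; have h : x * tau <= (dm + 1) * CB.
  by apply: le_trans xtaud; rewrite ler_pM2l.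
have xt0 : 0 <= x * tau by rewrite mulr_ge0 // ltW.
have h1 : (c0 * x) * (x * tau) <= 1 / 2 * (x * tau) by apply: ler_wpM2r.
have h2 : x * CB <= 1 * CB by apply: ler_wpM2r.
rewrite /slack; lra.
Qed.

(** Here the travel delays are paid for: of order $\sqrt n$ customers appear within [taud], each
    with bias at most [x], and $\sqrt n\,x \le CB$. *)
Let short_window t1 t2 : t1 <= t2 -> t2 <= H -> t2 - t1 <= taud ->
  x * (entered t2 - entered t1)%N%:R <= K2 * CB.
Proof.
move=> t12 tH td; have t0 : 0 <= t2 - t1 by rewrite subr_ge0.
apply: (@le_trans _ _ (x * (lam * (t2 - t1) + K1 * slack (t2 - t1)))).
  by rewrite ler_pM2l //; exact: J_upper.
have h1 := lxt t0 td.
have h2 : K1 * (x * slack (t2 - t1)) <= K1 * ((dm + 2) * CB).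
  by apply: ler_wpM2l => //; exact: slack_taud.
rewrite /K2; lra.
Qed.

Let KN : R := 2 * mu_tot + K1 + 1.

Let noise_le t1 t2 : t1 <= t2 -> t2 <= H ->
  err (entered t1) (entered t2) <= KN * slack (t2 - t1).
Proof.
move=> t12 tH; have t0 : 0 <= t2 - t1 by rewrite subr_ge0.
have [s0 [s1 s2]] := slack0 t0.
have h := J_upper t12 tH.
have h1 : c0 * x * (entered t2 - entered t1)%N%:R <= c0 * x * (lam * (t2 - t1) + K1 * slack (t2 - t1)).
  by apply: ler_wpM2l.
have h2 : lam * (c0 * x * (t2 - t1)) <= 2 * mu_tot * slack (t2 - t1).
  by apply: ler_pM => //; [exact: ltW|rewrite mulr_ge0].
have h3 : c0 * x * (K1 * slack (t2 - t1)) <= 1 * (K1 * slack (t2 - t1)).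
  by apply: ler_wpM2r; [rewrite mulr_ge0|have := cx; lra].
rewrite /err /KN; lra.
Qed.

Let hit_split m k a c : (a <= c)%N -> (c <= M)%N ->
  `|\sum_(a <= i < c) hit m k i - (p m * wt m k * (c - a)%N%:R + \sum_(a <= i < c) p m * pert i m k)| <= err a c.
Proof.
move=> ac cM; have := hm m k ac cM; rewrite sumrB.
have -> : \sum_(a <= i < c) p m * (wt m k + pert i m k) =
    p m * wt m k * (c - a)%N%:R + \sum_(a <= i < c) p m * pert i m k.
  under eq_bigr do rewrite mulrDr.
  by rewrite big_split /= sumr_const_nat mulr_natr.
exact.
Qed.

Let NM t : (entered t <= M)%N.
Proof. by apply: (leq_trans (count_size _ _)); rewrite size_iota. Qed.

Let shift_le t1 t2 m k : t1 <= t2 -> t1 - delay m k <= t2 - delay m k.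
Proof. by move=> h; rewrite lerD2r. Qed.

Let shift_H t m k : t <= H -> t - delay m k <= H.
Proof. by move=> h; have := delay0 m k; lra. Qed.

Let shift_sub t1 t2 m k : (t2 - delay m k) - (t1 - delay m k) = t2 - t1.
Proof. by ring. Qed.

Lemma arrived_pert k t1 t2 : t1 <= t2 -> t2 <= H ->
  (arrived k t2)%:R - (arrived k t1)%:R <=
   mu k / mu_tot * (lam * (t2 - t1)) + (K1 + b%:R * KN) * slack (t2 - t1) +
   \sum_(m < b) \sum_(entered (t1 - delay m k) <= c < entered (t2 - delay m k)) p m * pert c m k.
Proof.
move=> t12 tH; rewrite arrived_diff //.
have t0 : 0 <= t2 - t1 by rewrite subr_ge0.
have [s0 [s1 s2]] := slack0 t0.
apply: (@le_trans _ _ (\sum_(m < b) (p m * wt m k * (lam * (t2 - t1) + K1 * slack (t2 - t1)) +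
   KN * slack (t2 - t1) +
   \sum_(entered (t1 - delay m k) <= c < entered (t2 - delay m k)) p m * pert c m k))).
  apply: ler_sum => m _.
  have ac := entered_mono (shift_le m k t12).
  have := hit_split m k ac (NM _); rewrite ler_norml => /andP[_ h].
  have h1 := noise_le (shift_le m k t12) (shift_H m k tH); rewrite shift_sub in h1.
  have h2 := J_upper (shift_le m k t12) (shift_H m k tH); rewrite shift_sub in h2.
  have h3 : p m * wt m k * (entered (t2 - delay m k) - entered (t1 - delay m k))%N%:R <=
     p m * wt m k * (lam * (t2 - t1) + K1 * slack (t2 - t1)).
    by apply: ler_wpM2l => //; rewrite mulr_ge0 // ltW.
  lra.
rewrite !big_split /= -mulr_suml wt_mu sumr_const card_ord -[_ *+ b]mulr_natl lerD2r.
have h : mu k / mu_tot * (K1 * slack (t2 - t1)) <= 1 * (K1 * slack (t2 - t1)).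
  apply: ler_wpM2r; first by rewrite mulr_ge0.
  rewrite ler_pdivrMr // mul1r /mu_tot /mutot (bigD1 k) //= lerDl sumr_ge0 // => i _; exact: ltW.
lra.
Qed.

Let pert_window k m t1 t2 : t1 <= t2 -> t2 <= H -> t2 - t1 <= taud ->
  `|\sum_(entered t1 <= i < entered t2) p m * pert i m k| <= K2 * CB.
Proof.
move=> t12 tH td; apply: le_trans (short_window t12 tH td).
apply: (le_trans (ler_norm_sum _ _ _)).
apply: (@le_trans _ _ (\sum_(entered t1 <= i < entered t2) x)); first by apply: ler_sum => i _.
by rewrite sumr_const_nat mulr_natr.
Qed.

Lemma arrived_short k t1 t2 : t1 <= t2 -> t2 <= H -> t2 - t1 <= taud ->
  (arrived k t2)%:R - (arrived k t1)%:R <=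
   mu k / mu_tot * (lam * (t2 - t1)) + (K1 + b%:R * KN) * slack (t2 - t1) + b%:R * K2 * CB.
Proof.
move=> t12 tH td; apply: (le_trans (arrived_pert k t12 tH)); rewrite lerD2l.
apply: (@le_trans _ _ (\sum_(m < b) K2 * CB)); last first.
  by rewrite sumr_const card_ord -mulrA mulr_natl.
apply: ler_sum => m _; apply: (le_trans (ler_norm _)).
by apply: pert_window => //;
  [exact: shift_le|exact: shift_H|rewrite shift_sub].
Qed.

Let KA : R := K1 + b%:R * KN + b%:R * K2 + delta * (2 * mu_tot * (dm + 1) + K1).

Let K20 : 0 <= K2.
Proof. by rewrite /K2 addr_ge0 // mulr_ge0 ?addr_ge0 // mulr_ge0 // ltW. Qed.

Let KN0 : 0 <= KN.
Proof. by rewrite /KN addr_ge0 ?addr_ge0 ?mulr_ge0 // ltW. Qed.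

(** [pert_drift] holds only on average over the origins, whereas arrivals in a time window
    correspond to a different range of customers for each origin. The drift is collected on the
    common part of these ranges. The early remainder has bias at most [K2 * CB], and the late one
    has nonpositive bias by [pert_neg]. Windows no longer than [taud] may have no common part, but
    there the drift itself is of order [CB]. *)
Lemma arrived_not_shortest k t1 t2 : -1 <= t1 -> t1 <= t2 -> t2 <= H ->
  (forall c, (c < M)%N -> t1 + 1 <= ap c -> ap c < t2 -> (0 < ((rk c)^-1)%g k)%N) ->
  (arrived k t2)%:R - (arrived k t1)%:R <=
   mu k / mu_tot * (lam * (t2 - t1)) - delta * (x * (lam * (t2 - t1))) + KA * slack (t2 - t1).
Proof.
move=> t10 t12 tH ns; have dmn' := dmn.
have t0 : 0 <= t2 - t1 by rewrite subr_ge0.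
have [s0 [s1 s2]] := slack0 t0.
have [short|long] := leP (t2 - t1) taud.
  have h := arrived_short k t12 tH short.
  have h1 : delta * (x * (lam * (t2 - t1))) <= delta * (2 * mu_tot * (dm + 1) * CB).
    by apply: ler_wpM2l => //; exact: lxt.
  have h2 : b%:R * K2 * CB <= b%:R * K2 * slack (t2 - t1) by apply: ler_wpM2l => //; rewrite mulr_ge0.
  have h3 : delta * (2 * mu_tot * (dm + 1) * CB) <= delta * (2 * mu_tot * (dm + 1)) * slack (t2 - t1).
    by rewrite mulrA; apply: ler_wpM2l => //; rewrite mulr_ge0 // mulr_ge0 ?addr_ge0 // mulr_ge0 // ltW.
  have h4 : 0 <= delta * K1 * slack (t2 - t1) by rewrite !mulr_ge0.
  rewrite /KA; lra.
apply: (le_trans (arrived_pert k t12 tH)).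
have hG : t1 + 1 <= t2 - Num.sqrt n%:R * dm by rewrite /taud in long; lra.
(* Customers from [G1] to [G2] appear after the unit gap and reach any station before [t2], whatever
   their origin. *)
set G1 := entered (t1 + 1); set G2 := entered (t2 - Num.sqrt n%:R * dm).
have G12 : (G1 <= G2)%N by exact: entered_mono.
have hm1 (m : 'I_b) : \sum_(entered (t1 - delay m k) <= c < entered (t2 - delay m k)) p m * pert c m k <=
   K2 * CB + \sum_(G1 <= c < G2) p m * pert c m k.
  have dl := delay_le m k; have dl0 := delay0 m k.
  have n01 : (entered (t1 - delay m k) <= G1)%N by apply: entered_mono; lra.
  have n23 : (G2 <= entered (t2 - delay m k))%N by apply: entered_mono; lra.
  rewrite (big_cat_nat (n := G1)) //=; last exact: leq_trans n23.
  apply: lerD.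
    apply: (le_trans (ler_norm _)).
    apply: pert_window => //; rewrite /taud; lra.
  rewrite (big_cat_nat (n := G2)) //= gerDl.
  rewrite big_nat_cond; apply: sumr_le0 => c /andP[/andP[c1 c2] _].
  apply: mulr_ge0_le0; first exact: ltW.
  have cM : (c < M)%N by apply: leq_trans c2 (NM _).
  apply: pert_neg; apply: ns => //.
    by rewrite leNgt -lt_entered // -leqNgt (leq_trans G12).
  by rewrite lt_entered // in c2; lra.
have hm2 : \sum_(m < b) \sum_(entered (t1 - delay m k) <= c < entered (t2 - delay m k)) p m * pert c m k <=
   b%:R * K2 * CB - delta * x * (G2 - G1)%N%:R.
  apply: (le_trans (ler_sum _ (fun m _ => hm1 m))).
  rewrite big_split /= sumr_const card_ord -[_ *+ b]mulr_natl mulrA lerD2l exchange_big /=.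
  apply: (@le_trans _ _ (\sum_(G1 <= c < G2) (- (delta * x)))); last first.
    by rewrite sumr_const_nat mulNrn mulr_natr.
  rewrite big_nat_cond [leRHS]big_nat_cond; apply: ler_sum => c /andP[/andP[c1 c2] _].
  have cM : (c < M)%N by apply: leq_trans c2 (NM _).
  apply: pert_drift; apply: ns => //.
    by rewrite leNgt -lt_entered // -leqNgt.
  by rewrite lt_entered // in c2; lra.
have hJ : lam * (t2 - t1 - taud) - K1 * slack (t2 - t1) <= (G2 - G1)%N%:R.
  have tH' : t2 - Num.sqrt n%:R * dm <= H by lra.
  have t10' : 0 <= t1 + 1 by lra.
  have := J_lower t10' hG tH'.
  have -> : t2 - Num.sqrt n%:R * dm - (t1 + 1) = t2 - t1 - taud by rewrite /taud; ring.
  have : K1 * slack (t2 - t1 - taud) <= K1 * slack (t2 - t1).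
    by apply: ler_wpM2l => //; apply: slack_mono; rewrite /taud; lra.
  lra.
have hJ2 : delta * x * (lam * (t2 - t1 - taud) - K1 * slack (t2 - t1)) <= delta * x * (G2 - G1)%N%:R.
  by apply: ler_wpM2l => //; rewrite mulr_ge0 // ltW.
have td0 : 0 <= taud by rewrite /taud; lra.
have h1 : delta * (x * (lam * taud)) <= delta * (2 * mu_tot * (dm + 1) * CB).
  by apply: ler_wpM2l => //; exact: lxt.
have h2 : b%:R * K2 * CB <= b%:R * K2 * slack (t2 - t1) by apply: ler_wpM2l => //; rewrite mulr_ge0.
have h3 : delta * (2 * mu_tot * (dm + 1) * CB) <= delta * (2 * mu_tot * (dm + 1)) * slack (t2 - t1).
  by rewrite mulrA; apply: ler_wpM2l => //; rewrite mulr_ge0 // mulr_ge0 ?addr_ge0 // mulr_ge0 // ltW.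
have h4 : delta * (x * (K1 * slack (t2 - t1))) <= delta * (1 * (K1 * slack (t2 - t1))).
  by apply: ler_wpM2l => //; apply: ler_wpM2r => //; rewrite mulr_ge0.
rewrite /KA; lra.
Qed.

Let KL : R := K1 + s%:R * (b%:R * (KN + 2 * K2)).

(** Over all stations the perturbations of one customer cancel, so on the common range of customers
    nothing remains; the two boundary pieces cost [K2 * CB] each. The condition on [t1] ensures that
    customers of every origin have had time to arrive; before that, arrivals fall short of the
    rate. *)
Lemma arrived_total t1 t2 : Num.sqrt n%:R * dm <= t1 -> t1 <= t2 -> t2 <= H ->
  lam * (t2 - t1) - KL * slack (t2 - t1) <=
  \sum_(l < s) ((arrived l t2)%:R - (arrived l t1)%:R).
Proof.
move=> td t12 tH; have dmn' := dmn.
have t0 : 0 <= t2 - t1 by rewrite subr_ge0.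
have [s0 [s1 s2]] := slack0 t0.
pose F m l := \sum_(entered (t1 - delay m l) <= c < entered (t2 - delay m l)) p m * pert c m l.
have low l : \sum_(m < b) (p m * wt m l * (lam * (t2 - t1) - K1 * slack (t2 - t1)) - KN * slack (t2 - t1) + F m l)
    <= (arrived l t2)%:R - (arrived l t1)%:R.
  rewrite arrived_diff //; apply: ler_sum => m _.
  have ac := entered_mono (shift_le m l t12).
  have := hit_split m l ac (NM _); rewrite ler_norml => /andP[h _].
  have h1 := noise_le (shift_le m l t12) (shift_H m l tH); rewrite shift_sub in h1.
  have dl := delay_le m l.
  have t10 : 0 <= t1 - delay m l by lra.
  have h2 := J_lower t10 (shift_le m l t12) (shift_H m l tH); rewrite shift_sub in h2.
  have h3 : p m * wt m l * (lam * (t2 - t1) - K1 * slack (t2 - t1)) <=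
    p m * wt m l * (entered (t2 - delay m l) - entered (t1 - delay m l))%N%:R.
    by apply: ler_wpM2l => //; rewrite mulr_ge0 // ltW.
  rewrite /F; lra.
apply: le_trans (ler_sum _ (fun l _ => low l)).
have FF : - (s%:R * (b%:R * (2 * K2 * CB))) <= \sum_(l < s) \sum_(m < b) F m l.
  have cst : \sum_(l < s) \sum_(m < b) - (2 * K2 * CB) = - (s%:R * (b%:R * (2 * K2 * CB))).
    under eq_bigr do rewrite sumr_const card_ord mulNrn -(mulr_natl _ b).
    by rewrite sumr_const card_ord mulNrn (mulr_natl _ s).
  have KC : 0 <= K2 * CB by rewrite mulr_ge0.
  have [short|long] := leP (t2 - t1) taud.
    rewrite -cst; apply: ler_sum => l _; apply: ler_sum => m _.
    have : `|F m l| <= K2 * CB.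
      by apply: pert_window => //;
        [exact: shift_le|exact: shift_H|rewrite shift_sub].
    rewrite ler_norml => /andP[h _]; lra.
  set G1 := entered t1; set G2 := entered (t2 - Num.sqrt n%:R * dm).
  have hG : t1 <= t2 - Num.sqrt n%:R * dm by rewrite /taud in long; lra.
  have G12 : (G1 <= G2)%N by exact: entered_mono.
  have zero : \sum_(l < s) \sum_(m < b) \sum_(G1 <= c < G2) p m * pert c m l = 0.
    rewrite exchange_big big1 //= => m _; rewrite exchange_big big1 //= => c _.
    by rewrite -mulr_sumr pert_sum mulr0.
  have -> : \sum_(l < s) \sum_(m < b) F m l = \sum_(l < s) \sum_(m < b) F m l -
      \sum_(l < s) \sum_(m < b) \sum_(G1 <= c < G2) p m * pert c m l by rewrite zero subr0.
  rewrite -sumrB -cst; apply: ler_sum => l _.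
  rewrite -sumrB; apply: ler_sum => m _.
  have dl := delay_le m l; have dl0 := delay0 m l.
  have n01 : (entered (t1 - delay m l) <= G1)%N by apply: entered_mono; lra.
  have n23 : (G2 <= entered (t2 - delay m l))%N by apply: entered_mono; lra.
  rewrite /F (big_cat_nat (n := G1)) //=; last exact: leq_trans n23.
  rewrite (big_cat_nat (n := G2) (p := entered (t2 - delay m l))) //=.
  have := @pert_window l m (t1 - delay m l) t1.
  have := @pert_window l m (t2 - Num.sqrt n%:R * dm) (t2 - delay m l).
  rewrite !ler_norml /taud => /(_ ltac:(lra) ltac:(lra) ltac:(lra)) /andP[b1 _].
  by move=> /(_ ltac:(lra) ltac:(lra) ltac:(lra)) /andP[b2 _]; rewrite -/G1 -/G2 in b1 b2; lra.
have main : \sum_(l < s) \sum_(m < b) (p m * wt m l * (lam * (t2 - t1) - K1 * slack (t2 - t1)) - KN * slack (t2 - t1) + F m l) =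
   (lam * (t2 - t1) - K1 * slack (t2 - t1)) - s%:R * (b%:R * (KN * slack (t2 - t1))) + \sum_(l < s) \sum_(m < b) F m l.
  under eq_bigr do rewrite !big_split /= -mulr_suml sumrN sumr_const card_ord -[_ *+ b]mulr_natl.
  rewrite !big_split /= -mulr_suml sumrN sumr_const card_ord -[_ *+ s]mulr_natl.
  congr (_ - _ + _).
  rewrite exchange_big /=; under eq_bigr do rewrite -mulr_sumr wt1 mulr1.
  by rewrite p1 mul1r.
rewrite main.
have h2 : s%:R * (b%:R * (2 * K2 * CB)) <= s%:R * (b%:R * (2 * K2 * slack (t2 - t1))).
  by apply: ler_wpM2l => //; apply: ler_wpM2l => //; apply: ler_wpM2l => //; rewrite mulr_ge0.
rewrite /KL; lra.
Qed.

Variables (mmin Cb : R).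
Hypothesis mmin0 : 0 < mmin.
Hypothesis mmin_le : forall k, mmin <= mu k.
Hypothesis Cb0 : 0 <= Cb.
Hypothesis lam_drift : (lam - mu_tot) * (Num.sqrt n%:R * dm + 1) <= Cb.
Hypothesis lam_half : mu_tot / 2 <= lam.
Hypothesis c01 : c0 <= 1.

Let mu_le k : mu k <= mu_tot.
Proof. by rewrite /mu_tot /mutot (bigD1 k) //= lerDl sumr_ge0 // => i _; exact: ltW. Qed.

Let queueE k t : (queue k t)%:R = (arrived k t)%:R - (departed k t)%:R :> R.
Proof. by rewrite -queue_balance natrD addrK. Qed.

Let K3 : R := 2 * mu_tot + 3.
Let K30 : 0 <= K3. Proof. by rewrite /K3; have m0 := mut0; lra. Qed.
Let Kinit : R := mu_tot + Cb + (K1 + b%:R * KN + K3) * (dm + 2) + b%:R * K2.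

Let Kinit0 : 0 <= Kinit.
Proof.
have h1 : 0 <= (K1 + b%:R * KN + K3) * (dm + 2).
  apply: mulr_ge0; last by rewrite addr_ge0.
  by rewrite addr_ge0 // addr_ge0 // mulr_ge0.
have h2 : 0 <= b%:R * K2 := mulr_ge0 (ler0n _ _) K20.
by have h3 := mut0; have h4 := Cb0; rewrite /Kinit; lra.
Qed.

Let departed_diff k t1 t2 : t1 <= t2 ->
  (departed k t2 - departed k t1)%N%:R = (departed k t2)%:R - (departed k t1)%:R :> R.
Proof. by move=> t12; rewrite natrB // departed_mono. Qed.

Let K3_slack k t1 t2 : t1 <= t2 -> (2 * mu k + 3) * slack (t2 - t1) <= K3 * slack (t2 - t1).
Proof.
move=> t12; have t0 : 0 <= t2 - t1 by rewrite subr_ge0.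
have [s0 _] := slack0 t0; apply: ler_wpM2r => //; rewrite /K3; have := mu_le k; lra.
Qed.

Let queue_neg k : queue k (-1) = 0%N.
Proof.
have := queue_balance k (-1); suff -> : arrived k (-1) = 0%N by move=> /eqP; rewrite addn_eq0 => /andP[/eqP].
rewrite /arrived /arr_count count_map; apply/eqP; rewrite -leqn0 leqNgt -has_count.
apply/hasPn => c _ /=; rewrite -leNgt.
have : 0 <= ap c by rewrite /ap /appear divr_ge0 ?sumr_ge0 // ltW.
have := @appear_le_arrive _ _ _ dvec n lam z org d0 c k; rewrite -/(arv c k) -/(ap c); lra.
Qed.

(** During the initial period the total arrivals admit no matching lower bound, so the queue itself
    is bounded, going back to the last time it was empty. The period has length of order $\sqrt n$
    and the rates differ by order $1/\sqrt n$, hence the constant [Cb]. *)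
Let queue_initial k t : 0 <= t -> t <= Num.sqrt n%:R * dm -> t <= H ->
  (queue k t)%:R <= Kinit * CB.
Proof.
move=> t0 td tH; have dmn' := dmn; have m0 := mu0 k; have ml := mu_le k.
have t1' : -1 <= t by lra.
have [t1 [a1 t1t q0 busy]] := @last_time R (fun y => queue k y = 0%N) (-1) t (queue_neg k) t1'.
have tau0 : 0 <= t - t1 by rewrite subr_ge0.
have taule : t - t1 <= taud by rewrite /taud; lra.
have h1 := arrived_short k t1t tH taule.
have h2 : mu k * (t - t1) - (2 * mu k + 3) * slack (t - t1) <= (departed k t - departed k t1)%N%:R.
  by apply: departed_lower => // y y1 y2; rewrite lt0n; apply/eqP; exact: busy.
rewrite departed_diff // in h2.
have h3 := K3_slack k t1t.
have e0 : (queue k t1)%:R = 0 :> R by rewrite q0.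
rewrite queueE in e0; rewrite queueE.
have sl : slack (t - t1) <= (dm + 2) * CB.
  have xt : x * (t - t1) <= (dm + 1) * CB by apply: le_trans xtaud; rewrite ler_pM2l.
  have xt0 : 0 <= x * (t - t1) by rewrite mulr_ge0 // ltW.
  have : c0 * (x * (t - t1)) <= 1 * (x * (t - t1)) by apply: ler_wpM2r.
  rewrite /slack; lra.
have drift : mu k / mu_tot * (lam * (t - t1)) - mu k * (t - t1) <= Cb.
  have -> : mu k / mu_tot * (lam * (t - t1)) - mu k * (t - t1) = mu k / mu_tot * ((lam - mu_tot) * (t - t1)).
    by field; rewrite gt_eqF.
  have f1 : mu k / mu_tot <= 1 by rewrite ler_pdivrMr // mul1r.
  have f0 : 0 <= mu k / mu_tot by rewrite divr_ge0 // ltW.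
  have g : (lam - mu_tot) * (t - t1) <= Cb.
    have [l0|l0] := leP 0 (lam - mu_tot).
      by apply: le_trans lam_drift; apply: ler_wpM2l.
    by apply: le_trans Cb0; apply: mulr_le0_ge0 => //; exact: ltW.
  apply: (@le_trans _ _ (mu k / mu_tot * Cb)); first by apply: ler_wpM2l.
  by rewrite -[leRHS]mul1r; apply: ler_wpM2r.
have k0 : 0 <= K1 + b%:R * KN + K3.
  by rewrite addr_ge0 // addr_ge0 // mulr_ge0.
have h4 : (K1 + b%:R * KN + K3) * slack (t - t1) <= (K1 + b%:R * KN + K3) * ((dm + 2) * CB).
  by apply: ler_wpM2l.
have h5 : Cb <= Cb * CB by rewrite ler_peMr.
have h6 : 0 <= mu_tot * CB by rewrite mulr_ge0 // ltW.
rewrite /Kinit; lra.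
Qed.

(** The average of the loads with weights proportional to the service rates. The excesses with these
    weights therefore sum to zero, which is how [queue_imbalance] bounds deficits by excesses. *)
Let mean t : R := (\sum_(l < s) (queue l t)%:R) / mu_tot.
Let exc k t : R := (queue k t)%:R / mu k - mean t.

Let mean0 t : 0 <= mean t.
Proof. by apply: divr_ge0; [exact: sumr_ge0|exact: ltW]. Qed.

(** The total coefficient of [slack] in an increment of [exc]. By [c0_small], the part of this noise
    that grows with time uses up no more than the guaranteed drift $delta\,x/2$. *)
Definition drift_const : R := (KA + K3) / mmin + (KL + s%:R * K3) / mu_tot.
Hypothesis c0_small : drift_const * c0 <= delta / 2.

Let KA0 : 0 <= KA + K3.
Proof.
have h1 : 0 <= b%:R * KN := mulr_ge0 (ler0n _ _) KN0.
have h2 : 0 <= b%:R * K2 := mulr_ge0 (ler0n _ _) K20.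
have h3 : 0 <= 2 * mu_tot * (dm + 1) + K1.
  by rewrite addr_ge0 // mulr_ge0 ?addr_ge0 // mulr_ge0 // ltW.
have h4 := mulr_ge0 delta0 h3; have h5 := K10; have h6 := K30.
by rewrite /KA; lra.
Qed.

(** The common drift $lam/\mu - 1$ cancels between the load and the average. Idle servers elsewhere
    only raise the average, so an upper bound on departures suffices for it. There remains the bias,
    at least $delta\,x/2$ per unit time because $lam \ge \mu/2$. *)
Let drift_le k t1 t2 : Num.sqrt n%:R * dm <= t1 -> t1 <= t2 -> t2 <= H ->
  (forall y, t1 + 1 <= y -> y <= t2 -> 0 < exc k y) ->
  exc k t2 - exc k t1 <= drift_const * CB.
Proof.
move=> td t12 tH pos; have dmn' := dmn; have m0 := mu0 k; have ml := mu_le k.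
have t0 : 0 <= t2 - t1 by rewrite subr_ge0.
have [s0 [s1 s2]] := slack0 t0.
have busy y : t1 + 1 <= y -> y <= t2 -> (0 < queue k y)%N.
  move=> y1 y2; have := pos y y1 y2; rewrite /exc lt0n; apply: contraTneq => ->.
  by rewrite mul0r sub0r -leNgt oppr_le0.
have ns c : (c < M)%N -> t1 + 1 <= ap c -> ap c < t2 -> (0 < ((rk c)^-1)%g k)%N.
  move=> cM c1 c2; have := pos _ c1 (ltW c2); rewrite /exc => hp.
  have [l hl] : exists l, (queue l (ap c))%:R / mu l < (queue k (ap c))%:R / mu k.
    apply: contrapT => hn.
    have hall l : (queue k (ap c))%:R / mu k * mu l <= (queue l (ap c))%:R.
      by rewrite -ler_pdivlMr // leNgt; apply/negP => h; apply: hn; exists l.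
    have : (queue k (ap c))%:R / mu k <= mean (ap c).
      rewrite /mean ler_pdivlMr // /mu_tot /mutot mulr_sumr; exact: ler_sum.
    by move=> h; move: hp; rewrite subr_gt0 ltNge h.
  exact: not_shortest hl.
have t1m : -1 <= t1 by lra.
have U1 := arrived_not_shortest t1m t12 tH ns.
have U2 := departed_lower t12 busy.
rewrite departed_diff // in U2.
have U2' := K3_slack k t12.
have U3 := arrived_total td t12 tH.
have U4 : \sum_(l < s) ((departed l t2)%:R - (departed l t1)%:R) <= mu_tot * (t2 - t1) + s%:R * (K3 * slack (t2 - t1)).
  rewrite /mu_tot /mutot mulr_suml.
  have -> : s%:R * (K3 * slack (t2 - t1)) = \sum_(l < s) K3 * slack (t2 - t1).
    by rewrite sumr_const card_ord mulr_natl.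
  rewrite -big_split /=; apply: ler_sum => l _.
  rewrite -departed_diff //; apply: (le_trans (departed_upper l t12)); rewrite lerD2l.
  exact: K3_slack.
set nu := lam * (t2 - t1) in U1 U3.
set sl := slack (t2 - t1) in U1 U2 U2' U3 U4 s0 s1 s2.
have nu0 : 0 <= nu by rewrite mulr_ge0 // ltW.
have D1 : ((queue k t2)%:R - (queue k t1)%:R) / mu k <=
   nu / mu_tot - (t2 - t1) - delta * (x * nu) / mu_tot + (KA + K3) / mmin * sl.
  apply: (@le_trans _ _ ((mu k / mu_tot * nu - delta * (x * nu) + KA * sl - (mu k * (t2 - t1) - K3 * sl)) / mu k)).
    by apply: ler_wpM2r; [rewrite invr_ge0 ltW|rewrite !queueE; lra].
  have -> : (mu k / mu_tot * nu - delta * (x * nu) + KA * sl - (mu k * (t2 - t1) - K3 * sl)) / mu k =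
    nu / mu_tot - (t2 - t1) - delta * (x * nu) / mu k + (KA + K3) * sl / mu k.
    by field; rewrite !gt_eqF.
  have i1 : (mu_tot)^-1 <= (mu k)^-1 by rewrite lef_pV2 ?posrE.
  have i2 : (mu k)^-1 <= mmin^-1 by rewrite lef_pV2 ?posrE.
  have j1 : delta * (x * nu) / mu_tot <= delta * (x * nu) / mu k.
    by apply: ler_wpM2l => //; rewrite mulr_ge0 // mulr_ge0 // ltW.
  have j2 : (KA + K3) * sl / mu k <= (KA + K3) * sl / mmin.
    by apply: ler_wpM2l => //; rewrite mulr_ge0.
  lra.
have D2 : nu / mu_tot - (t2 - t1) - (KL + s%:R * K3) / mu_tot * sl <= mean t2 - mean t1.
  rewrite /mean -mulrBl -sumrB ler_pdivlMr //.
  have -> : (nu / mu_tot - (t2 - t1) - (KL + s%:R * K3) / mu_tot * sl) * mu_tot =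
    (nu - KL * sl) - (mu_tot * (t2 - t1) + s%:R * (K3 * sl)) by field; rewrite gt_eqF.
  have -> : \sum_(i < s) ((queue i t2)%:R - (queue i t1)%:R) =
     \sum_(i < s) ((arrived i t2)%:R - (arrived i t1)%:R) - \sum_(i < s) ((departed i t2)%:R - (departed i t1)%:R) :> R.
    by rewrite -sumrB; apply: eq_bigr => l _; rewrite !queueE; ring.
  lra.
have D3 : delta / 2 * (x * (t2 - t1)) <= delta * (x * nu) / mu_tot.
  have -> : delta / 2 * (x * (t2 - t1)) = (delta * x * (t2 - t1)) * (mu_tot / 2) / mu_tot by field; rewrite gt_eqF.
  apply: ler_wpM2r; first by rewrite invr_ge0 ltW.
  rewrite /nu (_ : delta * (x * (lam * (t2 - t1))) = (delta * x * (t2 - t1)) * lam); last by ring.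
  by apply: ler_wpM2l => //; rewrite mulr_ge0 // mulr_ge0 // ltW.
have D4 : drift_const * sl <= delta / 2 * (x * (t2 - t1)) + drift_const * CB.
  rewrite /sl /slack mulrDr lerD2r -mulrA mulrA; apply: ler_wpM2r => //.
  by rewrite mulr_ge0 // ltW.
have E : exc k t2 - exc k t1 = ((queue k t2)%:R - (queue k t1)%:R) / mu k - (mean t2 - mean t1).
  by rewrite /exc mulrBl; ring.
rewrite E; move: D4; rewrite {1}/drift_const mulrDl; lra.
Qed.

Let KF : R := Kinit / mmin + drift_const.

Let drift_const0 : 0 <= drift_const.
Proof.
have h : 0 <= KL + s%:R * K3.
  rewrite /KL addr_ge0 ?mulr_ge0 // addr_ge0 // mulr_ge0 // mulr_ge0 // addr_ge0 // mulr_ge0 //.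
by rewrite /drift_const addr_ge0 // divr_ge0 // ltW.
Qed.

Let exc_le k t : 0 <= t -> t <= H -> exc k t <= KF * CB.
Proof.
move=> t0 tH; have k0 : 0 <= drift_const * CB by rewrite mulr_ge0.
have init t' : 0 <= t' -> t' <= Num.sqrt n%:R * dm -> t' <= H -> exc k t' <= Kinit / mmin * CB.
  move=> t'0 t'd t'H; have h := queue_initial k t'0 t'd t'H.
  have h0 : 0 <= Kinit * CB by apply: le_trans h.
  apply: (@le_trans _ _ ((queue k t')%:R / mu k)); first by rewrite /exc gerBl.
  rewrite mulrAC; apply: ler_pM => //; first by rewrite invr_ge0 ltW.
  by rewrite lef_pV2 ?posrE.
have [td|td] := leP t (Num.sqrt n%:R * dm).
  by rewrite /KF mulrDl; have := init t t0 td tH; lra.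
(* The second alternative makes the set nonempty: the search stops at the end of the initial period,
   where [queue_initial] bounds the excess. *)
pose Pt y := exc k y <= 0 \/ y = Num.sqrt n%:R * dm.
have [t1 [a1 t1t P1 hP]] := @last_time R Pt _ t (or_intror erefl) (ltW td).
have h1 : exc k t1 <= Kinit / mmin * CB.
  case: P1 => [h|->]; last by apply: init => //; lra.
  by apply: (le_trans h); rewrite mulr_ge0 // divr_ge0 // ltW.
have h2 : exc k t - exc k t1 <= drift_const * CB.
  apply: drift_le => // y y1 y2; rewrite ltNge; apply/negP => h.
  by apply: (hP y y1 y2); left.
rewrite /KF mulrDl; lra.
Qed.

Definition imbalance_const : R := KF * (1 + mu_tot / mmin).

Lemma queue_imbalance k l t : 0 <= t -> t <= H ->
  `|(queue k t)%:R / mu k - (queue l t)%:R / mu l| <= imbalance_const * CB.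
Proof.
move=> t0 tH.
wlog suff gen : k l / (queue k t)%:R / mu k - (queue l t)%:R / mu l <= imbalance_const * CB.
  by rewrite ler_norml gen andbT; have := gen l k; lra.
have ek := exc_le k t0 tH.
have X0 : 0 <= KF * CB.
  apply: mulr_ge0 => //; rewrite /KF addr_ge0 // divr_ge0 // ltW //.
have hl : mean t - (queue l t)%:R / mu l <= mu_tot / mmin * (KF * CB).
  have e1 : mu l * (mean t - (queue l t)%:R / mu l) = \sum_(j < s | j != l) mu j * exc j t.
    have : \sum_(j < s) mu j * exc j t = 0.
      rewrite /exc; under eq_bigr do rewrite mulrBr mulrCA mulfV ?gt_eqF // mulr1.
      rewrite sumrB -mulr_suml -/(mutot mu) -/mu_tot /mean mulrCA mulfV ?gt_eqF // mulr1; exact: subrr.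
    by rewrite (bigD1 l) //= => /eqP; rewrite addr_eq0 => /eqP e; rewrite -[RHS]opprK -e /exc; ring.
  have e2 : \sum_(j < s | j != l) mu j * exc j t <= mu_tot * (KF * CB).
    apply: (@le_trans _ _ (\sum_(j < s | j != l) mu j * (KF * CB))).
      by apply: ler_sum => j _; apply: ler_wpM2l; [exact: ltW|exact: exc_le].
    rewrite -mulr_suml; apply: ler_wpM2r => //.
    by rewrite /mu_tot /mutot [leRHS](bigD1 l) //= lerDr ltW.
  rewrite mulrAC.
  have -> : mean t - (queue l t)%:R / mu l = (mu l * (mean t - (queue l t)%:R / mu l)) / mu l.
    by rewrite mulrAC mulfV ?mul1r // gt_eqF.
  rewrite e1; apply: (@le_trans _ _ (mu_tot * (KF * CB) / mu l)).
    by apply: ler_wpM2r => //; rewrite invr_ge0 ltW.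
  apply: ler_wpM2l; first by rewrite mulr_ge0 // ltW.
  by rewrite lef_pV2 ?posrE.
have -> : imbalance_const * CB = KF * CB + mu_tot / mmin * (KF * CB) by rewrite /imbalance_const; ring.
by rewrite /exc in ek; lra.
Qed.

Let Qt k t := Q_trunc mu dvec n lam z w org u known r eps epsm tb M k t.

Lemma trunc_imbalance k l t : 0 <= t -> t + 1 <= H ->
  `|(Qt k t)%:R / mu k - (Qt l t)%:R / mu l| <= imbalance_const * CB.
Proof.
move=> t0 tH.
pose data k' := station_data mu dvec n lam z w org (asg M) k'.
pose X k' := unzip1 (data k') ++ unzip2 (data k').
have [t' /andP[tt t1] /allP sep] := separating_time t (X k ++ X l).
have qE k' : {subset X k' <= X k ++ X l} -> Qt k' t = queue k' t'.
  move=> sX; apply: eq_in_count => ad adin /=.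
  have i1 : ad.1 \in X k' by rewrite mem_cat map_f.
  have i2 : ad.2 \in X k' by rewrite mem_cat map_f ?orbT.
  have /eqP -> := sep _ (sX _ i1).
  by have /eqP e2 := sep _ (sX _ i2); rewrite [t < _]ltNge e2 -leNgt.
rewrite !qE; [apply: queue_imbalance; lra| |].
- by move=> y yl; rewrite mem_cat yl orbT.
- by move=> y yk; rewrite mem_cat yk.
Qed.

Lemma imbalance_le T : (0 < n)%N -> 0 < T -> (0 < s)%N -> n%:R * T + 1 <= H ->
  imbalance mu dvec n lam z w org u known r eps epsm tb T <=
  imbalance_const * CB / Num.sqrt n%:R.
Proof.
move=> n0 T0 s0 nT; have n0' : 0 < n%:R :> R by rewrite ltr0n.
rewrite /imbalance; apply: ge_sup.
  by exists `|Ltilde mu dvec n lam z w org u known r eps epsm tb (Ordinal s0) 0 -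
     Ltilde mu dvec n lam z w org u known r eps epsm tb (Ordinal s0) 0|, 0, (Ordinal s0), (Ordinal s0);
    rewrite lexx ltW.
move=> y [t [k [l [/andP[t0 tT] ->]]]].
have nt0 : 0 <= n%:R * t by rewrite mulr_ge0.
have nt1 : n%:R * t + 1 <= H by apply: le_trans nT; rewrite lerD2r ler_pM2l.
have ntM : n%:R * t < ap M.
  have : ap M.-1 <= ap M by apply: appear_mono => //; exact: leq_pred.
  have := HM; lra.
have QE k' := @Qlen_trunc _ _ _ mu dvec n lam z w org u known r eps epsm tb d0 lam0 z0 k' M _ ntM.
rewrite /Ltilde !QE -/(Qt k _) -/(Qt l _) ![_ / Num.sqrt _ / _]mulrAC -mulrBl normrM.
rewrite [`|(Num.sqrt _)^-1|]ger0_norm ?invr_ge0 ?sqrtr_ge0 //.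
by apply: ler_wpM2r; [rewrite invr_ge0 sqrtr_ge0|exact: trunc_imbalance].
Qed.

End Drift.

(** * Noise of the primitives *)

Section IdentDistrib.
Context {d} {Omega : measurableType d} {R : realType} (P : probability Omega R).
Local Open Scope ereal_scope.

Lemma eq_law_integral (X Y : Omega -> R) (phi : R -> R) :
  measurable_fun setT X -> measurable_fun setT Y -> measurable_fun setT phi ->
  (forall B, measurable B -> P (X @^-1` B) = P (Y @^-1` B)) ->
  \int[P]_x (phi (X x))%:E = \int[P]_x (phi (Y x))%:E.
Proof.
move=> mX mY mphi law.
pose Xp : {RV P >-> R} := HB.pack X (isMeasurableFun.Build _ _ _ _ _ mX).
pose Yp : {RV P >-> R} := HB.pack Y (isMeasurableFun.Build _ _ _ _ _ mY).
have pos (psi : R -> \bar R) : measurable_fun setT psi -> (forall y, 0 <= psi y) ->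
    \int[P]_x (psi (X x)) = \int[P]_x (psi (Y x)).
  move=> mpsi psi0.
  rewrite -(ge0_integral_distribution Xp mpsi psi0) -(ge0_integral_distribution Yp mpsi psi0).
  by apply: eq_measure_integral => A mA _; exact: law.
have mE : measurable_fun setT (EFin \o phi) by exact/measurable_EFinP.
rewrite [LHS]integralE [RHS]integralE; congr (_ - _).
  have := pos _ (measurable_funepos mE) (funepos_ge0 _).
  by rewrite [@funepos]unlock.
have := pos _ (measurable_funeneg mE) (funeneg_ge0 _).
by rewrite [@funeneg]unlock.
Qed.

Lemma eq_law_integrable (X Y : Omega -> R) (phi : R -> R) :
  measurable_fun setT X -> measurable_fun setT Y -> measurable_fun setT phi ->
  (forall B, measurable B -> P (X @^-1` B) = P (Y @^-1` B)) ->
  P.-integrable setT (EFin \o (phi \o Y)) -> P.-integrable setT (EFin \o (phi \o X)).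
Proof.
move=> mX mY mphi law /integrableP[_ h]; apply/integrableP; split.
  by apply/measurable_EFinP; exact: measurableT_comp.
have mn : measurable_fun setT (fun x => `|phi x|%R) by exact: measurableT_comp.
by have := eq_law_integral mX mY mn law; rewrite /= => ->.
Qed.

(** Pointwise, at most $Y + 1$ natural numbers lie below [Y]; the claim is the integral of this. *)
Lemma sum_tail_le (Y : Omega -> R) (m : nat) : measurable_fun setT Y -> (forall x, 0 <= Y x)%R ->
  \sum_(i < m) P [set om | (i%:R < Y om)%R] <= \int[P]_x (Y x)%:E + 1.
Proof.
move=> mY Y0.
have mA i : measurable [set om | (i%:R < Y om)%R].
  by rewrite -[X in measurable X]setTI; apply: measurable_fun_ltr.
have -> : \sum_(i < m) P [set om | (i%:R < Y om)%R] =
    \int[P]_om \sum_(i < m) (\1_[set om | (i%:R < Y om)%R] om)%:E.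
  rewrite ge0_integral_sum //; last by move=> i; apply/measurable_EFinP; exact: measurable_indic.
  by apply: eq_bigr => i _; rewrite integral_indic ?setIT.
have -> : \int[P]_x (Y x)%:E + 1 = \int[P]_x ((Y x)%:E + 1).
  rewrite ge0_integralD //; last 2 first.
  - by move=> x _; rewrite lee_fin.
  - exact/measurable_EFinP.
  by rewrite integral_cst //= mul1e; congr (_ + _); rewrite -(probability_setT P).
apply: ge0_le_integral => //.
- by move=> x _; apply: sume_ge0 => i _; rewrite lee_fin.
- by apply: emeasurable_sum => i; apply/measurable_EFinP; exact: measurable_indic.
- by apply: emeasurable_funD => //; exact/measurable_EFinP.
move=> om _; rewrite sumEFin -EFinD lee_fin.
elim: m => [|m IH]; first by rewrite big_ord0 addr_ge0.
have [mY1|Ym] := ltP m%:R (Y om).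
  apply: (@le_trans _ _ (\sum_(i < m.+1) 1)%R).
    by apply: ler_sum => i _; rewrite indicE; case: (_ \in _).
  by rewrite sumr_const card_ord -natr1 lerD2r ltW.
rewrite big_ord_recr /= indicE memNset ?addr0 //=.
by rewrite ltNge Ym.
Qed.

(** The exponent is proportional to the probability [q]. This makes the noise of rare events, such
    as a change of decision caused by the perturbation, correspondingly small. *)
Lemma mgf_indicator (E : set Omega) (q th : R) : measurable E -> P E = q%:E ->
  (0 <= q)%R -> (`|th| <= 1 / 2)%R ->
  \int[P]_x (expR (th * (\1_E x - q)))%:E <= (expR (2 * th ^+ 2 * q))%:E.
Proof.
move=> mE PE q0 th2.
have e x : (expR (th * (\1_E x - q)))%:E =
   (expR (- (th * q)))%:E * (\1_(~` E) x)%:E + (expR (- (th * q)) * expR th)%:E * (\1_E x)%:E.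
  rewrite -!EFinM -EFinD; congr EFin; rewrite !indicE in_setC; case: (x \in E) => /=.
    by rewrite mulr0 add0r mulr1 -expRD; congr expR; ring.
  by rewrite mulr1 mulr0 addr0 sub0r mulrN.
under eq_integral do rewrite e.
have i1 (A : set Omega) : measurable A -> measurable_fun setT (fun x => (\1_A x : R)%:E).
  by move=> mA; apply/measurable_EFinP; exact: measurable_indic.
rewrite ge0_integralD //; last 2 first.
- by apply: measurable_funeM; apply: i1; exact: measurableC.
- by apply: measurable_funeM; exact: i1.
rewrite ge0_integralZl_EFin ?expR_ge0 //; last by apply: i1; exact: measurableC.
rewrite ge0_integralZl_EFin ?mulr_ge0 ?expR_ge0 //; last exact: i1.
rewrite !integral_indic ?setIT //; last exact: measurableC.
have PC : P (~` E) = (1 - q)%:E by rewrite probability_setC // PE.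
have -> : (expR (- (th * q)))%:E * P (~` E) + (expR (- (th * q)) * expR th)%:E * P E =
   (expR (- (th * q)) * (1 + (expR th - 1) * q))%:E.
  by rewrite PC PE -!EFinM -EFinD; congr EFin; ring.
rewrite lee_fin; apply: (@le_trans _ _ (expR (- (th * q)) * expR ((expR th - 1) * q))%R).
  by apply: ler_wpM2l; [exact: expR_ge0|exact: expR_ge1Dx].
rewrite -expRD ler_expR.
have := @expR_le_quad R th; rewrite ler_norml in th2; case/andP: th2 => _ th2 => /(_ th2) h.
have : (expR th * q <= (1 + th + 2 * th ^+ 2) * q)%R by apply: ler_wpM2r.
lra.
Qed.

End IdentDistrib.

Section IidNoise.
Context {d} {Omega : measurableType d} {R : realType} (P : probability Omega R).

(** Each [Y i] depends on its own group [J i] of coordinates, and the groups are disjoint; the past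
    of [Y j] lives on the union of the earlier groups. *)
Lemma family_indep (I : eqType) (X : I -> Omega -> R) (Y : nat -> Omega -> R) (J : nat -> pred I) :
  (forall i, measurable_fun setT (X i)) -> mutual_indep P X ->
  (forall i, measurable_fun setT (Y i : g_sigma_algebraType (cyl X (J i)) -> R)) ->
  (forall i j x, (i < j)%N -> J i x -> ~~ J j x) ->
  forall j A B, <<s cyl Y (fun i => (i < j)%N) >> A -> measurable B ->
  (P (A `&` Y j @^-1` B) = P A * P (Y j @^-1` B))%E.
Proof.
move=> mX iX mY dJ j A B sA mB.
pose U : pred I := fun x => has (fun i => J i x) (iota 0 j).
have UJ x : U x -> ~~ J j x.
  by move=> /hasP[i]; rewrite mem_iota add0n => /= ij; exact: dJ.
apply: (sigma_cyl_indep mX iX UJ).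
  have : <<s cyl Y (fun i => (i < j)%N) >> `<=` @measurable _ (g_sigma_algebraType (cyl X U)).
    apply: smallest_sub; first exact: sigma_algebra_measurable.
    move=> _ [F [D [uF JF mD ->]]]; apply: fin_bigcap_measurable => // i iF.
    have ij : (i < j)%N by exact: (allP JF).
    have := mY i measurableT (D i) (mD i); rewrite setTI.
    apply: sub_sigma_algebra2; apply: cyl_sub => x Jx; apply/hasP; exists i => //.
    by rewrite mem_iota add0n.
  exact.
by have := mY j measurableT B mB; rewrite setTI.
Qed.

Lemma iid_noise (Y : nat -> Omega -> R) (chi : nat -> R) (c : R) :
  (forall i, measurable_fun setT (Y i)) ->
  (forall i B, measurable B -> P (Y i @^-1` B) = P (Y 0%N @^-1` B)) ->
  (forall j A B, <<s cyl Y (fun i => (i < j)%N) >> A -> measurable B ->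
     (P (A `&` Y j @^-1` B) = P A * P (Y j @^-1` B))%E) ->
  P.-integrable setT (EFin \o Y 0%N) -> (\int[P]_x (Y 0%N x)%:E = 0)%E ->
  P.-integrable setT (EFin \o (fun x => Y 0%N x ^+ 4)) ->
  0 < c ->
  (exists N, forall n, (N <= n)%N -> [/\ 0 < chi n, chi n <= 1 & 4 <= Num.sqrt n%:R * chi n]) ->
  (forall Z, exists N, forall n, (N <= n)%N -> Z <= noise_scale n (chi n)) ->
  exists C, 0 < C /\ forall K : nat,
    {ae P, forall om, exists N, forall n, (N <= n)%N -> forall a b, (a <= b)%N -> (b <= K * n)%N ->
      `|\sum_(a <= l < b) Y l om| <= c * chi n * (b - a)%N%:R + C * noise_scale n (chi n)}.
Proof.
move=> mY law indY Y1 EY Y4 c0 hchi hB.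
have mp k : measurable_fun setT (fun x : R => x ^+ k) by exact: measurable_funX.
have Y2 : P.-integrable setT (EFin \o (fun x => Y 0%N x ^+ 2)).
  have i1 : P.-integrable setT (fun=> 1%:E) by exact: finite_measure_integrable_cst.
  apply: (le_integrable measurableT _ _ (integrableD measurableT i1 Y4)).
    by apply/measurable_EFinP; exact: measurable_funX.
  move=> x _ /=; rewrite lee_fin !ger0_norm ?sqr_ge0 ?addr_ge0 ?exprn_even_ge0 //.
  have := sqr_ge0 (Y 0%N x ^+ 2 - 1); rewrite (exprM _ 2 2) => h.
  have := sqr_ge0 (Y 0%N x); rewrite sqrrB1 in h; lra.
have fin (f : Omega -> R) : P.-integrable setT (EFin \o f) ->
    (\int[P]_x (f x)%:E = (fine (\int[P]_x (f x)%:E))%:E)%E.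
  by move=> h; rewrite fineK //; have := integrable_fin_num measurableT h.
pose V := 1 + `|fine (\int[P]_x (Y 0%N x ^+ 2)%:E)| + `|fine (\int[P]_x (Y 0%N x ^+ 4)%:E)|.
apply: (@increments_noise _ _ _ P Y mY indY V) => //.
- by rewrite /V -addrA lerDl addr_ge0.
- by move=> i; apply: (eq_law_integrable (phi := id) _ _ _ (law i)).
- by move=> i; rewrite (eq_law_integral (phi := id) _ _ _ (law i)).
- by move=> i; apply: (eq_law_integrable (phi := fun x => x ^+ 2) (mY i) (mY 0%N) (mp 2) (law i)).
- by move=> i; apply: (eq_law_integrable (phi := fun x => x ^+ 4) (mY i) (mY 0%N) (mp 4) (law i)).
- move=> i; rewrite (eq_law_integral (phi := fun x => x ^+ 2) (mY i) (mY 0%N) (mp 2) (law i)) (fin _ Y2) lee_fin /V.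
  by apply: (le_trans (ler_norm _)); rewrite -addrA addrCA lerDl addr_ge0.
- move=> i; rewrite (eq_law_integral (phi := fun x => x ^+ 4) (mY i) (mY 0%N) (mp 4) (law i)) (fin _ Y4) lee_fin /V.
  by apply: (le_trans (ler_norm _)); rewrite lerDr addr_ge0.
move=> e e0.
(* The probabilities of these events sum to at most $E[Y^4]/e + 1$, so Borel-Cantelli gives the
   growth bound on the individual terms. *)
pose F i := [set om | (i%:R < e^-1 * Y i om ^+ 4)%R].
have mF i : measurable (F i).
  rewrite -[X in measurable X]setTI; apply: measurable_fun_ltr => //.
  by apply: measurable_funM => //; exact: measurable_funX.
pose Z0 om := e^-1 * Y 0%N om ^+ 4.
have Z00 x : 0 <= Z0 x by rewrite mulr_ge0 ?invr_ge0 ?exprn_even_ge0 // ltW.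
have mZ0 : measurable_fun setT Z0 by apply: measurable_funM => //; exact: measurable_funX.
have hF m : (\sum_(i < m) P (F i) <= (fine (\int[P]_x (Z0 x)%:E) + 1)%:E)%E.
  have Zi : P.-integrable setT (EFin \o Z0).
    by have := integrableZl measurableT e^-1 Y4; apply: eq_integrable => // x _ /=; rewrite EFinM.
  rewrite EFinD -(fin _ Zi); apply: (le_trans _ (sum_tail_le P m mZ0 Z00)).
  apply: lee_sum => i _.
  have mB : measurable [set x : R | (i%:R < e^-1 * x ^+ 4)%R].
    by rewrite -[X in measurable X]setTI; apply: measurable_fun_ltr => //; apply: measurable_funM.
  by rewrite le_eqVlt; apply/orP; left; apply/eqP; exact: (law i _ mB).
have := ae_eventually_not mF hF; apply: filterS => om [N hN]; exists N => i Ni.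
have := hN i Ni; rewrite /F /= => /negP; rewrite -leNgt -ler_pdivlMl ?invr_gt0 // invrK //.
Qed.

End IidNoise.

Section Controlled.
Context {d} {Omega : measurableType d} {R : realType} (P : probability Omega R).

Lemma ae_forall (I : countType) (Q : I -> Omega -> Prop) :
  (forall i, {ae P, forall om, Q i om}) -> {ae P, forall om, forall i, Q i om}.
Proof.
move=> hQ.
have h n : {ae P, forall om, if unpickle n is Some i then Q i om else True}.
  by case: unpickle => [i|]; [exact: hQ|exact: nearW].
apply: filterS (ae_foralln h) => om {}h i.
by have := h (pickle i); rewrite pickleK.
Qed.

Variable chi : nat -> R.

(** One [C] serves every [K]: in the theorem the constants are chosen before the horizon [T]. The
    exceptional null set may depend on [K]. *)
Definition controlled (c : R) (S : nat -> nat -> Omega -> R) : Prop :=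
  exists C, 0 < C /\ forall K : nat,
    {ae P, forall om, exists N, forall n, (N <= n)%N -> forall a b, (a <= b)%N -> (b <= K * n)%N ->
      `|\sum_(a <= l < b) S n l om| <= c * chi n * (b - a)%N%:R + C * noise_scale n (chi n)}.

Lemma eq_controlled c S S' : (forall n l om, S n l om = S' n l om) ->
  controlled c S -> controlled c S'.
Proof.
move=> e [C [C0 h]]; exists C; split=> // K.
apply: filterS (h K) => om [N hN]; exists N => n Nn a b ab bK.
by have := hN n Nn a b ab bK; under eq_bigr do rewrite e.
Qed.

Lemma controlledD c1 c2 S1 S2 : controlled c1 S1 -> controlled c2 S2 ->
  controlled (c1 + c2) (fun n l om => S1 n l om + S2 n l om).
Proof.
move=> [C1 [C10 h1]] [C2 [C20 h2]]; exists (C1 + C2); split; first exact: addr_gt0.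
move=> K; apply: filterS2 (h1 K) (h2 K) => om [N1 hN1] [N2 hN2].
exists (maxn N1 N2) => n; rewrite geq_max => /andP[n1 n2] a b ab bK.
rewrite big_split /=; apply: (le_trans (ler_normD _ _)).
have := hN1 n n1 a b ab bK; have := hN2 n n2 a b ab bK; lra.
Qed.

Lemma controlledN c S : controlled c S -> controlled c (fun n l om => - S n l om).
Proof.
move=> [C [C0 h]]; exists C; split=> // K.
apply: filterS (h K) => om [N hN]; exists N => n Nn a b ab bK.
by rewrite sumrN normrN; exact: hN.
Qed.

Lemma controlled_family (I : finType) c (S : I -> nat -> nat -> Omega -> R) :
  (exists N, forall n, (N <= n)%N -> 0 <= noise_scale n (chi n)) ->
  (forall i, controlled c (S i)) ->
  exists C, 0 < C /\ forall K : nat,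
    {ae P, forall om, exists N, forall n, (N <= n)%N -> forall i a b, (a <= b)%N -> (b <= K * n)%N ->
      `|\sum_(a <= l < b) S i n l om| <= c * chi n * (b - a)%N%:R + C * noise_scale n (chi n)}.
Proof.
move=> [N0 hN0] hS; have [C hC] := choice hS.
exists (1 + \sum_i C i); split.
  by rewrite ltr_wpDr // sumr_ge0 // => i _; rewrite ltW // (hC i).1.
move=> K; have hK i := (hC i).2 K.
apply: filterS (ae_forall hK) => om /choice[N hN].
exists (maxn N0 (\max_i N i)) => n; rewrite geq_max => /andP[n0 /bigmax_leqP nN] i a b ab bK.
have := hN i n (nN i isT) a b ab bK; move/le_trans; apply; rewrite lerD2l.
apply: ler_wpM2r; first exact: hN0.
rewrite (bigD1 i) //= addrCA lerDl addr_ge0 // sumr_ge0 // => k _.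
by rewrite ltW // (hC k).1.
Qed.

End Controlled.

(** * Noise of the routing decisions *)

Section RoutingNoise.
Context {d} {Omega : measurableType d} {R : realType} (P : probability Omega R).
Variables (s b : nat) (p : 'I_b -> R).
Variables (z : nat -> Omega -> R) (w : 'I_s -> nat -> Omega -> R).
Variables (org : nat -> Omega -> 'I_b) (u : nat -> Omega -> R).
Let X := prim_rv z w org u.
Hypothesis mX : forall x, measurable_fun setT (X x).
Hypothesis iX : mutual_indep P X.
Hypothesis org_law : forall j m, P (org j @^-1` [set m]) = (p m)%:E.
Hypothesis u_law : forall j B, measurable B ->
  P (u j @^-1` B) = (@lebesgue_measure R) (B `&` `[0, 1]).

Definition routed (m : 'I_b) (B : set R) (j : nat) : set Omega :=
  [set om | org j om = m /\ B (u j om)].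

Let preimage_org m j : org j @^-1` [set m] = X (inr (inl j)) @^-1` [set (nat_of_ord m)%:R].
Proof.
apply/seteqP; split => om /=; first by move=> ->.
by move/eqP; rewrite eqr_nat => /eqP/val_inj.
Qed.

Let routedE m B j : routed m B j =
  X (inr (inl j)) @^-1` [set (nat_of_ord m)%:R] `&` X (inr (inr j)) @^-1` B.
Proof. by rewrite -preimage_org. Qed.

Lemma indic_routed m (i : interval R) j om :
  \1_(routed m [set` i] j) om = ((org j om == m) && (u j om \in i))%:R :> R.
Proof.
rewrite indicE; congr (_%:R); congr nat_of_bool.
apply/idP/idP => [/set_mem[-> /= ->]|/andP[/eqP om_m ui]]; first by rewrite eqxx.
by rewrite inE; split.
Qed.

Lemma org_cyl (J : pred (prim_index s)) m j : J (inr (inl j)) -> <<s cyl X J>> (org j @^-1` [set m]).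
Proof.
by move=> Jj; rewrite preimage_org; apply: sub_sigma_algebra; exact: cyl_coord.
Qed.

Lemma routed_cyl (J : pred (prim_index s)) m B j : J (inr (inl j)) -> J (inr (inr j)) -> measurable B ->
  <<s cyl X J>> (routed m B j).
Proof.
move=> J1 J2 mB; rewrite routedE.
apply: (@measurableI _ (g_sigma_algebraType (cyl X J))).
  by apply: sub_sigma_algebra; exact: cyl_coord.
by apply: sub_sigma_algebra; exact: cyl_coord.
Qed.

Lemma routed_measurable m B j : measurable B -> measurable (routed m B j).
Proof.
move=> mB; rewrite routedE; apply: measurableI.
  by rewrite -[X in measurable X]setTI; exact: mX.
by rewrite -[X in measurable X]setTI; exact: mX.
Qed.

Lemma routed_prob m B j : measurable B ->
  P (routed m B j) = ((p m)%:E * (@lebesgue_measure R) (B `&` `[0%R, 1%R]%classic))%E.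
Proof.
move=> mB.
pose D (x : prim_index s) := if x is inr (inl _) then [set (nat_of_ord m)%:R] else B.
have mD x : measurable (D x) by case: x => [y|[y|y]] //=; exact: measurable_set1.
have := iX (F := [:: inr (inl j) : prim_index s; inr (inr j)]) (B := D) isT mD.
rewrite big_cons big_seq1 /= -preimage_org org_law u_law // => <-; congr (P _).
rewrite routedE; apply/seteqP; split => [om [h1 h2] x /=|om h].
  by rewrite !inE => /orP[/eqP->|/eqP->].
by split; [apply: (h (inr (inl j)))|apply: (h (inr (inr j)))]; rewrite /= !inE eqxx ?orbT.
Qed.

Let measure_itv (x y : R) : x <= y -> (@lebesgue_measure R) `[x, y[%classic = (y - x)%:E.
Proof.
move=> xy; rewrite lebesgue_measure_itv /= lte_fin; case: ltP => [_|yx]; first by rewrite -EFinB.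
by have -> : y - x = 0 by lra.
Qed.

Lemma routed_prob_itv m (x y : R) j : 0 <= x -> x <= y -> y <= 1 ->
  P (routed m `[x, y[ j) = (p m * (y - x))%:E.
Proof.
move=> x0 xy y1; rewrite routed_prob // (_ : _ `&` _ = `[x, y[%classic).
  by rewrite measure_itv.
apply/seteqP; split => [v []//|v /= hv]; split=> //.
by move: hv; rewrite !in_itv /= => /andP[xv vy]; rewrite (le_trans x0) // (le_trans (ltW vy)).
Qed.

Lemma routed_prob_lt m (y : R) j : 0 <= y -> y <= 1 ->
  P (routed m `]-oo, y[ j) = (p m * y)%:E.
Proof.
move=> y0 y1; rewrite routed_prob // (_ : _ `&` _ = `[0, y[%classic).
  by rewrite measure_itv // subr0.
apply/seteqP; split => v /=; rewrite !in_itv /=; first by move=> [-> /andP[-> _]].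
by move=> /andP[v0 vy]; rewrite v0 vy (le_trans (ltW vy)).
Qed.

Definition fresh (j : nat) : pred (prim_index s) := fun x =>
  match x with inr (inl i) => i == j | inr (inr i) => i == j | _ => false end.

(** All interappearance times and service requirements are counted as past, including those not yet
    used: they are independent of the routing variables, and which ones have been used need not be
    tracked. *)
Definition past (j : nat) : pred (prim_index s) := fun x =>
  match x with inl _ => true | inr (inl i) => (i < j)%N | inr (inr i) => (i < j)%N end.

Lemma indic_law (E1 E2 : set Omega) (q : R) (B : set R) : measurable E1 -> measurable E2 ->
  P E1 = P E2 ->
  P ((fun om => \1_E1 om - q) @^-1` B) = P ((fun om => \1_E2 om - q) @^-1` B).
Proof.
move=> m1 m2 PE.
have e (E : set Omega) : (fun om => \1_E om - q) @^-1` B =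
    (E `&` [set _ | B (1 - q)]) `|` (~` E `&` [set _ | B (0 - q)]).
  apply/seteqP; split => om /=; rewrite indicE.
    by have [Eom|Eom] := pselect (E om); [rewrite mem_set //; left|rewrite memNset //; right].
  by move=> [[Eom]|[Eom]]; [rewrite mem_set|rewrite memNset].
rewrite !e.
have s1 (Q : Prop) : Q -> [set _ : Omega | Q] = setT by move=> q1; apply/seteqP; split.
have s0 (Q : Prop) : ~ Q -> [set _ : Omega | Q] = set0 by move=> q1; apply/seteqP; split.
have [b1|b1] := pselect (B (1 - q)); have [b0|b0] := pselect (B (0 - q)).
- by rewrite !(s1 _ b1) !(s1 _ b0) !setIT !setUv.
- by rewrite !(s1 _ b1) !(s0 _ b0) !setIT !setI0 !setU0.
- by rewrite !(s0 _ b1) !(s1 _ b0) !setIT !setI0 !set0U !probability_setC // PE.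
- by rewrite !(s0 _ b1) !(s0 _ b0) !setI0 !setU0.
Qed.

Lemma routed_fun (J : pred (prim_index s)) m (x : R) j : J (inr (inl j)) -> J (inr (inr j)) ->
  measurable_fun setT ((fun om => \1_(routed m `]-oo, x[ j) om : R) :
    g_sigma_algebraType (cyl X J) -> R).
Proof. by move=> J1 J2; apply: measurable_indic; exact: routed_cyl. Qed.

Lemma p_ge0 m : 0 <= p m.
Proof. by rewrite -lee_fin -(org_law 0). Qed.

Lemma p_le1 m : p m <= 1.
Proof.
rewrite -lee_fin -(org_law 0) probability_le1 // -[X in measurable X](@setTI).
by rewrite preimage_org setTI -[X in measurable X]setTI; exact: mX.
Qed.

Variables (chi : nat -> R) (c : R).
Hypothesis chi0 : forall n, 0 < chi n.
Hypothesis c0 : 0 < c.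
Hypothesis hchi : exists N, forall n, (N <= n)%N ->
  [/\ 0 < chi n, chi n <= 1 & 4 <= Num.sqrt n%:R * chi n].
Hypothesis hB : forall Z, exists N, forall n, (N <= n)%N -> Z <= noise_scale n (chi n).

(** At a fixed threshold the events are i.i.d. and the same for all [n]. Their variance need not be
    small, so they are treated by the block argument for i.i.d. walks. *)
Lemma base_noise m (x : R) : 0 <= x -> x <= 1 ->
  controlled P chi c (fun _ l om => \1_(routed m `]-oo, x[ l) om - p m * x).
Proof.
move=> x0 x1; have mE j : measurable (routed m `]-oo, x[ j) by exact: routed_measurable.
have q0 : 0 <= p m * x by rewrite mulr_ge0 // p_ge0.
have q1 : p m * x <= 1 by rewrite mulr_ile1 // ?p_ge0 ?p_le1.
have mY j : measurable_fun setT (fun om => \1_(routed m `]-oo, x[ j) om - p m * x).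
  by apply: measurable_funB => //; exact: measurable_indic.
have i1 : P.-integrable setT (fun om => (\1_(routed m `]-oo, x[ 0) om)%:E).
  exact: integrable_indic.
have i2 : P.-integrable setT (EFin \o cst (p m * x)) by exact: finite_measure_integrable_cst.
apply: (iid_noise (Y := fun l om => \1_(routed m `]-oo, x[ l) om - p m * x)) => //.
- move=> i B mB; apply: indic_law => //.
  exact: (etrans (routed_prob_lt m i x0 x1) (esym (routed_prob_lt m 0 x0 x1))).
- move=> j A B; apply: (family_indep (J := fresh) mX iX) => [i|i k y ik].
    by apply: measurable_funB => //; apply: routed_fun => /=.
  by case: y => [//|[l|l]] /= /eqP->; rewrite ltn_eqF.
- have := integrableB measurableT i1 i2; apply: eq_integrable => // om _ /=.
- rewrite [LHS](_ : _ = \int[P]_om ((\1_(routed m `]-oo, x[ 0) om)%:E - (p m * x)%:E))%E //.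
  rewrite integralB_EFin // integral_indic // setIT integral_cst //.
  rewrite -(subee (x := (p m * x)%:E)) //; congr (_ - _)%E; first exact: routed_prob_lt.
  by rewrite -[RHS]mule1; congr (_ * _)%E; exact: probability_setT.
apply: (le_integrable measurableT _ _ (finite_measure_integrable_cst P 1 measurableT)).
  by apply/measurable_EFinP; exact: measurable_funX.
move=> om _ /=; rewrite lee_fin normrX [X in _ <= X]normr1 exprn_ile1 // indicE.
by case: (_ \in _); rewrite /= ?mulr1n ?mulr0n ler_norml; apply/andP; split; lra.
Qed.

(** The two indicators differ only when the uniform variable falls between the thresholds, an event
    of probability at most [W * chi n]; hence [mgf_indicator] supplies what [adaptive_noise]
    requires. *)
Lemma adaptive_routing_noise (A : finType) (st : nat -> nat -> Omega -> A) (T : nat -> A -> R)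
    (W : R) m (x : R) : 0 <= x -> x <= 1 -> 0 < W ->
  (exists N : nat, forall n : nat, (N <= n)%N -> n%:R <= noise_scale n (chi n) ^+ 4) ->
  (forall n j, mdisc (st n j : g_sigma_algebraType (cyl X (past j)) -> A)) ->
  (forall n a, 0 <= T n a) -> (forall n a, T n a <= 1) ->
  (forall n a, `|p m * (T n a - x)| <= W * chi n) ->
  controlled P chi c (fun n l om => \1_(routed m `]-oo, T n (st n l om)[ l) om
    - \1_(routed m `]-oo, x[ l) om - p m * (T n (st n l om) - x)).
Proof.
move=> x0 x1 W0 h4 mst T0 T1 TW.
have mE B j : measurable B -> measurable (routed m B j) by exact: routed_measurable.
have hB' : exists N : nat, forall n : nat, (N <= n)%N -> 0 < noise_scale n (chi n).
  by have [N hN] := hB 1; exists N => n Nn; apply: lt_le_trans (hN n Nn).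
have mf (J : pred (prim_index s)) n a j : J (inr (inl j)) -> J (inr (inr j)) ->
    measurable_fun setT ((fun om => \1_(routed m `]-oo, T n a[ j) om
      - \1_(routed m `]-oo, x[ j) om - p m * (T n a - x)) : g_sigma_algebraType (cyl X J) -> R).
  move=> J1 J2; apply: measurable_funB => //; apply: measurable_funB; exact: routed_fun.
apply: (adaptive_noise (C := fun j => cyl X (past j))
  (f := fun n a j om => \1_(routed m `]-oo, T n a[ j) om
      - \1_(routed m `]-oo, x[ j) om - p m * (T n a - x)) _ _ mst _ _ W0) => //.
- by move=> j; exact: cyl_measurable.
- move=> i j ij; apply: cyl_sub => -[//|[k|k]] /= ki; exact: leq_trans ij.
- by move=> n a j; apply: mf => /=.
- move=> n a j B D sB mD.
  apply: (sigma_cyl_indep (J1 := past j) (J2 := fresh j) mX iX) => //.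
    by case=> [//|[k|k]] /= kj; rewrite ltn_eqF.
  by rewrite -[X in <<s _ >> X]setTI; apply: (mf (fresh j)) => //=.
move=> n a j th th2.
have split_lt (y v : R) om : y <= v -> \1_(routed m `]-oo, v[ j) om - \1_(routed m `]-oo, y[ j) om
   = \1_(routed m `[y, v[ j) om :> R.
  move=> yv; rewrite !indic_routed !in_itv /=; case: (org j om == m) => /=; last by rewrite subr0.
  have [uy|yu] := ltP (u j om) y; first by rewrite (lt_le_trans uy yv) subrr.
  by rewrite subr0.
have mgf y v th' : 0 <= y -> y <= v -> v <= 1 -> `|th'| <= 1 / 2 -> p m * (v - y) <= W * chi n ->
   (\int[P]_om (expR (th' * (\1_(routed m `[y, v[ j) om - p m * (v - y))))%:E <=
    (expR (2 * th' ^+ 2 * (W * chi n)))%:E)%E.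
  move=> y0 yv v1 th'2 le.
  apply: (le_trans (mgf_indicator _ (routed_prob_itv m j y0 yv v1) _ th'2)) => //.
  - exact: mE.
  - by rewrite mulr_ge0 ?p_ge0 // subr_ge0.
  - by rewrite lee_fin ler_expR; apply: ler_wpM2l => //; rewrite mulr_ge0 // sqr_ge0.
(* Which threshold is larger decides the sign of the difference of indicators; the second case is
   the first with [- th]. *)
have [xT|Tx] := leP x (T n a).
  under eq_integral do rewrite split_lt //.
  by apply: mgf => //; apply: le_trans (TW n a); exact: ler_norm.
rewrite -(sqrrN th).
rewrite (_ : (\int[P]_om _)%E = \int[P]_om (expR (- th * (\1_(routed m `[T n a, x[ j) om - p m * (x - T n a))))%:E)%E.
  apply: mgf => //; [exact: ltW|by rewrite normrN|apply: le_trans (TW n a)].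
  by rewrite -normrN -mulrN opprB; exact: ler_norm.
apply: eq_integral => om _; rewrite -split_lt; last exact: ltW.
by congr (expR _)%:E; ring.
Qed.

End RoutingNoise.

(** * Routing probabilities and thresholds of the policy *)

Definition routing_plan {R : realType} {s b : nat} (mu : 'I_s -> R) (p : 'I_b -> R)
    (r : 'I_b -> 'I_s -> R) (eps : 'I_s -> R)
    (epsm : 'I_b -> 'I_s -> {perm 'I_s} -> R) : Prop :=
  (forall m k, 0 <= r m k <= 1) /\
  (forall m, \sum_(k < s) r m k = 1) /\
  (forall k, mu k = mutot mu * \sum_(m < b) p m * r m k) /\
  (forall m (pi : {perm 'I_s}), \sum_(l < s) epsm m l pi = 0) /\
  (forall (l : 'I_s) (pi : {perm 'I_s}), \sum_(m < b) p m * epsm m l pi = eps l) /\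
  (forall m (l : 'I_s) (pi : {perm 'I_s}), nat_of_ord l = 0%N -> 0 <= epsm m l pi) /\
  (forall m (l : 'I_s) (pi : {perm 'I_s}), (0 < l)%N -> epsm m l pi <= 0) /\
  (forall m (k : 'I_s) (pi : {perm 'I_s}), 0 <= r m k + epsm m (pi k) pi <= 1).

Section Policy.
Context {R : realType} {s b : nat}.
Variables (mu : 'I_s -> R) (p : 'I_b -> R) (known : bool) (r : 'I_b -> 'I_s -> R).
Variables (eps : 'I_s -> R) (epsm : 'I_b -> 'I_s -> {perm 'I_s} -> R) (chi delta : R).
Hypothesis s0 : (0 < s)%N.
Hypothesis mu0 : forall k, 0 < mu k.
Hypothesis p0 : forall m, 0 < p m.
Hypothesis p1 : \sum_(m < b) p m = 1.
Hypothesis eps_sum : \sum_(l < s) eps l = 0.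
Hypothesis eps_first : forall l : 'I_s, nat_of_ord l = 0%N -> eps l = chi.
Hypothesis eps_neg : forall l : 'I_s, (0 < l)%N -> eps l < 0.
Hypothesis eps_range : forall k l : 'I_s, 0 <= mu k / mutot mu + eps l <= 1.
Hypothesis eps_gap : forall l : 'I_s, (0 < l)%N -> eps l <= - (delta * chi).
Hypothesis chi0 : 0 < chi.
Hypothesis known_plan : known -> routing_plan mu p r eps epsm.

Definition base_weight (m : 'I_b) (k : 'I_s) : R := if known then r m k else mu k / mutot mu.
Definition perturbation (pi : {perm 'I_s}) (m : 'I_b) (k : 'I_s) : R :=
  if known then epsm m (pi k) pi else eps (pi k).

Lemma route_weightE pi m k : route_weight mu known r eps epsm pi m k =
  base_weight m k + perturbation pi m k.
Proof. by rewrite /route_weight /base_weight /perturbation; case: known. Qed.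

Lemma mutot_gt0 : 0 < mutot mu.
Proof.
rewrite /mutot (bigD1 (Ordinal s0)) //= ltr_wpDr //.
by apply: sumr_ge0 => k _; exact: ltW.
Qed.

Lemma base_weight_ge0 m k : 0 <= base_weight m k.
Proof.
rewrite /base_weight; case: (boolP known) => [/known_plan[h _]|_]; first by case/andP: (h m k).
by rewrite divr_ge0 ?ltW // mutot_gt0.
Qed.

Lemma base_weight_sum m : \sum_(k < s) base_weight m k = 1.
Proof.
rewrite /base_weight; case: (boolP known) => [/known_plan[_ [h _]]|_]; first exact: h.
by rewrite -mulr_suml mulfV // gt_eqF // mutot_gt0.
Qed.

Lemma base_weight_mean k : \sum_(m < b) p m * base_weight m k = mu k / mutot mu.
Proof.
rewrite /base_weight; case: (boolP known) => [/known_plan[_ [_ [h _]]]|_].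
  by rewrite [in RHS]h mulrAC mulfV ?mul1r // gt_eqF // mutot_gt0.
by rewrite -mulr_suml p1 mul1r.
Qed.

(** The negative coefficients add up to [- chi], so none exceeds [chi] in absolute value. *)
Lemma eps_le l : `|eps l| <= chi.
Proof.
have [l0|l0] := posnP l; first by rewrite eps_first // gtr0_norm.
rewrite ltr0_norm ?eps_neg //.
have := eps_sum; rewrite (bigD1 (Ordinal s0)) //= eps_first // (bigD1 l) /=; last first.
  by rewrite -val_eqE /= -lt0n.
have : \sum_(i < s | (i != Ordinal s0) && (i != l)) eps i <= 0.
  by apply: sumr_le0 => i /andP[i0 _]; rewrite ltW // eps_neg // lt0n; move: i0; rewrite -val_eqE.
lra.
Qed.

(** For a given rank the coefficients of all origins have the same sign and mean [eps], so each
    weighted one is at most $|eps|$. The factor [p m] stays because the coefficient of a rare origin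
    may exceed [chi]. *)
Lemma perturbation_le pi m k : `|p m * perturbation pi m k| <= chi.
Proof.
have p_le1 : p m <= 1.
  by rewrite -p1 (bigD1 m) //= lerDl; apply: sumr_ge0 => i _; exact: ltW.
rewrite /perturbation; case: (boolP known) => [/known_plan[_ [_ [_ [_ [mean [pos [neg _]]]]]]]|_].
  apply: (le_trans _ (eps_le (pi k))); rewrite -(mean (pi k) pi).
  have [k0|k0] := posnP (pi k).
    have h i : 0 <= p i * epsm i (pi k) pi by apply: mulr_ge0; [exact: ltW|exact: pos].
    rewrite !ger0_norm ?sumr_ge0 // (bigD1 m) //= lerDl; exact: sumr_ge0.
  have h i : p i * epsm i (pi k) pi <= 0 by apply: mulr_ge0_le0; [exact: ltW|exact: neg].
  rewrite !ler0_norm ?sumr_le0 // (bigD1 m) //= opprD lerDl oppr_ge0; exact: sumr_le0.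
rewrite normrM (gtr0_norm (p0 m)); apply: (le_trans _ (eps_le (pi k))).
by rewrite ler_piMl.
Qed.

Lemma perturbation_sum pi m : \sum_(k < s) perturbation pi m k = 0.
Proof.
rewrite /perturbation; case: (boolP known) => [/known_plan[_ [_ [_ [h _]]]]|_].
  by have := h m pi; rewrite (reindex_inj (@perm_inj _ pi)).
by have := eps_sum; rewrite (reindex_inj (@perm_inj _ pi)).
Qed.

Lemma perturbation_le0 (pi : {perm 'I_s}) m (k : 'I_s) : (0 < pi k)%N -> perturbation pi m k <= 0.
Proof.
move=> k0; rewrite /perturbation; case: (boolP known) => [/known_plan[_ [_ [_ [_ [_ [_ [h _]]]]]]]|_].
  exact: h.
by rewrite ltW // eps_neg.
Qed.

Lemma perturbation_drift (pi : {perm 'I_s}) (k : 'I_s) : (0 < pi k)%N ->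
  \sum_(m < b) p m * perturbation pi m k <= - (delta * chi).
Proof.
move=> k0; rewrite /perturbation; case: (boolP known) => [/known_plan[_ [_ [_ [_ [h _]]]]]|_].
  by rewrite h eps_gap.
by rewrite -mulr_suml p1 mul1r eps_gap.
Qed.

Lemma weight_ge0 pi m k : 0 <= base_weight m k + perturbation pi m k.
Proof.
rewrite /base_weight /perturbation.
case: (boolP known) => [/known_plan[_ [_ [_ [_ [_ [_ [_ h]]]]]]]|_]; first by case/andP: (h m k pi).
by case/andP: (eps_range k (pi k)).
Qed.

Definition base_threshold (m : 'I_b) (q : nat) : R := \sum_(l < s | (l < q)%N) base_weight m l.
Definition threshold (pi : {perm 'I_s}) (m : 'I_b) (q : nat) : R :=
  \sum_(l < s | (l < q)%N) (base_weight m l + perturbation pi m l).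

Lemma base_threshold_itv m q : 0 <= base_threshold m q <= 1.
Proof.
apply/andP; split; first by apply: sumr_ge0 => l _; exact: base_weight_ge0.
rewrite -(base_weight_sum m) [leRHS](bigID (fun l : 'I_s => (l < q)%N)) /= lerDl.
by apply: sumr_ge0 => l _; exact: base_weight_ge0.
Qed.

Lemma threshold_itv pi m q : 0 <= threshold pi m q <= 1.
Proof.
apply/andP; split; first by apply: sumr_ge0 => l _; exact: weight_ge0.
have -> : 1 = \sum_(l < s) (base_weight m l + perturbation pi m l).
  by rewrite big_split /= base_weight_sum perturbation_sum addr0.
rewrite [leRHS](bigID (fun l : 'I_s => (l < q)%N)) /= lerDl.
by apply: sumr_ge0 => l _; exact: weight_ge0.
Qed.

Lemma threshold_gap pi m q : `|p m * (threshold pi m q - base_threshold m q)| <= s%:R * chi.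
Proof.
rewrite /threshold big_split /= addrAC subrr add0r mulr_sumr.
apply: (le_trans (ler_norm_sum _ _ _)); apply: (@le_trans _ _ (\sum_(l < s) chi)).
  apply: (@le_trans _ _ (\sum_(l < s) `|p m * perturbation pi m l|)).
    rewrite [leRHS](bigID (fun l : 'I_s => (l < q)%N)) /= lerDl; exact: sumr_ge0.
  by apply: ler_sum => l _; exact: perturbation_le.
by rewrite sumr_const card_ord mulr_natl.
Qed.

Lemma thresholdS pi m (k : 'I_s) :
  threshold pi m k.+1 - threshold pi m k = base_weight m k + perturbation pi m k.
Proof.
rewrite {1}/threshold (bigD1 k) //= [X in _ + X - _](_ : _ = threshold pi m k) ?addrK //.
by apply: eq_bigl => l; rewrite ltnS -val_eqE /= ltn_neqAle andbC.
Qed.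

Lemma threshold_mono pi m (q q' : nat) : (q <= q')%N -> threshold pi m q <= threshold pi m q'.
Proof.
move=> qq; rewrite /threshold [leRHS](bigID (fun l : 'I_s => (l < q)%N)) /=.
rewrite [X in _ <= X + _](eq_bigl (fun l : 'I_s => (l < q)%N)).
  by rewrite lerDl; apply: sumr_ge0 => l _; exact: weight_ge0.
by move=> l /=; case: (ltnP l q) => lq; rewrite ?andbF ?andbT // (leq_trans lq).
Qed.

Lemma route_decisionE zeta m (x : R) (k : 'I_s) :
  (route_decision mu known r eps epsm zeta m x == Some k) =
  (threshold zeta^-1 m k <= x) && (x < threshold zeta^-1 m k.+1).
Proof.
have e q : \sum_(l < s | (l < q)%N) route_weight mu known r eps epsm zeta^-1 m l = threshold zeta^-1 m q.
  by apply: eq_bigr => l _; exact: route_weightE.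
rewrite /route_decision; case: pickP => [k' /andP[]|h].
  rewrite (e k') (e k'.+1) => h1 h2; apply/eqP/andP => [[<-] //|[h3 h4]].
  congr Some; apply/val_inj; apply/eqP; rewrite eqn_leq; apply/andP; split.
    rewrite leqNgt; apply/negP => /(threshold_mono zeta^-1 m) => h; move: h1 h4 h; lra.
  rewrite leqNgt; apply/negP => /(threshold_mono zeta^-1 m) => h; move: h3 h2 h; lra.
by have := h k; rewrite (e k) (e k.+1) => ->.
Qed.

End Policy.

(** * Noise of the interappearance times and service requirements *)

Section CenteredNoise.
Context {d} {Omega : measurableType d} {R : realType} (P : probability Omega R).
Context {I : eqType} (X : I -> Omega -> R).
Hypothesis mX : forall x, measurable_fun setT (X x).
Hypothesis iX : mutual_indep P X.
Variables (chi : nat -> R) (c : R).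
Hypothesis c0 : 0 < c.
Hypothesis hchi : exists N, forall n, (N <= n)%N ->
  [/\ 0 < chi n, chi n <= 1 & 4 <= Num.sqrt n%:R * chi n].
Hypothesis hB : forall Z, exists N, forall n, (N <= n)%N -> Z <= noise_scale n (chi n).

Lemma centered_noise (xi : nat -> Omega -> R) (ix : nat -> I) :
  injective ix -> (forall i, X (ix i) = xi i) ->
  (forall i B, measurable B -> P (xi i @^-1` B) = P (xi 0%N @^-1` B)) ->
  P.-integrable setT (EFin \o xi 0%N) -> (\int[P]_om (xi 0%N om)%:E = 1)%E ->
  (\int[P]_om (xi 0%N om ^+ 4)%:E < +oo)%E ->
  controlled P chi c (fun _ l om => xi l om - 1).
Proof.
move=> ix_inj Xix law xi1 Exi xi4.
have mxi i : measurable_fun setT (xi i) by rewrite -Xix.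
have i1 (k : R) : P.-integrable setT (EFin \o cst k) by exact: finite_measure_integrable_cst.
have mxi4 : measurable_fun setT (fun om => xi 0%N om ^+ 4) by exact: measurable_funX.
have i4 : P.-integrable setT (EFin \o (fun om => xi 0%N om ^+ 4)).
  apply/integrableP; split; first exact/measurable_EFinP.
  rewrite (eq_integral (fun om => (xi 0%N om ^+ 4)%:E)) // => om _ /=.
  by rewrite ger0_norm // exprn_even_ge0.
apply: (iid_noise (Y := fun l om => xi l om - 1)) => //.
- by move=> i; exact: measurable_funB.
- move=> i B mB; pose B' := (fun x : R => x - 1) @^-1` B.
  have mB' : measurable B'.
    by rewrite /B' -[X in measurable X]setTI; exact: measurable_funB.
  exact: law mB'.
- move=> j A B; apply: (family_indep (J := fun i => pred1 (ix i)) mX iX).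
    move=> i; apply: measurable_funB => //; rewrite -Xix.
    move=> mT B' mB'; rewrite setTI; apply: sub_sigma_algebra; apply: cyl_coord => //=.
  by move=> i k x ik /eqP->; apply/negP => /eqP/ix_inj e; rewrite e ltnn in ik.
- have := integrableB measurableT xi1 (i1 1); apply: eq_integrable => // om _ /=.
- rewrite [LHS](_ : _ = \int[P]_om ((xi 0%N om)%:E - 1%:E))%E //.
  rewrite integralB_EFin; [|by []|exact: xi1|exact: (i1 1)].
  transitivity (1%:E - 1%:E : \bar R)%E; last exact: subee.
  congr (_ - _)%E; first exact: Exi.
  apply: (etrans (integral_cst P measurableT 1%:E)).
  by rewrite mul1e; exact: probability_setT.
have i8 := integrableD measurableT (integrableZl measurableT 8 i4) (i1 8).
apply: (le_integrable measurableT _ _ i8).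
  by apply/measurable_EFinP; apply: measurable_funX; exact: measurable_funB.
move=> om _ /=; rewrite lee_fin.
have q4 (y : R) : 0 <= y ^+ 4 by rewrite exprn_even_ge0.
rewrite !ger0_norm ?q4 //; last by apply: addr_ge0 => //; apply: mulr_ge0.
set v := xi 0%N om.
(* [8 v^4 + 8 - (v - 1)^4 = 5 (v^2 - 1)^2 + 2 v^2 (v + 1)^2 + 2 (v + 1)^2] *)
have := sqr_ge0 (v ^+ 2 - 1); have := sqr_ge0 (v * (v + 1)); have := sqr_ge0 (v + 1); nra.
Qed.

End CenteredNoise.

(** * Noise of the decisions along the path of the system *)

Section HitNoise.
Context {d} {Omega : measurableType d} {R : realType} (P : probability Omega R).
Variables (s b : nat) (mu : 'I_s -> R) (dvec : 'I_b -> 'I_s -> R) (p : 'I_b -> R).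
Variables (z : nat -> Omega -> R) (w : 'I_s -> nat -> Omega -> R).
Variables (org : nat -> Omega -> 'I_b) (u : nat -> Omega -> R).
Variables (lam chi : nat -> R) (eps : nat -> 'I_s -> R) (known : bool) (r : 'I_b -> 'I_s -> R).
Variables (epsm : nat -> 'I_b -> 'I_s -> {perm 'I_s} -> R).
Variables (tb : nat -> nat -> ('I_s -> R) -> {perm 'I_s}).
Let X := prim_rv z w org u.
Hypothesis s0 : (0 < s)%N.
Hypothesis mu0 : forall k, 0 < mu k.
Hypothesis p0 : forall m, 0 < p m.
Hypothesis p1 : \sum_(m < b) p m = 1.
Hypothesis mX : forall x, measurable_fun setT (X x).
Hypothesis iX : mutual_indep P X.
Hypothesis org_law : forall j m, P (org j @^-1` [set m]) = (p m)%:E.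
Hypothesis u_law : forall j B, measurable B ->
  P (u j @^-1` B) = (@lebesgue_measure R) (B `&` `[0, 1]).
Hypothesis chi0 : forall n, 0 < chi n.
Hypothesis eps_sum : forall n, \sum_(l < s) eps n l = 0.
Hypothesis eps_first : forall n (l : 'I_s), nat_of_ord l = 0%N -> eps n l = chi n.
Hypothesis eps_neg : forall n (l : 'I_s), (0 < l)%N -> eps n l < 0.
Hypothesis eps_range : forall n (k l : 'I_s), 0 <= mu k / mutot mu + eps n l <= 1.
Hypothesis known_plan : forall n, known -> routing_plan mu p r (eps n) (epsm n).

Definition path_rank (n j : nat) (om : Omega) : {perm 'I_s} :=
  ((ranking mu dvec n (lam n) (z^~ om) (fun k i => w k i om) (org^~ om) (u^~ om)
     known r (eps n) (epsm n) (tb n) j)^-1)%g.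

Lemma mdisc_path_rank n j :
  mdisc (path_rank n j : g_sigma_algebraType (cyl X (past j)) -> {perm 'I_s}).
Proof.
apply: (mdisc_comp (fun x : {perm 'I_s} => (x^-1)%g)).
have mcoord x : past j x ->
    measurable_fun setT (X x : g_sigma_algebraType (cyl X (past j)) -> R).
  by move=> jx mT B mB; rewrite setTI; apply: sub_sigma_algebra; exact: cyl_coord.
apply: (@mdisc_ranking _ (g_sigma_algebraType (cyl X (past j)))).
- by move=> i; exact: (mcoord (inl (inl i))).
- by move=> k i; exact: (mcoord (inl (inr (k, i)))).
- by move=> i ij m; exact: (org_cyl (J := past j)).
- by move=> i ij; exact: (mcoord (inr (inr i))).
Qed.

Hypothesis hchi : exists N, forall n, (N <= n)%N ->
  [/\ 0 < chi n, chi n <= 1 & 4 <= Num.sqrt n%:R * chi n].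
Hypothesis hB : forall Z, exists N, forall n, (N <= n)%N -> Z <= noise_scale n (chi n).
Hypothesis h4 : exists N, forall n, (N <= n)%N -> n%:R <= noise_scale n (chi n) ^+ 4.

Let th n := threshold mu known r (eps n) (epsm n).

Lemma threshold_noise c m q : 0 < c -> controlled P chi c (fun n l om =>
  \1_(routed org u m `]-oo, th n (path_rank n l om) m q[ l) om - p m * th n (path_rank n l om) m q).
Proof.
move=> c0; pose x := base_threshold mu known r m q.
have c2 : 0 < c / 2 by rewrite divr_gt0.
have kn n := @known_plan n.
have /andP[x0 x1] : 0 <= x <= 1.
  exact: (@base_threshold_itv _ _ _ mu p known r (eps 0%N) (epsm 0%N) s0 mu0 (kn 0%N)).
have T01 n a : 0 <= th n a m q <= 1.
  exact: (threshold_itv s0 mu0 (eps_sum n) (eps_range n) (kn n)).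
have base := base_noise mX iX org_law u_law c2 hchi hB m x0 x1.
have s_gt0 : 0 < s%:R :> R by rewrite ltr0n.
have adapt := @adaptive_routing_noise _ _ _ P s b p z w org u mX iX org_law u_law chi (c / 2)
  chi0 c2 hB _ path_rank (fun n a => th n a m q) s%:R m x x0 x1 s_gt0 h4 mdisc_path_rank.
have := controlledD base (adapt _ _ _); rewrite -splitr => h; apply: eq_controlled (h _ _ _).
- by move=> n l om; ring.
- by move=> n a; case/andP: (T01 n a).
- by move=> n a; case/andP: (T01 n a).
- move=> n a; exact: (threshold_gap s0 p0 p1 (eps_sum n) (@eps_first n) (@eps_neg n) (chi0 n) (kn n)).
Qed.

(** A station is chosen when the uniform variable lies between two consecutive thresholds, so the
    decision is a difference of two threshold events, each controlled with half of [c]. *)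
Lemma hit_noise c m k : 0 < c -> controlled P chi c (fun n l om =>
  hit mu dvec n (lam n) (z^~ om) (fun k i => w k i om) (org^~ om) (u^~ om)
     known r (eps n) (epsm n) (tb n) m k l -
  p m * (base_weight mu known r m k + perturbation known (eps n) (epsm n) (path_rank n l om) m k)).
Proof.
move=> c0; have c2 : 0 < c / 2 by rewrite divr_gt0.
have := controlledD (threshold_noise m k.+1 c2) (controlledN (threshold_noise m k c2)).
rewrite -splitr; apply: eq_controlled => n l om.
have kn := @known_plan n.
rewrite -(thresholdS mu known r (eps n) (epsm n) (path_rank n l om) m k) -/(th n).
have -> : hit mu dvec n (lam n) (z^~ om) (fun k i => w k i om) (org^~ om) (u^~ om)
     known r (eps n) (epsm n) (tb n) m k l =
    \1_(routed org u m `]-oo, th n (path_rank n l om) m k.+1[ l) om -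
    \1_(routed org u m `]-oo, th n (path_rank n l om) m k[ l) om.
  rewrite !indic_routed !in_itv /= /hit /decision; case: eqP => [->|_] /=; last by rewrite subr0.
  rewrite (route_decisionE (eps_range n) kn) -/(path_rank n l om) -/(th n).
  have := threshold_mono (eps_range n) kn (path_rank n l om) m (leqnSn k).
  rewrite -/(th n); set T := th n _ m k; set T' := th n _ m k.+1 => TT.
  case: (ltP (u l om) T) => uT /=; last by rewrite subr0.
  by rewrite (lt_le_trans uT TT) subrr.
ring.
Qed.

End HitNoise.

(** * Asymptotics *)

Section Asymptotics.
Context {R : realType}.

Lemma near_eventually (Q : nat -> Prop) : (\forall n \near \oo, Q n) ->
  exists N, forall n, (N <= n)%N -> Q n.
Proof. by move=> [N _ h]; exists N => n; exact: h. Qed.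

Lemma eventually_ge_nat (a : R) : exists N, forall n : nat, (N <= n)%N -> a <= n%:R.
Proof.
exists (Num.bound `|a|) => n Nn; apply: (le_trans (ler_norm a)).
by apply: (le_trans (ltW (archi_boundP (normr_ge0 a)))); rewrite ler_nat.
Qed.

Lemma ln_le_sqrt (y : R) : 0 < y -> ln y <= 2 * Num.sqrt y.
Proof.
move=> y0; have v0 : 0 < Num.sqrt y by rewrite sqrtr_gt0.
rewrite -{1}(sqr_sqrtr (ltW y0)) lnXn // -(mulr_natl (ln _)); apply: ler_wpM2l => //.
exact/ltW/ln_sublinear.
Qed.

Definition log_term (n : nat) (x : R) : R := ln (ln n%:R) + ln (n%:R * x ^+ 2).

Lemma noise_scaleE n x : noise_scale n x = Num.sqrt n%:R * x + log_term n x / x.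
Proof. by []. Qed.

Section Bounds.
Variables (n : nat) (x : R).
Hypothesis x0 : 0 < x.
Hypothesis x1 : x <= 1.
Hypothesis nx : 4 <= Num.sqrt n%:R * x.
Let q := Num.sqrt n%:R : R.

Let q2 : q ^+ 2 = n%:R. Proof. by rewrite sqr_sqrtr. Qed.
Let q4 : 4 <= q.
Proof. have := nx; have := x1; have : 0 <= q by exact: sqrtr_ge0. rewrite -/q; nra. Qed.

Let nx2 : n%:R * x ^+ 2 = (q * x) ^+ 2. Proof. by rewrite exprMn q2. Qed.

Lemma ln_nx2_ge1 : 1 <= ln (n%:R * x ^+ 2).
Proof.
have h := nx; have y0 : 0 < q * x by apply: lt_le_trans nx.
rewrite nx2 lnXn // -(mulr_natl (ln _)).
have iy : (q * x)^-1 <= 4^-1 by rewrite lef_pV2 ?posrE.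
have : ln (1 + ((q * x)^-1 - 1)) <= (q * x)^-1 - 1.
  by apply: le_ln1Dx; rewrite ltrDr invr_gt0.
rewrite addrCA subrr addr0 lnV ?posrE //; lra.
Qed.

Lemma ln_n_ge : ln (n%:R * x ^+ 2) <= ln n%:R.
Proof.
have x01 := x0; have x11 := x1; have h := q4.
have n0 : 0 < n%:R :> R by rewrite -q2 exprn_gt0 //; lra.
rewrite ler_ln ?posrE ?mulr_gt0 ?exprn_gt0 //.
by apply: ler_piMr; [exact: ltW|apply: exprn_ile1 => //; exact: ltW].
Qed.

Lemma lnln_ge0 : 0 <= ln (ln n%:R : R).
Proof. by rewrite ln_ge0 // (le_trans ln_nx2_ge1) // ln_n_ge. Qed.

Lemma log_term_ge1 : 1 <= log_term n x.
Proof. by rewrite /log_term; have := ln_nx2_ge1; have := lnln_ge0; lra. Qed.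

Lemma noise_scale_ge : q * x <= noise_scale n x.
Proof. by rewrite noise_scaleE lerDl divr_ge0 ?(ltW x0) // (le_trans _ log_term_ge1). Qed.

(** The two terms of [noise_scale] have product $\sqrt n$ times [log_term], at least $\sqrt n$; by
    the inequality of arithmetic and geometric means the square of their sum is at least $\sqrt
    n$. *)
Lemma noise_scale_pow4 : n%:R <= noise_scale n x ^+ 4.
Proof.
have B0 : 0 <= noise_scale n x.
  by apply: le_trans noise_scale_ge; apply: le_trans nx.
have B2 : q <= noise_scale n x ^+ 2.
  rewrite noise_scaleE -/q; set l := log_term n x.
  have l1 : 1 <= l := log_term_ge1.
  have e : (q * x) * (l / x) = q * l by rewrite mulrCA -mulrA mulfV ?mulr1 1?mulrC // gt_eqF.
  have := sqr_ge0 (q * x - l / x); have := q4.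
  have : q * 1 <= q * l by apply: ler_wpM2l => //; exact: sqrtr_ge0.
  rewrite sqrrB sqrrD e; lra.
have : q ^+ 2 <= (noise_scale n x ^+ 2) ^+ 2 by rewrite ler_pXn2r ?nnegrE ?sqrtr_ge0 ?exprn_ge0.
by rewrite q2 -exprM.
Qed.

(** In terms of $v = n^{1/4}$, logarithms are at most a multiple of $v$ and $1/x \le v^2/4$. The
    exponent $3/4$ is crude but below 1, which makes the noise negligible against the number of
    customers. *)
Lemma noise_scale_le : noise_scale n x <= 3 * Num.sqrt q ^+ 3.
Proof.
set v := Num.sqrt q; have h4 := q4.
have v2 : v ^+ 2 = q by rewrite sqr_sqrtr //; lra.
have v0 : 0 <= v by exact: sqrtr_ge0.
have v1 : 1 <= v.
  by rewrite -[leLHS]sqrtr1 ler_wsqrtr //; lra.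
have vgt : 0 < v by lra.
have L8 : log_term n x <= 8 * v.
  have ln_n : ln n%:R <= 4 * v.
    rewrite -q2 -v2 -exprM lnXn // -(mulr_natl (ln _)); apply: ler_wpM2l => //.
    exact/ltW/ln_sublinear.
  rewrite /log_term; have := ln_n_ge; have := @ln_sublinear R (ln n%:R).
  have := ln_nx2_ge1; have := ln_n_ge => a1 a2 a3; have := a3 (lt_le_trans ltr01 (le_trans a2 a1)).
  lra.
have ix : x^-1 <= q / 4.
  by rewrite -(ler_pM2r x0) mulVf ?gt_eqF // mulrAC ler_pdivlMr // mul1r; exact: nx.
rewrite noise_scaleE -/q.
have h1 : log_term n x / x <= 8 * v * (q / 4).
  apply: ler_pM => //; first by rewrite (le_trans _ log_term_ge1).
  by rewrite invr_ge0 ltW.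
have h2 : q * x <= q by apply: ler_piMr => //; exact: sqrtr_ge0.
have h3 : v ^+ 3 = v * q by rewrite -v2 -exprS.
have h5 : q <= v * q by apply: ler_peMl => //; exact: sqrtr_ge0.
rewrite h3; lra.
Qed.

End Bounds.

Variable chi : nat -> R.
Hypothesis chi0 : forall n, 0 < chi n.
Hypothesis chi_lim : chi @ \oo --> 0.
Hypothesis nchi_lim : (fun n : nat => Num.sqrt (n%:R) * chi n) @ \oo --> +oo.

Lemma eventually_chi e : 0 < e -> exists N, forall n, (N <= n)%N -> chi n <= e.
Proof.
move=> e0; apply: near_eventually.
have /cvgrPdist_le/(_ e e0) := chi_lim; apply: filterS => n.
by rewrite sub0r normrN => /(le_trans (ler_norm _)).
Qed.

Lemma eventually_nchi a : exists N, forall n, (N <= n)%N -> a <= Num.sqrt n%:R * chi n.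
Proof. by apply: near_eventually; have /cvgryPge/(_ a) := nchi_lim. Qed.

Lemma balance_regime : exists N, forall n, (N <= n)%N ->
  [/\ 0 < chi n, chi n <= 1 & 4 <= Num.sqrt n%:R * chi n].
Proof.
have [N1 h1] := eventually_chi ltr01; have [N2 h2] := eventually_nchi 4.
by exists (maxn N1 N2) => n; rewrite geq_max => /andP[n1 n2]; split; [|exact: h1|exact: h2].
Qed.

Lemma noise_scale_large a : exists N, forall n, (N <= n)%N -> a <= noise_scale n (chi n).
Proof.
have [N1 h1] := balance_regime; have [N2 h2] := eventually_nchi a.
exists (maxn N1 N2) => n; rewrite geq_max => /andP[/h1[x0 x1 nx] /h2 h].
exact: le_trans (noise_scale_ge x0 x1 nx).
Qed.

Lemma noise_scale_pow : exists N, forall n, (N <= n)%N -> n%:R <= noise_scale n (chi n) ^+ 4.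
Proof.
have [N h] := balance_regime; exists N => n /h[x0 x1 nx]; exact: noise_scale_pow4.
Qed.

Lemma noise_scale_small e : 0 < e ->
  exists N, forall n, (N <= n)%N -> noise_scale n (chi n) <= e * n%:R.
Proof.
move=> e0; have [N1 h1] := balance_regime.
have [N2 h2] := eventually_ge_nat ((3 / e) ^+ 4).
exists (maxn N1 N2) => n; rewrite geq_max => /andP[/h1[x0 x1 nx] /h2 h].
apply: (le_trans (noise_scale_le x0 x1 nx)); set v := Num.sqrt _.
have v4 : v ^+ 4 = n%:R by rewrite (exprM v 2 2) !sqr_sqrtr.
have e3 : 0 <= 3 / e by rewrite divr_ge0 // ltW.
have v0 : 0 <= v by exact: sqrtr_ge0.
have ev : 3 / e <= v by rewrite -(@ler_pXn2r _ 4) ?nnegrE // v4.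
have ev3 : 3 <= v * e by rewrite -ler_pdivrMr.
rewrite -v4 (_ : e * v ^+ 4 = v * e * v ^+ 3); last by ring.
apply: ler_wpM2r => //; exact: exprn_ge0.
Qed.

(** With $y = \sqrt n\,\chi_n$, the ratio is $\chi_n + \ln\ln n / y + \ln(y^2)/y$, and each term
    gets $e/3$: the first and last vanish because $\chi_n \to 0$ and $y \to \infty$, the middle one
    by the additional hypothesis. The [12] comes from $\ln(y^2) \le 4\sqrt y$. *)
Lemma log_ratio_small e : 0 < e ->
  (fun n : nat => Num.sqrt (n%:R) * chi n / ln (ln (n%:R))) @ \oo --> +oo ->
  exists N, forall n, (N <= n)%N -> noise_scale n (chi n) / Num.sqrt n%:R <= e.
Proof.
move=> e0 /cvgryPge/(_ (3 / e))/near_eventually[N1 h1].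
have [N2 h2] := balance_regime.
have e3 : 0 < e / 3 by rewrite divr_gt0.
have [N3 h3] := eventually_chi e3.
have [N4 h4] := eventually_nchi ((12 / e) ^+ 2).
exists (maxn (maxn N1 N2) (maxn N3 N4)) => n; rewrite !geq_max.
move=> /andP[/andP[/h1{}h1 /h2[x0 x1 nx]] /andP[/h3{}h3 /h4{}h4]].
set q := Num.sqrt n%:R in nx h1 h4 *.
have q0 : 0 < q by have q_ge0 : 0 <= q := sqrtr_ge0 _; nra.
set x := chi n in x0 x1 nx h1 h3 h4 *.
have -> : noise_scale n x / q = x + log_term n x / (q * x).
  by rewrite noise_scaleE -/q; field; rewrite !gt_eqF.
have y0 : 0 < q * x by rewrite mulr_gt0.
set y := q * x in nx h1 h4 y0 *.
(* Division by 0 gives 0, so a vanishing denominator would contradict the lower bound [h1] on the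
   ratio. *)
have ll0 : 0 < ln (ln n%:R : R).
  rewrite lt_neqAle (lnln_ge0 x0 x1 nx) andbT; apply/negP => /eqP ll.
  have : 0 < 3 / e by rewrite divr_gt0.
  by move: h1; rewrite -ll invr0 mulr0; lra.
have l1 : ln (ln n%:R) / y <= e / 3.
  have : 3 * ln (ln n%:R) <= y * e by move: h1; rewrite ler_pdivlMr // mulrAC ler_pdivrMr.
  by rewrite ler_pdivrMr //; lra.
have l2 : ln (n%:R * x ^+ 2) / y <= e / 3.
  have -> : n%:R * x ^+ 2 = y ^+ 2 by rewrite /y exprMn sqr_sqrtr.
  rewrite lnXn // -(mulr_natl (ln _)) ler_pdivrMr //.
  have hl := ln_le_sqrt y0; set v := Num.sqrt y in hl.
  have v2 : v ^+ 2 = y by rewrite sqr_sqrtr // ltW.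
  have v0 : 0 <= v by exact: sqrtr_ge0.
  have e12 : 0 <= 12 / e by rewrite divr_ge0 // ltW.
  have ev : 12 / e <= v by rewrite -(@ler_pXn2r _ 2) ?nnegrE // v2.
  have ev12 : 12 <= v * e by rewrite -ler_pdivrMr.
  have : 12 * v <= v * e * v by apply: ler_wpM2r.
  have -> : v * e * v = e * y by rewrite -v2; ring.
  lra.
rewrite /log_term mulrDl; lra.
Qed.

End Asymptotics.

(** $\sqrt n\,(1 - lam_n/\mu)$ is bounded, so the excess of the arrival rate is of order $1/\sqrt n$
    and accumulates only a bounded amount over a time of order $\sqrt n$. *)
Lemma heavy_traffic (R : realType) (lam : nat -> R) (mut beta dm : R) : 0 < mut -> 0 <= dm ->
  (fun n : nat => Num.sqrt (n%:R) * (1 - lam n / mut)) @ \oo --> beta ->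
  exists Cb, 0 <= Cb /\ exists N, forall n, (N <= n)%N ->
    [/\ lam n <= 2 * mut, mut / 2 <= lam n &
        (lam n - mut) * (Num.sqrt n%:R * dm + 1) <= Cb].
Proof.
move=> mut0 dm0 /cvgrPdist_le/(_ 1 ltr01)/near_eventually[N1 h1].
pose B := `|beta| + 1; have B0 : 0 < B by rewrite ltr_wpDl.
have [N2 h2] := eventually_ge_nat ((2 * B + 1) ^+ 2).
exists (mut * B * dm + mut); split.
  by rewrite addr_ge0 ?mulr_ge0 // ltW.
exists (maxn N1 N2) => n; rewrite geq_max => /andP[/h1{}h1 /h2{}h2].
set q := Num.sqrt n%:R in h1 *; set e := 1 - lam n / mut in h1.
have q0 : 0 <= q by exact: sqrtr_ge0.
have qB : 2 * B + 1 <= q.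
  by rewrite -(@ler_pXn2r _ 2) ?nnegrE ?sqr_sqrtr //; lra.
have qe : `|q * e| <= B.
  rewrite -(subKr beta (q * e)); apply: (le_trans (ler_normB _ _)); rewrite /B; lra.
have lamE : lam n = mut * (1 - e) by rewrite /e; field; rewrite gt_eqF.
move: qe; rewrite ler_norml => /andP[qe1 qe2].
have e1 : e <= 1 / 2 by nra.
have e2 : - (1 / 2) <= e by nra.
rewrite lamE; split.
- by rewrite mulrC ler_pM2r //; lra.
- by rewrite ler_pM2l //; lra.
have -> : (mut * (1 - e) - mut) * (q * dm + 1) = mut * (- (q * e) * dm) + mut * (- e) by ring.
apply: lerD; last by rewrite ler_piMr ?ltW //; lra.
rewrite -mulrA ler_pM2l //; apply: ler_wpM2r => //; lra.
Qed.

(** If the set has no supremum, [sup] takes the default value 0; otherwise 0 belongs to the set,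
    from equal stations. *)
Lemma imbalance_ge0 (R : realType) (s b : nat) (mu : 'I_s -> R) (dvec : 'I_b -> 'I_s -> R)
    n lam z w org u known r eps epsm tb (T : R) : (0 < s)%N -> 0 <= T ->
  0 <= imbalance mu dvec n lam z w org u known r eps epsm tb T.
Proof.
move=> s0 T0; rewrite /imbalance; set A := [set x | _].
have [hA|/sup_out -> //] := pselect (has_sup A).
apply: sup_ubound; first by case: hA.
by exists 0, (Ordinal s0), (Ordinal s0); rewrite lexx T0 subrr normr0.
Qed.

(** * Almost sure bound on the imbalance by the noise scale *)

Section Regime.
Context {d} {Omega : measurableType d} {R : realType} (P : probability Omega R).
Variables (s b : nat) (mu : 'I_s -> R) (dvec : 'I_b -> 'I_s -> R) (p : 'I_b -> R).
Variables (z : nat -> Omega -> R) (w : 'I_s -> nat -> Omega -> R).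
Variables (org : nat -> Omega -> 'I_b) (u : nat -> Omega -> R).
Variables (lam chi : nat -> R) (eps : nat -> 'I_s -> R) (known : bool) (r : 'I_b -> 'I_s -> R).
Variables (epsm : nat -> 'I_b -> 'I_s -> {perm 'I_s} -> R).
Variables (tb : nat -> nat -> ('I_s -> R) -> {perm 'I_s}) (beta delta : R).
Let X := prim_rv z w org u.
Hypothesis s0 : (0 < s)%N.
Hypothesis mu0 : forall k, 0 < mu k.
Hypothesis mu_mono : forall k l : 'I_s, (k <= l)%N -> mu k <= mu l.
Hypothesis d0 : forall m k, 0 <= dvec m k.
Hypothesis p0 : forall m, 0 < p m.
Hypothesis p1 : \sum_(m < b) p m = 1.
Hypothesis mX : forall x, measurable_fun setT (X x).
Hypothesis iX : mutual_indep P X.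
Hypothesis z_law : forall i B, measurable B -> P (z i @^-1` B) = P (z 0%N @^-1` B).
Hypothesis z_ge0 : P (z 0%N @^-1` `]-oo, 0[) = 0%E.
Hypothesis z1 : P.-integrable setT (EFin \o z 0%N).
Hypothesis Ez : (\int[P]_om (z 0%N om)%:E = 1)%E.
Hypothesis z4 : (\int[P]_om (z 0%N om ^+ 4)%:E < +oo)%E.
Hypothesis w_law : forall k i B, measurable B -> P (w k i @^-1` B) = P (w k 0%N @^-1` B).
Hypothesis w_ge0 : forall k, P (w k 0%N @^-1` `]-oo, 0[) = 0%E.
Hypothesis w1 : forall k, P.-integrable setT (EFin \o w k 0%N).
Hypothesis Ew : forall k, (\int[P]_om (w k 0%N om)%:E = 1)%E.
Hypothesis w4 : forall k, (\int[P]_om (w k 0%N om ^+ 4)%:E < +oo)%E.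
Hypothesis org_law : forall j m, P (org j @^-1` [set m]) = (p m)%:E.
Hypothesis u_law : forall j B, measurable B ->
  P (u j @^-1` B) = (@lebesgue_measure R) (B `&` `[0, 1]).
Hypothesis tb_sort : forall n j (L : 'I_s -> R) (l1 l2 : 'I_s), (l1 <= l2)%N ->
  L (tb n j L l1) <= L (tb n j L l2).
Hypothesis lam0 : forall n, 0 < lam n.
Hypothesis chi0 : forall n, 0 < chi n.
Hypothesis eps_sum : forall n, \sum_(l < s) eps n l = 0.
Hypothesis eps_first : forall n (l : 'I_s), nat_of_ord l = 0%N -> eps n l = chi n.
Hypothesis eps_neg : forall n (l : 'I_s), (0 < l)%N -> eps n l < 0.
Hypothesis eps_range : forall n (k l : 'I_s), 0 <= mu k / mutot mu + eps n l <= 1.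
Hypothesis delta0 : 0 < delta.
Hypothesis eps_gap : forall n (l : 'I_s), (0 < l)%N -> eps n l <= - (delta * chi n).
Hypothesis known_plan : forall n, known -> routing_plan mu p r (eps n) (epsm n).
Hypothesis lam_lim : (fun n : nat => Num.sqrt (n%:R) * (1 - lam n / mutot mu)) @ \oo --> beta.
Hypothesis chi_lim : chi @ \oo --> 0.
Hypothesis nchi_lim : (fun n : nat => Num.sqrt (n%:R) * chi n) @ \oo --> +oo.

Let ae_ge0 (xi : nat -> Omega -> R) : (forall i, measurable_fun setT (xi i)) ->
  (forall i B, measurable B -> P (xi i @^-1` B) = P (xi 0%N @^-1` B)) ->
  P (xi 0%N @^-1` `]-oo, 0[) = 0%E ->
  {ae P, forall om, forall i, 0 <= xi i om}.
Proof.
move=> mxi law xi0; apply: ae_foralln => i.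
exists (xi i @^-1` `]-oo, 0[); split.
- by rewrite -[X in measurable X]setTI; exact: mxi.
- by apply: (etrans (law i _ _)) => //; exact: xi0.
by move=> om /= /negP; rewrite in_itv /= -ltNge.
Qed.

Lemma imbalance_noise : exists C : R, 0 < C /\ forall T : R, 0 < T ->
  {ae P, forall om, exists N, forall n, (N <= n)%N ->
     sys_imbalance mu dvec lam z w org u known r eps epsm tb om n T <=
     C * (noise_scale n (chi n) / Num.sqrt n%:R)}.
Proof.
have regime := balance_regime chi0 chi_lim nchi_lim.
have large := noise_scale_large chi0 chi_lim nchi_lim.
have pow := noise_scale_pow chi0 chi_lim nchi_lim.
have mut0 : 0 < mutot mu := mutot_gt0 s0 mu0.
pose dm := \sum_(m < b) \sum_(k < s) dvec m k.
have dm0 : 0 <= dm by apply: sumr_ge0 => m _; exact: sumr_ge0.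
have d_le m k : dvec m k <= dm.
  rewrite /dm (bigD1 m) //= (bigD1 k) //= -addrA lerDl addr_ge0 ?sumr_ge0 //.
  by move=> i _; exact: sumr_ge0.
pose mmin := mu (Ordinal s0).
have mmin_le k : mmin <= mu k by exact: mu_mono.
have [Cb [Cb0 [Nl hl]]] := heavy_traffic mut0 dm0 lam_lim.
pose D := drift_const (b := b) mu delta dm mmin.
(* The slope of the noise is fixed first, small against the drift as [c0_small] demands. This is not
   circular: [D] involves neither [c] nor the noise constants, which depend on [c]. *)
pose c := Num.min (1 / 2) (delta / 2 / (`|D| + 1)).
have D1 : 0 < `|D| + 1 by rewrite ltr_wpDl.
have c0 : 0 < c by rewrite lt_min !divr_gt0.
have c_half : c <= 1 / 2 by rewrite ge_min lexx.
have Dc : D * c <= delta / 2.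
  apply: (@le_trans _ _ ((`|D| + 1) * (delta / 2 / (`|D| + 1)))).
    apply: (@le_trans _ _ ((`|D| + 1) * c)).
      by apply: ler_wpM2r; [exact: ltW|have := ler_norm D; lra].
    by apply: ler_wpM2l; [exact: ltW|rewrite ge_min lexx orbT].
  by rewrite mulrC divfK // gt_eqF.
have noise0 : exists N, forall n, (N <= n)%N -> 0 <= noise_scale n (chi n) := large 0.
have izJ : injective (fun i => inl (inl i) : prim_index s) by move=> i j [].
have [Cz [Cz0 hz]] := centered_noise mX iX c0 regime large izJ (fun=> erefl) z_law z1 Ez z4.
have iwJ k : injective (fun i => inl (inr (k, i)) : prim_index s) by move=> i j [].
have [Cw [Cw0 hw]] := controlled_family noise0 (fun k =>
  centered_noise mX iX c0 regime large (iwJ k) (fun=> erefl) (w_law k) (w1 k) (Ew k) (w4 k)).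
have [Ch [Ch0 hh]] := controlled_family noise0 (fun mk : 'I_b * 'I_s =>
  hit_noise dvec lam tb s0 mu0 p0 p1 mX iX org_law u_law chi0 eps_sum eps_first eps_neg eps_range
    known_plan regime large pow mk.1 mk.2 c0).
pose CC := 1 + Cz + Cw + Ch.
have CC1 : 1 <= CC by rewrite /CC; lra.
pose IC := imbalance_const (b := b) mu delta dm mmin Cb.
exists (`|IC| * CC + 1); split; first by rewrite ltr_wpDl // mulr_ge0 //; lra.
move=> T T0.
have mT : 0 <= mutot mu * (T + 1) by apply: mulr_ge0; lra.
(* The first [K * n] customers must reach beyond time $nT + 1$. Deviations of the walk cost at most
   half of $Kn$ plus [n], and $lam \le 2\mu$, so $K/2 - 1 \ge 2\mu(T+1)$ suffices. *)
pose K := Num.bound (4 * mutot mu * (T + 1) + 2).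
have hK : 4 * mutot mu * (T + 1) + 2 <= K%:R.
  by apply/ltW/archi_boundP; lra.
have mz i : measurable_fun setT (z i) by exact: (mX (inl (inl i))).
have mw k i : measurable_fun setT (w k i) by exact: (mX (inl (inr (k, i)))).
have zw_ge0 : {ae P, forall om, (forall i, 0 <= z i om) /\ forall k i, 0 <= w k i om}.
  apply: (ae_and (ae_ge0 mz z_law z_ge0)).
  exact: (ae_forall (fun k => ae_ge0 (mw k) (w_law k) (w_ge0 k))).
apply: filterS2 zw_ge0 (ae_and (hz K) (ae_and (hw K) (hh K))) => om [zom wom].
move=> [[N1 h1] [[N2 h2] [N3 h3]]].
have CCi : 0 < CC^-1 by rewrite invr_gt0; lra.
have [N4 h4] := regime; have [N5 h5] := large 1.
have [N6 h6] := noise_scale_small chi0 chi_lim nchi_lim CCi.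
exists (maxn 1 (maxn (maxn N1 (maxn N2 N3)) (maxn (maxn N4 Nl) (maxn N5 N6)))) => n.
rewrite !geq_max => /andP[n0 /andP[/andP[/h1{}h1 /andP[/h2{}h2 /h3{}h3]]]].
move=> /andP[/andP[/h4[x0 x1 nx] /hl[lam2 lam_half lam_drift]] /andP[/h5{}h5 /h6{}h6]].
set B := noise_scale n (chi n) in h1 h2 h3 h5 h6 *.
have CB1 : 1 <= CC * B by rewrite -[leLHS]mulr1; apply: ler_pM.
have CBn : CC * B <= n%:R.
  by move: h6; rewrite mulrC ler_pdivlMr ?(mulrC B) //; lra.
have up C' v (t : R) : C' <= CC -> t <= v + C' * B -> t <= v + CC * B.
  move=> C'C /le_trans; apply; rewrite lerD2l; apply: ler_wpM2r => //; lra.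
have Kn0 : (0 < K * n)%N.
  rewrite muln_gt0 n0 andbT -(ltr_nat R); apply: lt_le_trans hK.
  lra.
have HM : n%:R * T + 1 <= appear (lam n) (fun i => z i om) (K * n).-1.
  rewrite /appear prednK // ler_pdivlMr // -(big_mkord xpredT (fun i => z i om)).
  have := h1 0%N (K * n)%N (leq0n _) (leqnn _).
  rewrite big_split /= sumrN sumr_const_nat subn0 ler_norml => /andP[hsum _].
  have n1 : 1 <= n%:R :> R by rewrite ler1n.
  have CzB : Cz * B <= n%:R.
    apply: le_trans CBn; apply: ler_wpM2r; [lra|rewrite /CC; lra].
  have half : c * chi n * (K * n)%:R <= 1 / 2 * (K * n)%:R.
    apply: ler_wpM2r => //; rewrite -[leRHS]mulr1; apply: ler_pM => //; exact: ltW.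
  have t1 : (n%:R * T + 1) * lam n <= n%:R * (T + 1) * (2 * mutot mu).
    apply: ler_pM => //; first by rewrite addr_ge0 // mulr_ge0 // ltW.
      exact: ltW.
    by rewrite mulrDr mulr1 lerD2l.
  have t2 : n%:R * (4 * mutot mu * (T + 1) + 2) <= n%:R * K%:R by apply: ler_wpM2l.
  rewrite natrM in hsum half; lra.
have sq0 : 0 < Num.sqrt n%:R :> R by rewrite sqrtr_gt0 ltr0n.
have kn := known_plan.
pose pert l := perturbation known (eps n) (epsm n)
   (path_rank mu dvec z w org u lam eps known r epsm tb n l om).
apply: (@le_trans _ _ (IC * (CC * B) / Num.sqrt n%:R)); last first.
  rewrite !mulrA ler_pM2r ?invr_gt0 //; apply: ler_wpM2r; first by lra.
  have := ler_norm IC; have : 0 <= CC by lra.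
  move=> CC0 /(ler_wpM2r CC0); lra.
have hz' a e : (a <= e)%N -> (e <= K * n)%N ->
    `|\sum_(a <= i < e) (z i om - 1)| <= c * chi n * (e - a)%N%:R + CC * B.
  by move=> ae eK; apply: (up Cz) (h1 a e ae eK); rewrite /CC; lra.
have hw' k a e : (a <= e)%N -> (e <= K * n)%N ->
    `|\sum_(a <= i < e) (w k i om - 1)| <= c * chi n * (e - a)%N%:R + CC * B.
  by move=> ae eK; apply: (up Cw) (h2 k a e ae eK); rewrite /CC; lra.
have hh' m k a e (ae : (a <= e)%N) (eK : (e <= K * n)%N) :=
  up Ch _ _ (ltac:(rewrite /CC; lra)) (h3 (m, k) a e ae eK).
apply: (imbalance_le mu0 d0 (lam0 n) zom wom Kn0 HM x0 (ltW c0) _ CB1 hz' hw' (tb_sort n) p0 p1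
  (wt := base_weight mu known r) (pert := pert) _ _ _ _ _ _ _ (ltW delta0) dm0 d_le x1 _ lam2 mut0
  hh' (mu0 (Ordinal s0)) mmin_le Cb0 lam_drift lam_half _ Dc n0 T0 s0 (lexx _)).
- by rewrite -[leRHS]mulr1; apply: ler_pM => //; exact: ltW.
- exact: (base_weight_ge0 s0 mu0 (kn n)).
- exact: (base_weight_sum s0 mu0 (kn n)).
- exact: (base_weight_mean s0 mu0 p1 (kn n)).
- move=> l m k.
  exact: (perturbation_le s0 p0 p1 (eps_sum n) (@eps_first n) (@eps_neg n) x0 (kn n)).
- move=> l m; exact: (perturbation_sum (eps_sum n) (kn n)).
- move=> l m k; exact: (perturbation_le0 (@eps_neg n) (kn n)).
- move=> l k; exact: (perturbation_drift p1 (@eps_gap n) (kn n)).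
- apply: (le_trans (noise_scale_ge x0 x1 nx)); rewrite -/B -[leLHS]mul1r; apply: ler_wpM2r => //; lra.
- lra.
Qed.

End Regime.

Unset Implicit Arguments.
Set Strict Implicit.

Theorem theorem2 (R : realType) (d : measure_display) (Omega : measurableType d)
  (P : probability Omega R) (s b : nat)
  (mu : 'I_s -> R) (dvec : 'I_b -> 'I_s -> R) (p : 'I_b -> R)
  (z : nat -> Omega -> R) (w : 'I_s -> nat -> Omega -> R)
  (org : nat -> Omega -> 'I_b) (u : nat -> Omega -> R)
  (lam chi : nat -> R) (eps : nat -> 'I_s -> R)
  (known : bool) (r : 'I_b -> 'I_s -> R)
  (epsm : nat -> 'I_b -> 'I_s -> {perm 'I_s} -> R)
  (tb : nat -> nat -> ('I_s -> R) -> {perm 'I_s}) (beta : R) :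
  (* stations, rates, origins *)
  (2 <= s)%N -> (1 <= b)%N ->
  (forall k, 0 < mu k) -> (forall k l : 'I_s, (k <= l)%N -> mu k <= mu l) ->
  (forall m k, 0 <= dvec m k) -> (forall m, 0 < p m) -> \sum_(m < b) p m = 1 ->
  (* primitives: measurable and mutually independent *)
  (forall x, measurable_fun setT (prim_rv z w org u x)) ->
  mutual_indep P (prim_rv z w org u) ->
  (* (1) interappearance variables *)
  (forall i B, measurable B -> P (z i @^-1` B) = P (z 0%N @^-1` B)) ->
  P (z 0%N @^-1` `]-oo, 0[) = 0%E ->
  P.-integrable setT (EFin \o z 0%N) -> ('E_P[z 0%N] = 1)%E ->
  P.-integrable setT (EFin \o (fun x => z 0%N x ^+ 2)) ->
  (* (2) service requirements *)
  (forall k i B, measurable B -> P (w k i @^-1` B) = P (w k 0%N @^-1` B)) ->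
  (forall k, P (w k 0%N @^-1` `]-oo, 0[) = 0%E) ->
  (forall k, P.-integrable setT (EFin \o w k 0%N)) -> (forall k, ('E_P[w k 0%N] = 1)%E) ->
  (forall k, P.-integrable setT (EFin \o (fun x => w k 0%N x ^+ 2))) ->
  (* (3) origins: gamma(j) = dvec (org j) *)
  (forall j m, P (org j @^-1` [set m]) = (p m)%:E) ->
  (* (4) uniform(0,1) variables *)
  (forall j B, measurable B ->
     P (u j @^-1` B) = (@lebesgue_measure R) (B `&` `[0, 1])) ->
  (* RJSQ policy: tie-breaking rule sorts the stations by load *)
  (forall n j (L : 'I_s -> R) (l1 l2 : 'I_s), (l1 <= l2)%N ->
     L (tb n j L l1) <= L (tb n j L l2)) ->
  (forall n, 0 < lam n) -> (forall n, 0 < chi n) ->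
  (* perturbation coefficients *)
  (forall n, \sum_(l < s) eps n l = 0) ->
  (forall n (l : 'I_s), nat_of_ord l = 0%N -> eps n l = chi n) ->
  (forall n (l : 'I_s), (0 < l)%N -> eps n l < 0) ->
  (forall n (k l : 'I_s), 0 <= mu k / mutot mu + eps n l <= 1) ->
  (exists delta0 : R, 0 < delta0 /\
     forall n (l : 'I_s), (0 < l)%N -> eps n l <= - (delta0 * chi n)) ->
  (* known origins: routing plan and origin-dependent coefficients *)
  (known ->
     (forall m k, 0 <= r m k <= 1) /\
     (forall m, \sum_(k < s) r m k = 1) /\
     (forall k, mu k = mutot mu * \sum_(m < b) p m * r m k) /\
     (forall n m (pi : {perm 'I_s}), \sum_(l < s) epsm n m l pi = 0) /\
     (forall n (l : 'I_s) (pi : {perm 'I_s}),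
        \sum_(m < b) p m * epsm n m l pi = eps n l) /\
     (forall n m (l : 'I_s) (pi : {perm 'I_s}), nat_of_ord l = 0%N ->
        0 <= epsm n m l pi) /\
     (forall n m (l : 'I_s) (pi : {perm 'I_s}), (0 < l)%N ->
        epsm n m l pi <= 0) /\
     (forall n m (k : 'I_s) (pi : {perm 'I_s}),
        0 <= r m k + epsm n m (pi k) pi <= 1)) ->
  (* heavy-traffic and balancing-fraction regime *)
  (fun n : nat => Num.sqrt (n%:R) * (1 - lam n / mutot mu)) @ \oo --> beta ->
  chi @ \oo --> 0 ->
  (fun n : nat => Num.sqrt (n%:R) * chi n) @ \oo --> +oo ->
  (* fourth moments *)
  (\int[P]_x ((z 0%N x ^+ 4)%:E) + \sum_(k < s) \int[P]_x ((w k 0%N x ^+ 4)%:E)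
     < +oo)%E ->
  ((fun n : nat => Num.sqrt (n%:R) * chi n / Num.sqrt (ln (ln (n%:R))))
      @ \oo --> +oo ->
   exists C C' : R, 0 < C /\ 0 < C' /\
     forall T : R, 0 < T ->
       {ae P, forall om, exists N : nat, forall n : nat, (N <= n)%N ->
         sys_imbalance mu dvec lam z w org u known r eps epsm tb om n T
         < Num.max (C * chi n)
             (C' * (ln (ln (n%:R)) + ln (n%:R * chi n ^+ 2))
                 / (Num.sqrt (n%:R) * chi n))})
  /\
  ((fun n : nat => Num.sqrt (n%:R) * chi n / ln (ln (n%:R))) @ \oo --> +oo ->
   forall T : R, 0 < T ->
     {ae P, forall om,
       (fun n : nat => sys_imbalance mu dvec lam z w org u known r eps epsm tb om n T)
         @ \oo --> 0}).
Proof.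
move=> s2 _ mu0 mu_mono d0 p0 p1 mX iX z_law z_ge0 z1 Ez _ w_law w_ge0 w1 Ew _ org_law u_law
  tb_sort lam0 chi0 eps_sum eps_first eps_neg eps_range [delta [delta0 eps_gap]] known_plan
  lam_lim chi_lim nchi_lim m4.
have s0 : (0 < s)%N by exact: ltnW.
have plan n : known -> routing_plan mu p r (eps n) (epsm n).
  move=> /known_plan[h1 [h2 [h3 [h4 [h5 [h6 [h7 h8]]]]]]].
  exact: (conj h1 (conj h2 (conj h3 (conj (h4 n) (conj (h5 n) (conj (h6 n) (conj (h7 n) (h8 n)))))))).
have pow4 (xi : Omega -> R) : (0 <= \int[P]_x ((xi x ^+ 4)%:E))%E.
  by apply: integral_ge0 => x _; rewrite lee_fin exprn_even_ge0.
have w4_ge0 : (0 <= \sum_(k < s) \int[P]_x ((w k 0%N x ^+ 4)%:E))%E.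
  by apply: sume_ge0 => k _; exact: pow4.
have z4 : (\int[P]_om (z 0%N om ^+ 4)%:E < +oo)%E.
  by apply: le_lt_trans m4; exact: leeDl.
have w4 k : (\int[P]_om (w k 0%N om ^+ 4)%:E < +oo)%E.
  apply: le_lt_trans m4; rewrite (bigD1 k) //= addeCA; apply: leeDl.
  by apply: adde_ge0 => //; apply: sume_ge0 => i _; exact: pow4.
rewrite unlock in Ez.
have Ew' k : (\int[P]_om (w k 0%N om)%:E = 1)%E by have := Ew k; rewrite unlock.
have [C [C0 hC]] := imbalance_noise s0 mu0 mu_mono d0 p0 p1 mX iX z_law z_ge0 z1 Ez z4
  w_law w_ge0 w1 Ew' w4 org_law u_law tb_sort lam0 chi0 eps_sum eps_first eps_neg eps_range
  delta0 eps_gap plan lam_lim chi_lim nchi_lim.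
split=> [_|log_lim].
  have [N1 hN1] := balance_regime chi0 chi_lim nchi_lim.
  have C20 : 0 < 2 * C + 1 by lra.
  (* A sum is at most twice the maximum, and the additional 1 makes the inequality strict, the
     maximum being positive. *)
  exists (2 * C + 1), (2 * C + 1); split=> //; split=> // T T0.
  apply: filterS (hC T T0) => om [N hN]; exists (maxn N1 N) => n.
  rewrite geq_max => /andP[/hN1[x0 x1 nx] /hN{}hN].
  apply: (le_lt_trans hN); set x := chi n in x0 x1 nx *; set q := Num.sqrt n%:R in nx *.
  have q0 : 0 < q by have q_ge0 : 0 <= q := sqrtr_ge0 _; nra.
  have -> : noise_scale n x / q = x + log_term n x / (q * x).
    by rewrite noise_scaleE -/q; field; rewrite !gt_eqF.
  rewrite -mulrA -/(log_term n x).
  have : 0 <= log_term n x / (q * x).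
    by rewrite divr_ge0 ?mulr_ge0 ?ltW // (lt_le_trans _ (log_term_ge1 x0 x1 nx)).
  set y := log_term n x / (q * x) => y0; rewrite lt_max.
  by have [xy|yx] := leP x y; apply/orP; [right|left]; nra.
move=> T T0; apply: filterS (hC T T0) => om [N hN].
apply/cvgrPdist_le => e e0.
have eC : 0 < e / C by rewrite divr_gt0.
have [N1 hN1] := log_ratio_small chi0 chi_lim nchi_lim eC log_lim.
exists (maxn N N1) => // n /=; rewrite geq_max => /andP[/hN{}hN /hN1{}hN1].
rewrite sub0r normrN ger0_norm; last by apply: imbalance_ge0 => //; exact: ltW.
apply: (le_trans hN); move: hN1; rewrite ler_pdivlMr //; lra.
Qed.
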